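(* Let $D$ be a convex $n$-gon in the plane. Then there is a positive integer $m$ (depending on $D$) such that every finite set $S$ of points in the plane admits a coloring of its points with $3$ colors such that every homothetic copy of $D$ that contains at least $m$ points of $S$ contains two points of $S$ having different colors.
   Context: A homothetic copy (homothet) of a planar set $D$ is a set of the form $\lambda D + v=\{\lambda x+v : x\in D\}$ with $\lambda>0$ and $v\in\mathbb{R}^2$ (scaling and translation only, no rotation). *)

(* Defs.v *)
From HB Require Import structures.
From mathcomp Require Export all_boot all_order all_algebra.
From mathcomp Require Export boolp classical_sets functions cardinality reals.

Set Implicit Arguments.
Unset Strict Implicit.
Unset Printing Implicit Defensive.

Import GRing.Theory Num.Theory.
Local Open Scope classical_set_scope.
Local Open Scope ring_scope.

Definition conv_hull (R : realType) (V : lmodType R) (I : finType)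
    (p : I -> V) : set V :=
  [set x | exists w : I -> R,
    [/\ forall i, 0 <= w i, \sum_i w i = 1 & x = \sum_i w i *: p i]].

(* [p \o lift i] enumerates the points [p j] with [j != i].  Since no vertex is
   a convex combination of the others and there are at least three of them, the
   vertices are distinct and not collinear, so D is a nondegenerate closed
   polygonal region with exactly n vertices. *)
Definition convex_ngon (R : realType) (n : nat) (D : set 'rV[R]_2) : Prop :=
  (3 <= n)%N /\
  exists p : 'I_n -> 'rV[R]_2,
    (forall i, ~ conv_hull (p \o lift i) (p i)) /\ D = conv_hull p.

Definition homothet (R : realType) (V : lmodType R) (D H : set V) : Prop :=
  exists (l : R) (v : V), 0 < l /\ H = [set l *: x + v | x in D].

(* Main.v *)
(** A homothet [l D + v] is encoded by the vector [f = (v, - l)]: a point belongs to it iff the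
    side functionals of the cone over [D] are at least as large at the point as at [f].

    After a perturbation making the points generic, join two points when some homothet contains
    exactly these two. This graph is plane, so it is 5-degenerate and has a 3-colouring [c] with
    acyclic colour classes, while every homothet induces a connected subgraph; hence a
    monochromatic homothet induces a tree. In each monochromatic homothet [W] with exactly [T]
    points pick a point [p] of degree at least two in [W] that is extreme for no side, and give
    [p] the next colour. To keep at most one recoloured point per [W], points carry labels,
    boundedly many and distinct inside each [W], and are processed by label.

    Suppose a large homothet [F] ends up monochromatic. Its recoloured points of largest label
    are tips: each is the only common point of its [W] with [F]. Among many tips three would
    leave [F] through the same two sides, which the geometry of nested homothets forbids, so the
    tips are boundedly many. Deleting a point from [F] leaves a set covered by boundedly many
    smaller homothets, so a large homothet inside [F] avoids these tips. Repeating this for each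
    label gives a large monochromatic homothet with no recoloured point, which is absurd. *)

Require Import Defs.
From mathcomp Require Import ring lra zify fintype finset.

Set Implicit Arguments.
Unset Strict Implicit.
Unset Printing Implicit Defensive.

Import Order.TTheory GRing.Theory Num.Theory.
Local Open Scope ring_scope.

(** * Side functionals and noncrossing homothets *)

(** Why the recoloured point has these two properties: in the final argument it is a tip, and all
    other points of its [W] lie outside [F]. Degree two gives two neighbours outside [F]. If both
    neighbours of one tip lay in the [W] of another tip, adding the first tip to that [W] would give
    a monochromatic set with a cycle; so each tip always offers a neighbour that the other [W]
    misses. If this neighbour leaves [F] through side [s], then, the tip not being extreme for [s],
    another point of [W] leaves through a different side. These two exits feed the three-tip
    argument. Why largest labels give tips: a point of [W] in [F] has both the old and the new
    colour in common with the tip, so it is recoloured too. Its label is not larger, by maximality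
    in [F], and not smaller, by the processing order; equal labels inside [W] mean equal points. The
    constants depend on each other in the order: covering number [C], tree size [T], [6 ^ T] labels,
    number of tips, and [m] by one round of avoidance per label. *)

Definition det3 (R : realType) (u v w : R * R * R) : R :=
  u.1.1 * (v.1.2 * w.2 - v.2 * w.1.2) - u.1.2 * (v.1.1 * w.2 - v.2 * w.1.1)
  + u.2 * (v.1.1 * w.1.2 - v.1.2 * w.1.1).

Definition vadd (R : realType) (u : R * R * R) (a : R) (v : R * R * R) : R * R * R :=
  (u.1.1 + a * v.1.1, u.1.2 + a * v.1.2, u.2 + a * v.2).

(* The polygon sits at height [1] in homogeneous coordinates; the cone over it is both
   generated by the vertices and cut out by the functionals of the sides
   [(vtx j, vtx (nxt j))]. *)
Record polygon (R : realType) := Polygon {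
  side :> finType;
  vtx : side -> R * R * R;
  nxt : side -> side;
  vtx_t : forall j, (vtx j).2 = 1;
  vtx_side : forall j l, l != j -> l != nxt j -> 0 < det3 (vtx j) (vtx (nxt j)) (vtx l);
  vtx_off : forall j, exists l, (l != j) && (l != nxt j);
  cone_gen : forall z, (forall j, 0 <= det3 (vtx j) (vtx (nxt j)) z) ->
    exists w : side -> R, [/\ forall l, 0 <= w l,
      z.1.1 = \sum_l w l * (vtx l).1.1, z.1.2 = \sum_l w l * (vtx l).1.2
      & z.2 = \sum_l w l]
}.

(** Read [(x, y)] as gradients in the basis of two crossing directions: up to the weights, [i]
    points right, [j] left and [k] up. If [j] is reached from [i] by a counterclockwise turn of at
    most a half circle, then [k] lies inside that turn. *)
Lemma interleave_half (R : realType) (a a' b xi yi xj yj xk yk : R) :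
  0 < a -> 0 < a' -> 0 < b -> 0 < xi -> xj < 0 -> 0 < yk ->
  b * yi < a * xi -> b * yj < - (a' * xj) -> a * xk < b * yk -> - (a' * xk) < b * yk ->
  0 <= xi * yj - xj * yi -> 0 < xi * yk - xk * yi.
Proof.
move=> a0 a'0 b0 xi0 xj0 yk0 H1 H2 H3 H4 D.
have xy0 : 0 < xi * yk by rewrite mulr_gt0.
have [yi0|yi0] := leP 0 yi; have [xk0|xk0] := leP 0 xk.
- have M : (a * xk) * (b * yi) < (b * yk) * (a * xi).
    by rewrite ltr_pM // mulr_ge0 // ltW.
  have : 0 < (a * b) * (xi * yk - xk * yi) by lra.
  by rewrite pmulr_rgt0 // mulr_gt0.
- have := mulr_le0_ge0 (ltW xk0) yi0; lra.
- have := mulr_ge0_le0 xk0 (ltW yi0); lra.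
have yj0 : 0 < yj.
  rewrite -(pmulr_rgt0 _ xi0); have := mulr_gt0 (_ : 0 < - xj) (_ : 0 < - yi).
  by rewrite !oppr_gt0 => /(_ xj0 yi0); lra.
have M : (- (a' * xk)) * (b * yj) < (b * yk) * (- (a' * xj)).
  rewrite ltr_pM // ?oppr_ge0; first by rewrite mulr_ge0_le0 // ltW.
  by rewrite mulr_ge0 // ltW.
have M1 : 0 < xk * yj - xj * yk.
  have : 0 < (a' * b) * (xk * yj - xj * yk) by lra.
  by rewrite pmulr_rgt0 // mulr_gt0.
have M2 : 0 < (- xj) * (xi * yk - xk * yi).
  have := mulr_gt0 xi0 M1; have := mulr_le0_ge0 (ltW xk0) D; lra.
by move: M2; rewrite pmulr_rgt0 // oppr_gt0.
Qed.

Section Functionals.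
Variables (R : realType) (P : polygon R).
Implicit Types (i j k l : P) (z h f g : R * R * R).

Definition n1 j : R := (vtx j).1.2 * (vtx (nxt j)).2 - (vtx j).2 * (vtx (nxt j)).1.2.
Definition n2 j : R := (vtx j).2 * (vtx (nxt j)).1.1 - (vtx j).1.1 * (vtx (nxt j)).2.
Definition n3 j : R := (vtx j).1.1 * (vtx (nxt j)).1.2 - (vtx j).1.2 * (vtx (nxt j)).1.1.
Definition L j z : R := n1 j * z.1.1 + n2 j * z.1.2 + n3 j * z.2.

Lemma LE j z : L j z = det3 (vtx j) (vtx (nxt j)) z.
Proof. by rewrite /L /n1 /n2 /n3 /det3; ring. Qed.

Lemma L_vadd j z a h : L j (vadd z a h) = L j z + a * L j h.
Proof. by rewrite /L /vadd /=; ring. Qed.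

Lemma L_vtx_self j : L j (vtx j) = 0.
Proof. by rewrite LE /det3; ring. Qed.

Lemma L_vtx_nxt j : L j (vtx (nxt j)) = 0.
Proof. by rewrite LE /det3; ring. Qed.

Lemma L_vtx_gt0 j l : l != j -> l != nxt j -> 0 < L j (vtx l).
Proof. by rewrite LE; exact: vtx_side. Qed.

Lemma L_vtx_ge0 j l : 0 <= L j (vtx l).
Proof.
have [->|ne1] := eqVneq l j; first by rewrite L_vtx_self.
have [->|ne2] := eqVneq l (nxt j); first by rewrite L_vtx_nxt.
exact: ltW (L_vtx_gt0 ne1 ne2).
Qed.

(** Only the constant terms can differ. At [vtx k] the functional [L k] vanishes while [L i] and
    [L j] are nonnegative, whence [n3 k <= a * n3 i + b * n3 j]. *)
Lemma L_cone i j k (a b : R) h : 0 <= a -> 0 <= b -> 0 <= h.2 ->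
  n1 k = a * n1 i + b * n1 j -> n2 k = a * n2 i + b * n2 j ->
  L k h <= a * L i h + b * L j h.
Proof.
move=> a0 b0 h0 e1 e2.
have := L_vtx_self k; have := L_vtx_ge0 i k; have := L_vtx_ge0 j k.
rewrite {1 2 3}/L e1 e2 vtx_t => Hj Hi H0.
have H3 : n3 k - a * n3 i - b * n3 j <= 0.
  have := mulr_ge0 a0 Hi; have := mulr_ge0 b0 Hj; lra.
have : (n3 k - a * n3 i - b * n3 j) * h.2 <= 0 by rewrite mulr_le0_ge0.
by rewrite /L e1 e2; lra.
Qed.

(** Opposite normals cancel and leave a multiple of the height; the factor is positive because some
    vertex lies off side [j]. *)
Lemma L_opp i j (c : R) h : 0 <= c -> n1 j = - c * n1 i -> n2 j = - c * n2 i ->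
  exists2 K, 0 < K & L j h + c * L i h = K * h.2.
Proof.
move=> c0 e1 e2; exists (n3 j + c * n3 i); last by rewrite /L e1 e2; ring.
have [l /andP[l1 l2]] := vtx_off j.
have := L_vtx_gt0 l1 l2; have := mulr_ge0 c0 (L_vtx_ge0 i l).
rewrite /L e1 e2 vtx_t; lra.
Qed.

Lemma L_opp_false i j (c : R) h : 0 <= c -> n1 j = - c * n1 i -> n2 j = - c * n2 i ->
  0 <= h.2 -> L j h < 0 -> L i h < 0 -> False.
Proof.
move=> c0 e1 e2 h0 Hj Hi; have [K K0 E] := L_opp h c0 e1 e2.
have := mulr_ge0 (ltW K0) h0; rewrite -E => H.
have := mulr_ge0_le0 c0 (ltW Hi); lra.
Qed.

Lemma L_cone_false i j k (a b : R) h : 0 <= a -> 0 <= b -> 0 <= h.2 ->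
  n1 k = a * n1 i + b * n1 j -> n2 k = a * n2 i + b * n2 j ->
  L i h < 0 -> L j h < 0 -> 0 < L k h -> False.
Proof.
move=> a0 b0 h0 e1 e2 Hi Hj Hk.
have := L_cone a0 b0 h0 e1 e2.
have := mulr_ge0_le0 a0 (ltW Hi); have := mulr_ge0_le0 b0 (ltW Hj); lra.
Qed.

Definition pt (x : R * R) : R * R * R := (x.1, x.2, 0).
(* [f = (v, - l)] with [0 < l] stands for the homothet [l D + v]. *)
Definition inF f (x : R * R) : bool := [forall j, L j f <= L j (pt x)].

Lemma inFP f x : reflect (forall j, L j f <= L j (pt x)) (inF f x).
Proof. exact: forallP. Qed.

Lemma inFPn f x : reflect (exists j, L j (pt x) < L j f) (~~ inF f x).
Proof.
apply: (iffP idP) => [|[j Hj]].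
  by rewrite negb_forall => /existsP[j]; rewrite -ltNge; exists j.
by apply/forallPn; exists j; rewrite -ltNge.
Qed.

Definition onseg (p q : R * R) (a : R) : R * R :=
  (p.1 + a * (q.1 - p.1), p.2 + a * (q.2 - p.2)).

Lemma L_onseg j p q a : L j (pt (onseg p q a)) = (1 - a) * L j (pt p) + a * L j (pt q).
Proof. by rewrite /L /onseg /=; ring. Qed.

(** Sides [i], [j] cut [p], [q] off from [g], and [k], [l] cut [r], [s] off from [f]. As the
    segments meet, these normals alternate around the circle, so [k] or [l] is a nonnegative
    combination of [i] and [j], or [i] and [j] are opposite. Since [f] is not the larger homothet,
    [h] has nonnegative height, and its signs (negative at [i], [j], positive at [k], [l])
    contradict [L_cone] or [L_opp]. *)
Lemma noncross_wlog f g p q r s (a b : R) : g.2 <= f.2 ->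
  inF f p -> inF f q -> ~~ inF g p -> ~~ inF g q ->
  inF g r -> inF g s -> ~~ inF f r -> ~~ inF f s ->
  0 <= a <= 1 -> 0 <= b <= 1 -> onseg p q a = onseg r s b -> False.
Proof.
move=> hfg /inFP fp /inFP fq /inFPn[i gp] /inFPn[j gq] /inFP gr /inFP gs /inFPn[k fr] /inFPn[l fs].
move=> /andP[a0 a1] /andP[b0 b1] E.
pose h := vadd f (-1) g.
have h0 : 0 <= h.2 by rewrite /h /=; lra.
have Lh m : L m h = L m f - L m g by rewrite L_vadd; ring.
have hi : L i h < 0 by rewrite Lh; have := fp i; lra.
have hj : L j h < 0 by rewrite Lh; have := fq j; lra.
have hk : 0 < L k h by rewrite Lh; have := gr k; lra.
have hl : 0 < L l h by rewrite Lh; have := gs l; lra.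
(* Increments of [L m] along the two segments: the coordinates of normal [m] in the basis of the two
   directions. [D] below is the cross product of two normals up to the common factor [De]. *)
pose x m := L m (pt q) - L m (pt p); pose y m := L m (pt s) - L m (pt r).
have Ez m : L m (pt p) + a * x m = L m (pt r) + b * y m.
  have := L_onseg m p q a; have := L_onseg m r s b; rewrite E /x /y => -> H; lra.
have xE m : x m = n1 m * (q.1 - p.1) + n2 m * (q.2 - p.2) by rewrite /x /L /=; ring.
have yE m : y m = n1 m * (s.1 - r.1) + n2 m * (s.2 - r.2) by rewrite /y /L /=; ring.
pose De := (q.1 - p.1) * (s.2 - r.2) - (q.2 - p.2) * (s.1 - r.1).
pose D m m' := x m * y m' - x m' * y m.
have DE m m' : D m m' = De * (n1 m * n2 m' - n1 m' * n2 m).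
  by rewrite /D /De !xE !yE; ring.
have i1 : b * y i < a * x i by have := Ez i; have := gr i; lra.
have i2 : - ((1 - b) * y i) < a * x i by have := Ez i; have := gs i; rewrite /y; lra.
have j1 : b * y j < - ((1 - a) * x j) by have := Ez j; have := gr j; rewrite /x; lra.
have j2 : - ((1 - b) * y j) < - ((1 - a) * x j)
  by have := Ez j; have := gs j; rewrite /x /y; lra.
have k1 : a * x k < b * y k by have := Ez k; have := fp k; lra.
have k2 : - ((1 - a) * x k) < b * y k by have := Ez k; have := fq k; rewrite /x; lra.
have l1 : a * x l < - ((1 - b) * y l) by have := Ez l; have := fp l; rewrite /y; lra.
have l2 : - ((1 - a) * x l) < - ((1 - b) * y l)
  by have := Ez l; have := fq l; rewrite /x /y; lra.
have xi : 0 < a * x i.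
  have [y0|y0] := leP 0 (y i); first by apply: le_lt_trans i1; rewrite mulr_ge0.
  by apply: le_lt_trans i2; rewrite oppr_ge0 mulr_ge0_le0 ?subr_ge0 // ltW.
have xj : 0 < - ((1 - a) * x j).
  have [y0|y0] := leP 0 (y j); first by apply: le_lt_trans j1; rewrite mulr_ge0.
  by apply: le_lt_trans j2; rewrite oppr_ge0 mulr_ge0_le0 ?subr_ge0 // ltW.
have yk : 0 < b * y k.
  have [x0|x0] := leP 0 (x k); first by apply: le_lt_trans k1; rewrite mulr_ge0.
  by apply: le_lt_trans k2; rewrite oppr_ge0 mulr_ge0_le0 ?subr_ge0 // ltW.
have yl : 0 < - ((1 - b) * y l).
  have [x0|x0] := leP 0 (x l); first by apply: le_lt_trans l1; rewrite mulr_ge0.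
  by apply: le_lt_trans l2; rewrite oppr_ge0 mulr_ge0_le0 ?subr_ge0 // ltW.
have split_gt0 (u v : R) : 0 <= u -> 0 < u * v -> 0 < u /\ 0 < v.
  move=> u0 uv; have u1 : 0 < u by rewrite lt_neqAle u0 eq_sym andbT; apply: contraTneq uv => ->; rewrite mul0r ltxx.
  by split=> //; rewrite -(pmulr_rgt0 _ u1).
have [a_gt0 xi0] := split_gt0 _ _ a0 xi.
have [a'_gt0 xj0] : 0 < 1 - a /\ x j < 0.
  by rewrite -(oppr_gt0 (x j)); apply: split_gt0; rewrite ?subr_ge0 // mulrN.
have [b_gt0 yk0] := split_gt0 _ _ b0 yk.
have [b'_gt0 yl0] : 0 < 1 - b /\ 0 < - y l.
  by apply: split_gt0; rewrite ?subr_ge0 // mulrN.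
(* Cramer's rule, writing normal [m''] in terms of [m] and [m']. *)
have ID m m' m'' : D m m' * n1 m'' = D m'' m' * n1 m + D m m'' * n1 m'.
  by rewrite !DE; ring.
have ID2 m m' m'' : D m m' * n2 m'' = D m'' m' * n2 m + D m m'' * n2 m'.
  by rewrite !DE; ring.
have [Dij|Dij] := leP 0 (D i j).
  have Dik : 0 < D i k.
    exact: (interleave_half a_gt0 a'_gt0 b_gt0 xi0 xj0 yk0 i1 j1 k1 k2 Dij).
  have Dkj : 0 < D k j.
    have := @interleave_half _ (1 - a) a b (- x j) (y j) (- x i) (y i) (- x k) (y k)
      a'_gt0 a_gt0 b_gt0 _ _ yk0 _ _ _ _ _.
    rewrite oppr_gt0 oppr_lt0 /D => H.
    have {}H : 0 < - x j * y k - - x k * y j by apply: H; rewrite ?mulrN ?opprK //; rewrite /D in Dij; lra.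
    lra.
  move: Dij; rewrite le_eqVlt => /predU1P[D0|Dij].
    have := ID i j k; have := ID2 i j k; rewrite -D0 !mul0r => e2 e1.
    apply: (@L_opp_false i j (D k j / D i k) h) => //; first by rewrite divr_ge0 // ltW.
      by apply: (mulfI (lt0r_neq0 Dik)); rewrite mulrA mulrN mulrCA mulfV ?lt0r_neq0 // mulr1; lra.
    by apply: (mulfI (lt0r_neq0 Dik)); rewrite mulrA mulrN mulrCA mulfV ?lt0r_neq0 // mulr1; lra.
  apply: (@L_cone_false i j k (D k j / D i j) (D i k / D i j) h) => //;
    rewrite ?divr_ge0 ?(ltW Dkj) ?(ltW Dik) ?(ltW Dij) //.
    by apply: (mulfI (lt0r_neq0 Dij)); rewrite ID; field; rewrite lt0r_neq0.
  by apply: (mulfI (lt0r_neq0 Dij)); rewrite ID2; field; rewrite lt0r_neq0.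
have Dil : D i l < 0.
  have := @interleave_half _ a (1 - a) (1 - b) (x i) (- y i) (x j) (- y j) (x l) (- y l)
      a_gt0 a'_gt0 b'_gt0 xi0 xj0 yl0 _ _ _ _ _.
  rewrite /D in Dij *; rewrite !mulrN => H.
  have {}H : 0 < - (x i * y l) - - (x l * y i) by apply: H => //; lra.
  lra.
have Dlj : D l j < 0.
  have := @interleave_half _ (1 - a) a (1 - b) (- x j) (- y j) (- x i) (- y i) (- x l) (- y l)
      a'_gt0 a_gt0 b'_gt0 _ _ yl0 _ _ _ _ _.
  rewrite oppr_gt0 oppr_lt0 /D in Dij *; rewrite !mulrN !mulNr !opprK => H.
  have {}H : 0 < x j * y l - x l * y j by apply: H => //; lra.
  lra.
have Dn : D i j != 0 by rewrite lt_eqF.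
apply: (@L_cone_false i j l (D l j / D i j) (D i l / D i j) h) => //.
- by rewrite -mulrNN -invrN divr_ge0 ?oppr_ge0 // ltW.
- by rewrite -mulrNN -invrN divr_ge0 ?oppr_ge0 // ltW.
- by apply: (mulfI Dn); rewrite ID; field.
by apply: (mulfI Dn); rewrite ID2; field.
Qed.

Lemma noncross f g p q r s (a b : R) :
  inF f p -> inF f q -> ~~ inF g p -> ~~ inF g q ->
  inF g r -> inF g s -> ~~ inF f r -> ~~ inF f s ->
  0 <= a <= 1 -> 0 <= b <= 1 -> onseg p q a = onseg r s b -> False.
Proof.
move=> H1 H2 H3 H4 H5 H6 H7 H8 Ha Hb E.
have [gf|fg] := leP g.2 f.2; first exact: (@noncross_wlog f g p q r s a b).
by apply: (@noncross_wlog g f r s p q b a) => //; rewrite ltW.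
Qed.
End Functionals.

(** * Pencils of lines through a common point of two sides *)

Section Tips.
Variables (R : realType) (P : polygon R).
Implicit Types (i j k l s t : P) (f g h : R * R * R) (p q u w x y z : R * R).

(** [L_cone] forces both vertices of side [i] onto side [j]. If [i != j], side [i] would then start
    at [nxt j] and run back along side [j] or have length zero; a vertex off side [i] excludes
    both. *)
Lemma normals_indep i j (c : R) : 0 < c -> n1 i = c * n1 j -> n2 i = c * n2 j -> i = j.
Proof.
move=> c0 e1 e2; apply/eqP/negPn/negP => ij.
have le1 h : 0 <= h.2 -> L i h <= c * L j h.
  by move=> h0; have := @L_cone _ P j j i c 0 h (ltW c0) (lexx _) h0; rewrite !mul0r !addr0 => ->.
have c0' : c != 0 by rewrite gt_eqF.
have le2 h : 0 <= h.2 -> c * L j h <= L i h.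
  move=> h0; have := @L_cone _ P i i j c^-1 0 h.
  rewrite invr_ge0 (ltW c0) !mul0r !addr0 e1 e2 !mulrA mulVf // !mul1r => /(_ isT (lexx _) h0 erefl erefl).
  by rewrite mulrC ler_pdivlMr // mulrC.
have t1 l : 0 <= (vtx l).2 by rewrite vtx_t.
have jz l : (l == i) || (l == nxt i) -> (l == j) || (l == nxt j).
  move=> Hl; apply/negPn/negP; rewrite negb_or => /andP[n1' n2'].
  have := L_vtx_gt0 n1' n2'; have := le2 _ (t1 l).
  have -> : L i (vtx l) = 0 by case/orP: Hl => /eqP->; rewrite ?L_vtx_self ?L_vtx_nxt.
  by move=> H1 H2; have := mulr_gt0 c0 H2; lra.
have H1 : i = nxt j by have := jz i; rewrite eqxx (negbTE ij) => /(_ isT) /eqP.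
have [l /andP[l1 l2]] := vtx_off i.
have := jz (nxt i); rewrite eqxx orbT => /(_ isT)/orP[]/eqP H2.
  have := L_vtx_gt0 l1 l2; have := @L_vtx_ge0 _ P j l; rewrite !LE H2 -H1 /det3.
  lra.
have := L_vtx_gt0 l1 l2; rewrite LE H2 -H1 /det3; lra.
Qed.

Section Pencil.
Variables (g : R * R * R) (s t : P).
(** [E j] is the homogeneous equation of the line through side [j] of the homothet [g]. The vector
    [de] is the cross product of the equations of [s] and [t], hence their common point, at infinity
    when [de.2 = 0]. *)
Definition E j (X : R * R * R) : R := n1 j * X.1.1 + n2 j * X.1.2 - L j g * X.2.
Definition hom x : R * R * R := (x.1, x.2, 1).
Definition de : R * R * R :=
  (- (n2 s * L t g) + n2 t * L s g, - (n1 t * L s g) + n1 s * L t g, n1 s * n2 t - n2 s * n1 t).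

Lemma E_hom j x : E j (hom x) = L j (pt x) - L j g.
Proof. by rewrite /E /L /hom /pt /=; ring. Qed.

Lemma E_vadd j X (a : R) Y : E j (vadd X a Y) = E j X + a * E j Y.
Proof. by rewrite /E /vadd /=; ring. Qed.

Hypothesis st : s != t.

(** Two independent equations have a line of solutions, spanned by their cross product. If [de]
    vanished, the equations would be proportional, with a positive factor as both are positive at
    [p], against [normals_indep]. *)
Lemma kernel X p : 0 < E s (hom p) -> 0 < E t (hom p) -> E s X = 0 -> E t X = 0 ->
  exists o : R, X = (o * de.1.1, o * de.1.2, o * de.2).
Proof.
move=> sp tp sX tX.
have X1 : X.1.2 * de.2 = X.2 * de.1.2.
  have : X.1.2 * de.2 - X.2 * de.1.2 = n1 s * E t X - n1 t * E s X by rewrite /de /E /=; ring.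
  by rewrite sX tX; lra.
have X2 : X.2 * de.1.1 = X.1.1 * de.2.
  have : X.2 * de.1.1 - X.1.1 * de.2 = n2 s * E t X - n2 t * E s X by rewrite /de /E /=; ring.
  by rewrite sX tX; lra.
have X3 : X.1.1 * de.1.2 = X.1.2 * de.1.1.
  have : X.1.1 * de.1.2 - X.1.2 * de.1.1 = L t g * E s X - L s g * E t X by rewrite /de /E /=; ring.
  by rewrite sX tX; lra.
pose N := de.1.1 ^+ 2 + de.1.2 ^+ 2 + de.2 ^+ 2.
have N0 : N != 0.
  apply/eqP => N0.
  have [d1 d2 d3] : [/\ de.1.1 = 0, de.1.2 = 0 & de.2 = 0].
    have := sqr_ge0 de.1.1; have := sqr_ge0 de.1.2; have := sqr_ge0 de.2; rewrite /N in N0 => a b c.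
    by split; apply/eqP; rewrite -sqrf_eq0; apply/eqP; lra.
  pose c := E s (hom p) / E t (hom p).
  have c0 : 0 < c by rewrite divr_gt0.
  have tn : E t (hom p) != 0 by rewrite gt_eqF.
  have cE : c * E t (hom p) = E s (hom p) by rewrite /c divfK.
  case/eqP: st; apply: (@normals_indep s t c c0); apply: (mulfI tn);
    rewrite mulrA [_ * c]mulrC cE.
  - move: d1 d2 d3; rewrite /de /E /= => d1 d2 d3.
    have e1 : n1 s * n2 t = n2 s * n1 t by lra.
    have e2 : n1 s * L t g = n1 t * L s g by lra.
    by have := congr1 ( *%R p.2) e1; lra.
  - move: d1 d2 d3; rewrite /de /E /= => d1 d2 d3.
    have e1 : n1 s * n2 t = n2 s * n1 t by lra.
    have e2 : n2 s * L t g = n2 t * L s g by lra.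
    by have := congr1 ( *%R p.1) e1; lra.
case: X X1 X2 X3 sX tX => [[x1 x2] x3]; cbn [fst snd] => X1 X2 X3 _ _.
pose S := x1 * de.1.1 + x2 * de.1.2 + x3 * de.2.
exists (S / N).
have e1 : x1 = S / N * de.1.1.
  apply: (mulfI N0); rewrite mulrA mulrCA mulfV // mulr1 /S /N.
  have -> : (x1 * de.1.1 + x2 * de.1.2 + x3 * de.2) * de.1.1
    = x1 * de.1.1 ^+ 2 + x2 * de.1.1 * de.1.2 + x3 * de.1.1 * de.2 by ring.
  by rewrite -X3 X2; ring.
have e2 : x2 = S / N * de.1.2.
  apply: (mulfI N0); rewrite mulrA mulrCA mulfV // mulr1 /S /N.
  have -> : (x1 * de.1.1 + x2 * de.1.2 + x3 * de.2) * de.1.2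
    = x1 * de.1.2 * de.1.1 + x2 * de.1.2 ^+ 2 + x3 * de.1.2 * de.2 by ring.
  by rewrite X3 -X1; ring.
have e3 : x3 = S / N * de.2.
  apply: (mulfI N0); rewrite mulrA mulrCA mulfV // mulr1 /S /N.
  have -> : (x1 * de.1.1 + x2 * de.1.2 + x3 * de.2) * de.2
    = x1 * de.2 * de.1.1 + x2 * de.2 * de.1.2 + x3 * de.2 ^+ 2 by ring.
  by rewrite X1 -X2; ring.
by rewrite -e1 -e2 -e3.
Qed.

(* [y = al * p + o * de] in homogeneous coordinates: [y] lies on the line joining
   [p] to the common point of the side lines [s] and [t], possibly at infinity. *)
Definition onray p y (al o : R) :=
  [/\ 0 <= al, y.1 = al * p.1 + o * de.1.1, y.2 = al * p.2 + o * de.1.2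
    & 1 = al + o * de.2].

Lemma onray_ex p y al : 0 < E s (hom p) -> 0 < E t (hom p) -> 0 <= al ->
  E s (hom y) = al * E s (hom p) -> E t (hom y) = al * E t (hom p) ->
  exists o, onray p y al o.
Proof.
move=> sp tp al0 es et.
have [||o []] := @kernel (vadd (hom y) (- al) (hom p)) p sp tp.
- by rewrite E_vadd es; ring.
- by rewrite E_vadd et; ring.
by rewrite /= => e1 e2 e3; exists o; split=> //=; lra.
Qed.

(** The affine function [G] vanishes on the line through [p] and [de] and changes sign between [q]
    and [x], so the segment meets that line. *)
Lemma curve_pt p q x : 0 < E s (hom p) -> 0 < E t (hom p) ->
  0 < E s (hom q) -> 0 < E t (hom q) -> E s (hom x) = 0 -> 0 <= E t (hom x) ->
  E s (hom p) * E t (hom q) <= E s (hom q) * E t (hom p) ->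
  exists (a al o : R), 0 <= a <= 1 /\ onray p (onseg q x a) al o.
Proof.
move=> sp tp sq tq sx tx H.
pose G y := E s (hom y) * E t (hom p) - E t (hom y) * E s (hom p).
have Gq : 0 <= G q by rewrite /G; lra.
have Gx : G x <= 0 by rewrite /G sx mul0r sub0r oppr_le0 mulr_ge0 // ltW.
have [a a01 Ga] : exists2 a, 0 <= a <= 1 & (1 - a) * G q + a * G x = 0.
  have [d0|d0] := eqVneq (G q - G x) 0.
    by exists 0; rewrite ?lexx ?ler01 //; lra.
  have d1 : 0 < G q - G x by rewrite lt_neqAle eq_sym d0; lra.
  exists (G q / (G q - G x)); last by field.
  by rewrite divr_ge0 ?(ltW d1) //= ler_pdivrMr // mul1r; lra.
have Eo j : E j (hom (onseg q x a)) = (1 - a) * E j (hom q) + a * E j (hom x).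
  by rewrite /E /=; ring.
pose al := E s (hom (onseg q x a)) / E s (hom p).
have sp0 : E s (hom p) != 0 by rewrite gt_eqF.
case/andP: a01 => a0 a1.
have al0 : 0 <= al.
  apply: divr_ge0; last exact: ltW.
  by rewrite Eo sx mulr0 addr0; apply: mulr_ge0; [rewrite subr_ge0 | exact: ltW].
have [|o Ho] := @onray_ex p (onseg q x a) al sp tp al0 (esym (divfK sp0 _)).
  apply: (mulIf sp0); rewrite /al mulrAC divfK //.
  by move: Ga; rewrite !Eo /G; lra.
by exists a, al, o; rewrite a0 a1.
Qed.

End Pencil.

(** With [r = o' / o > 0], eliminating [de] from the two ray equations gives
    [r al p + y' = r y + al' q]. Both sides have total weight [r + al']; dividing by it gives the
    common point. *)
Lemma rays_meet g s t p q y y' (al o al' o' : R) :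
  onray g s t p y al o -> onray g s t q y' al' o' -> 0 < o * o' ->
  exists a b : R, [/\ 0 <= a <= 1, 0 <= b <= 1 & onseg p y' a = onseg y q b].
Proof.
move=> [al0 y1 y2 yt] [al0' y1' y2' yt'] oo.
set d1 := (de g s t).1.1 in y1 y1'; set d2 := (de g s t).1.2 in y2 y2'.
set d3 := (de g s t).2 in yt yt'.
have o0 : o != 0 by apply: contraTneq oo => ->; rewrite mul0r ltxx.
have oo' : 0 < o' / o.
  have -> : o' / o = o * o' / (o * o) by field.
  by rewrite divr_gt0 // lt_neqAle eq_sym mulf_neq0 // -expr2 sqr_ge0.
set r := o' / o in oo'; have Eo' : o' = r * o by rewrite /r divfK.
have D0 : 0 < r + al' by lra.
have Dn : r + al' != 0 by rewrite gt_eqF.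
exists (1 / (r + al')), (al' / (r + al')).
have ra : al' = 1 - r * o * d3 by rewrite -Eo'; lra.
have ra1 : r + al' - 1 = r * al by have -> : al = 1 - o * d3; [lra | rewrite ra; ring].
split.
- rewrite divr_ge0 ?ler01 ?(ltW D0) //= ler_pdivrMr // mul1r.
  by have := mulr_ge0 (ltW oo') al0; lra.
- by rewrite divr_ge0 ?(ltW D0) //= ler_pdivrMr // mul1r; lra.
have yal : al = (r + al' - 1) / r by rewrite ra1 mulrAC mulfV ?mul1r // gt_eqF.
have r0 : r != 0 by rewrite gt_eqF.
rewrite /onseg y1 y2 y1' y2' Eo' yal; congr pair; field; rewrite Dn r0 //.
Qed.

Lemma pos_factor (a b : R) : 0 <= a -> 0 < b * a -> 0 < b.
Proof.
move=> a0 ba; rewrite ltNge; apply/negP => b0.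
by have := mulr_le0_ge0 b0 a0; lra.
Qed.

(** Write the normals [k] and [l] in the basis [s], [t]. Side [k] of [f] cuts off the common point
    of [s] and [t] but not [x] and [z], so [k] has positive coordinates; this settles [0 <= h.2].
    Otherwise [- h] has positive height, and the position of [l] makes [s] or [t] a nonnegative
    combination of [k] and [l], or [k] and [l] opposite: each contradicts the signs of [- h]. *)
Lemma nested_nonparallel g f s t k l pc x z :
  let h := vadd f (-1) g in let d := de g s t in
  d.2 != 0 -> E f k d / d.2 < 0 -> 0 <= E f l d / d.2 -> E f l (hom pc) < 0 ->
  0 < E g s (hom pc) -> 0 < E g t (hom pc) ->
  E g s (hom x) = 0 -> 0 <= E g t (hom x) -> 0 <= E f k (hom x) ->
  E g t (hom z) = 0 -> 0 <= E g s (hom z) -> 0 <= E f k (hom z) ->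
  L s h < 0 -> L t h < 0 -> 0 < L k h -> 0 < L l h -> False.
Proof.
move=> h d d0 kd ld lc sc tc sx tx kx tz sz kz hs ht hk hl.
pose A (m : P) := (n1 m * n2 t - n2 m * n1 t) / d.2.
pose B (m : P) := (n1 s * n2 m - n2 s * n1 m) / d.2.
have d2E : d.2 = n1 s * n2 t - n2 s * n1 t by [].
have e1 (m : P) : n1 m = A m * n1 s + B m * n1 t by rewrite /A /B; rewrite d2E in d0 *; field.
have e2 (m : P) : n2 m = A m * n2 s + B m * n2 t by rewrite /A /B; rewrite d2E in d0 *; field.
have Em (m : P) X : E f m X = A m * E g s X + B m * E g t X + E f m d / d.2 * X.2.
  rewrite /A /B; rewrite d2E in d0 *; rewrite /E /d /de /=; field; exact: d0.
have Ak : 0 < A k.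
  by apply: (pos_factor sz); move: kz; rewrite Em tz mulr0 addr0 /= mulr1; lra.
have Bk : 0 < B k.
  by apply: (pos_factor tx); move: kx; rewrite Em sx mulr0 add0r /= mulr1; lra.
have [h0|h0] := leP 0 h.2.
  exact: (L_cone_false (ltW Ak) (ltW Bk) h0 (e1 k) (e2 k)).
pose h' := vadd (0, 0, 0) (-1) h.
have h'0 : 0 <= h'.2 by rewrite /h' /vadd /=; move: h0; rewrite /h /=; lra.
have Lh' (m : P) : L m h' = - L m h by rewrite L_vadd /L /=; ring.
have hs' : 0 < L s h' by rewrite Lh'; lra.
have ht' : 0 < L t h' by rewrite Lh'; lra.
have hk' : L k h' < 0 by rewrite Lh'; lra.
have hl' : L l h' < 0 by rewrite Lh'; lra.
have AB : A l * E g s (hom pc) + B l * E g t (hom pc) < 0.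
  by move: lc; rewrite Em /= mulr1; lra.
pose D := A k * B l - A l * B k.
have [D0|D0|D0] := ltgtP D 0.
- have Bl : B l <= 0.
    rewrite leNgt; apply/negP => Bl.
    have Al : 0 < A l.
      by apply: (pos_factor (ltW Bk)); have := mulr_gt0 Ak Bl; rewrite /D in D0; lra.
    by have := mulr_gt0 Al sc; have := mulr_gt0 Bl tc; lra.
  apply: (@L_cone_false _ P k l s (- B l / - D) (B k / - D) h') => //.
  + by rewrite divr_ge0 // oppr_ge0 // ltW.
  + by rewrite divr_ge0 ?oppr_ge0 // ltW.
  + by rewrite (e1 k) (e1 l) /D; field; rewrite -/(D) lt_eqF.
  + by rewrite (e2 k) (e2 l) /D; field; rewrite -/(D) lt_eqF.
- have Al : A l <= 0.
    rewrite leNgt; apply/negP => Al.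
    have Bl : 0 < B l.
      by apply: (pos_factor (ltW Ak)); have := mulr_gt0 Al Bk; rewrite /D in D0; lra.
    by have := mulr_gt0 Al sc; have := mulr_gt0 Bl tc; lra.
  apply: (@L_cone_false _ P k l t (- A l / D) (A k / D) h') => //.
  + by rewrite divr_ge0 // ?oppr_ge0 // ltW.
  + by rewrite divr_ge0 // ltW.
  + by rewrite (e1 k) (e1 l) /D; field; rewrite -/(D) gt_eqF.
  + by rewrite (e2 k) (e2 l) /D; field; rewrite -/(D) gt_eqF.
have Akn : A k != 0 by rewrite gt_eqF.
have BlE : B l = A l * B k / A k.
  by apply: (mulIf Akn); rewrite divfK //; rewrite /D in D0; lra.
have Al : A l < 0.
  rewrite ltNge; apply/negP => Al.
  have Bl : 0 <= B l
    by rewrite BlE; apply: divr_ge0; [apply: mulr_ge0 => //; exact: ltW | exact: ltW].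
  by have := mulr_ge0 Al (ltW sc); have := mulr_ge0 Bl (ltW tc); lra.
apply: (@L_opp_false _ P k l (- A l / A k) h') => //.
- by rewrite divr_ge0 ?oppr_ge0 // ltW.
- by rewrite (e1 k) (e1 l) BlE; field.
- by rewrite (e2 k) (e2 l) BlE; field.
Qed.

(** Now [s] and [t] have opposite normals and [d] is a direction. The signs at [s], [t] force
    [h.2 < 0]. As [k] and [l] have opposite signs at [d], a positive combination of them is a
    multiple [ze] of the normal of [s]; the sign of [ze] selects [s], [t] or an opposite pair for
    the contradiction. *)
Lemma nested_parallel g f s t k l :
  let h := vadd f (-1) g in let d := de g s t in s != t ->
  d.2 = 0 -> E f k d < 0 -> 0 < E f l d ->
  L s h < 0 -> L t h < 0 -> 0 < L k h -> 0 < L l h -> False.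
Proof.
move=> h d st d0 kd ld hs ht hk hl.
have d2E : n1 s * n2 t = n2 s * n1 t by move: d0; rewrite /d /=; lra.
have ns0 : (n1 s != 0) || (n2 s != 0).
  rewrite -negb_and; apply/negP => /andP[/eqP z1 /eqP z2].
  have [l' /andP[a1 a2]] := vtx_off s.
  have := L_vtx_gt0 a1 a2; have := @L_vtx_self _ P s; rewrite /L z1 z2 !vtx_t; lra.
have [c c1 c2] : exists2 c, n1 t = c * n1 s & n2 t = c * n2 s.
  case/orP: ns0 => n0.
    by exists (n1 t / n1 s); [rewrite divfK | apply: (mulIf n0); rewrite mulrAC divfK //; lra].
  by exists (n2 t / n2 s); [apply: (mulIf n0); rewrite mulrAC divfK //; lra | rewrite divfK].
have c0 : c <= 0.
  rewrite leNgt; apply/negP => c0; case/eqP: st.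
  exact/esym/(normals_indep c0 c1 c2).
have h0 : h.2 < 0.
  rewrite ltNge; apply/negP => h0.
  apply: (@L_opp_false _ P s t (- c) h) => //; by rewrite ?oppr_ge0 ?opprK.
pose h' := vadd (0, 0, 0) (-1) h.
have h'0 : 0 <= h'.2 by rewrite /h' /vadd /=; move: h0; rewrite /h /=; lra.
have Lh' (m : P) : L m h' = - L m h by rewrite L_vadd /L /=; ring.
have hs' : 0 < L s h' by rewrite Lh'; lra.
have ht' : 0 < L t h' by rewrite Lh'; lra.
have hk' : L k h' < 0 by rewrite Lh'; lra.
have hl' : L l h' < 0 by rewrite Lh'; lra.
pose ka := c * L s g - L t g.
have Ed (m : P) : E f m d = ka * (n1 m * n2 s - n2 m * n1 s).
  by rewrite /E d0 /d /= c1 c2 /ka; ring.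
pose K := n1 k * n2 s - n2 k * n1 s; pose M := n1 l * n2 s - n2 l * n1 s.
have Kd : ka * K < 0 by rewrite -Ed.
have Md : 0 < ka * M by rewrite -Ed.
have [ze z1 z2] : exists2 ze, ka * M * n1 k - ka * K * n1 l = ze * n1 s
    & ka * M * n2 k - ka * K * n2 l = ze * n2 s.
  exists (ka * (n1 l * n2 k - n2 l * n1 k)); rewrite /K /M; ring.
have ka0 : 0 <= - (ka * K) by lra.
have [ze0|ze0|ze0] := ltgtP ze 0.
- have cn : c != 0.
    apply/eqP => c0'; have [l' /andP[a1 a2]] := vtx_off t.
    have := L_vtx_gt0 a1 a2; have := @L_vtx_self _ P t; rewrite /L c1 c2 c0' !vtx_t; lra.
  have cz : 0 <= c / ze by rewrite -mulrNN -invrN divr_ge0 ?oppr_ge0 // ltW.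
  apply: (@L_cone_false _ P k l t (c / ze * (ka * M)) (c / ze * - (ka * K)) h') => //.
  + by rewrite mulr_ge0 // ltW.
  + by rewrite mulr_ge0.
  + have -> : c / ze * (ka * M) * n1 k + c / ze * - (ka * K) * n1 l =
      c / ze * (ka * M * n1 k - ka * K * n1 l) by ring.
    by rewrite z1 c1; field; rewrite lt_eqF.
  + have -> : c / ze * (ka * M) * n2 k + c / ze * - (ka * K) * n2 l =
      c / ze * (ka * M * n2 k - ka * K * n2 l) by ring.
    by rewrite z2 c2; field; rewrite lt_eqF.
- apply: (@L_cone_false _ P k l s (ka * M / ze) (- (ka * K) / ze) h') => //.
  + by rewrite divr_ge0 // ltW.
  + by rewrite divr_ge0 // ltW.
  + have -> : ka * M / ze * n1 k + - (ka * K) / ze * n1 l =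
      (ka * M * n1 k - ka * K * n1 l) / ze by field; rewrite gt_eqF.
    by rewrite z1; field; rewrite gt_eqF.
  + have -> : ka * M / ze * n2 k + - (ka * K) / ze * n2 l =
      (ka * M * n2 k - ka * K * n2 l) / ze by field; rewrite gt_eqF.
    by rewrite z2; field; rewrite gt_eqF.
have Kn : - (ka * K) != 0 by rewrite gt_eqF // oppr_gt0.
apply: (@L_opp_false _ P k l (ka * M / - (ka * K)) h') => //.
- by rewrite divr_ge0 // ltW.
- by apply: (mulfI Kn); rewrite ze0 mul0r in z1; rewrite mulrA mulrN mulrCA mulfV // mulr1; lra.
- by apply: (mulfI Kn); rewrite ze0 mul0r in z2; rewrite mulrA mulrN mulrCA mulfV // mulr1; lra.
Qed.

End Tips.

(** * Three tips leaving a homothet through the same two sides *)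

Section ThreeTips.
Variables (R : realType) (P : polygon R).
Implicit Types (i j k l s t : P) (f g h : R * R * R) (p q u w x y z : R * R).

Definition exits g p u s : Prop :=
  L s (pt u) < L s g /\
  exists2 a : R, 0 <= a <= 1 & inF P g (onseg p u a) && (L s (pt (onseg p u a)) == L s g).

Lemma exit_ex g p u : inF P g p -> ~~ inF P g u -> exists s, exits g p u s.
Proof.
move=> /inFP gp /inFPn[m0 m0u].
pose th (m : P) : R := (L m (pt p) - L m g) / (L m (pt p) - L m (pt u)).
have den (m : P) : L m (pt u) < L m g -> 0 < L m (pt p) - L m (pt u) by have := gp m; lra.
pose s := [arg min_(m < m0 | L m (pt u) < L m g) th m]%O.
have [su smin] : L s (pt u) < L s g /\ forall m, L m (pt u) < L m g -> th s <= th m.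
  by rewrite /s; case: arg_minP => // i Hi Hm; split=> // m /Hm.
exists s; split=> //; exists (th s).
  rewrite /th divr_ge0 ?subr_ge0 ?(ltW (den s su)) //=; last by rewrite -subr_ge0; apply/ltW/den.
  by rewrite ler_pdivrMr ?den // mul1r lerB // ltW.
have thE (m : P) : L m (pt u) < L m g -> th m * (L m (pt p) - L m (pt u)) = L m (pt p) - L m g.
  by move=> /den d0; rewrite /th divfK // gt_eqF.
have th01 : 0 <= th s <= 1.
  rewrite /th divr_ge0 ?subr_ge0 //=; last by rewrite -subr_ge0; apply/ltW/den.
  by rewrite ler_pdivrMr ?den // mul1r lerB // ltW.
case/andP: th01 => t0 t1.
apply/andP; split; last by rewrite L_onseg; apply/eqP; have := thE s su; lra.
apply/inFP => m; rewrite L_onseg.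
have [mu|mu] := ltP (L m (pt u)) (L m g).
  have := smin m mu; have := thE m mu; have := den m mu => d0 e1 le1.
  by have := ler_wpM2r (ltW d0) le1; lra.
have := gp m => mp.
have := mulr_ge0 t0 (_ : 0 <= L m (pt u) - L m g); rewrite subr_ge0 => /(_ mu).
have := mulr_ge0 (_ : 0 <= 1 - th s) (_ : 0 <= L m (pt p) - L m g); rewrite !subr_ge0 => /(_ t1 mp).
lra.
Qed.

Lemma inF_onseg f p q (a : R) : 0 <= a <= 1 -> inF P f p -> inF P f q -> inF P f (onseg p q a).
Proof.
move=> /andP[a0 a1] /inFP fp /inFP fq; apply/inFP => m; rewrite L_onseg.
have := mulr_ge0 a0 (_ : 0 <= L m (pt q) - L m f); rewrite subr_ge0 => /(_ (fq m)).
have := mulr_ge0 (_ : 0 <= 1 - a) (_ : 0 <= L m (pt p) - L m f); rewrite !subr_ge0 => /(_ a1 (fp m)).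
lra.
Qed.

Lemma onseg_trans p q (a b : R) : onseg p (onseg p q a) b = onseg p q (b * a).
Proof. by rewrite /onseg /=; congr pair; ring. Qed.

Lemma onray_sym g s t p y (al o : R) : onray g t s p y al o -> onray g s t p y al (- o).
Proof. by move=> [a0 e1 e2 e3]; split=> //; move: e1 e2 e3; rewrite /de /= => *; lra. Qed.

Lemma E_onray f g s t (m : P) p y (al o : R) : onray g s t p y al o ->
  E f m (hom y) = al * E f m (hom p) + o * E f m (de g s t).
Proof.
case: y => [y1 y2] [_ e1 e2 e3].
have -> : E f m (hom (y1, y2)) = n1 m * y1 + n2 m * y2 - L m f * 1 by [].
move: e1 e2 => /= -> ->; rewrite [1 in LHS]e3 /E /=; ring.
Qed.

Section Config.
Variables (g : R * R * R) (s t : P).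
Variables (p u w : 'I_3 -> R * R) (fW fE : 'I_3 -> R * R * R).
Hypothesis st : s != t.
Hypothesis gp : forall a j, L j g < L j (pt (p a)).
Hypothesis Wp : forall a, inF P (fW a) (p a).
Hypothesis Wu : forall a, inF P (fW a) (u a).
Hypothesis Ww : forall a, inF P (fW a) (w a).
Hypothesis Wp' : forall a b, a != b -> ~~ inF P (fW a) (p b).
Hypothesis Wu' : forall a b, a != b -> ~~ inF P (fW a) (u b).
Hypothesis Ep : forall a, inF P (fE a) (p a).
Hypothesis Eu : forall a, inF P (fE a) (u a).
Hypothesis Ep' : forall a b, a != b -> ~~ inF P (fE a) (p b).
Hypothesis Ew' : forall a b, a != b -> ~~ inF P (fE a) (w b).
Hypothesis xs : forall a, exits g (p a) (u a) s.
Hypothesis xt : forall a, exits g (p a) (w a) t.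

(** The homothet of tip [b] reaches the line joining tip [a] to the common point of [s] and [t]; the
    sign of [o] tells on which side of [p a]. *)
Definition inside (neg : bool) a b := exists y al o,
  [/\ inF P (fW b) y, onray g s t (p a) y al o & if neg then o < 0 else 0 < o].

Let Epos j a : 0 < E g j (hom (p a)).
Proof. by rewrite E_hom subr_gt0. Qed.

(** By [curve_pt], the exit path of [b] through [s] meets the line of [a], and the exit path of [a]
    through [t] meets the line of [b]. With equal signs, [rays_meet] would make the two paths cross,
    which [noncross] forbids for [fW a] and [fE b]. *)
Lemma inside_lt a b : a != b ->
  E g s (hom (p a)) * E g t (hom (p b)) <= E g s (hom (p b)) * E g t (hom (p a)) ->
  exists neg, inside neg a b /\ inside (~~ neg) b a.
Proof.
move=> ab H.
have [_ [th th01 /andP[/inFP gx /eqP sx]]] := xs b.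
have [_ [ph ph01 /andP[/inFP gz /eqP tz]]] := xt a.
have sx0 : E g s (hom (onseg (p b) (u b) th)) = 0 by rewrite E_hom sx subrr.
have tx0 : 0 <= E g t (hom (onseg (p b) (u b) th)) by rewrite E_hom subr_ge0.
have tz0 : E g t (hom (onseg (p a) (w a) ph)) = 0 by rewrite E_hom tz subrr.
have sz0 : 0 <= E g s (hom (onseg (p a) (w a) ph)) by rewrite E_hom subr_ge0.
have [a1 [al [o [a101 Hy]]]] := curve_pt st (Epos s a) (Epos t a) (Epos s b) (Epos t b) sx0 tx0 H.
have H' : E g t (hom (p b)) * E g s (hom (p a)) <= E g t (hom (p a)) * E g s (hom (p b)).
  by rewrite mulrC (mulrC (E g t _)).
have ts : t != s by rewrite eq_sym.
have [b1 [al' [o' [b101 Hy']]]] := curve_pt ts (Epos t b) (Epos s b) (Epos t a) (Epos s a) tz0 sz0 H'.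
move: Hy' => /onray_sym Hy'; move: (- o') Hy' => {}o' Hy'.
rewrite onseg_trans in Hy; rewrite onseg_trans in Hy'.
have prod01 (x y : R) : 0 <= x <= 1 -> 0 <= y <= 1 -> 0 <= x * y <= 1.
  by move=> /andP[x0 x1] /andP[y0 y1]; rewrite mulr_ge0 //= mulr_ile1.
have c01 := prod01 _ _ a101 th01; have c01' := prod01 _ _ b101 ph01.
set c := a1 * th in c01 Hy; set c' := b1 * ph in c01' Hy'.
have Wy : inF P (fW b) (onseg (p b) (u b) c) by apply: inF_onseg.
have Wy' : inF P (fW a) (onseg (p a) (w a) c') by apply: inF_onseg.
have onray0 q y al0 : onray g s t q y al0 0 -> y = q.
  case=> _; rewrite !mul0r !addr0 => e1 e2 e3; move: e1 e2; rewrite -e3 !mul1r.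
  by case: y => [? ?]; case: q => [? ?] /= -> ->.
have o0 : o != 0.
  by apply/eqP => o0; rewrite o0 in Hy; move: Wy; rewrite (onray0 _ _ _ Hy); apply/negP/Wp'; rewrite eq_sym.
have o0' : o' != 0.
  by apply/eqP => o0'; rewrite o0' in Hy'; move: Wy'; rewrite (onray0 _ _ _ Hy'); apply/negP/Wp'.
have [oo|oo] := ltP 0 (o * o').
  have [A [B [A01 B01]]] := rays_meet Hy Hy' oo.
  rewrite onseg_trans; have -> : onseg (onseg (p b) (u b) c) (p b) B = onseg (p b) (u b) ((1 - B) * c).
    by rewrite /onseg /=; congr pair; ring.
  move=> Eq; exfalso.
  have B01' : 0 <= 1 - B <= 1 by move: B01 => /andP[? ?]; lra.
  have ba : b != a by rewrite eq_sym.
  exact: (@noncross _ P (fW a) (fE b) (p a) (w a) (p b) (u b) (A * c') ((1 - B) * c) (Wp a) (Ww a)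
    (Ep' ba) (Ew' ba) (Ep b) (Eu b) (Wp' ab) (Wu' ab) (prod01 _ _ A01 c01') (prod01 _ _ B01' c01) Eq).
have {}oo : o * o' < 0 by rewrite lt_neqAle mulf_neq0.
have [o1|o1] := ltP o 0.
  exists true; split; [exists (onseg (p b) (u b) c), al, o | exists (onseg (p a) (w a) c'), al', o']; split=> //=.
  by move: oo; rewrite nmulr_rlt0.
have {}o1 : 0 < o by rewrite lt_neqAle eq_sym o0.
exists false; split; [exists (onseg (p b) (u b) c), al, o | exists (onseg (p a) (w a) c'), al', o']; split=> //=.
by move: oo; rewrite pmulr_rlt0.
Qed.

Lemma inside_total a b : a != b -> exists neg, inside neg a b /\ inside (~~ neg) b a.
Proof.
move=> ab.
have [H|H] := leP (E g s (hom (p a)) * E g t (hom (p b))) (E g s (hom (p b)) * E g t (hom (p a))).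
  exact: inside_lt.
have [|neg [H1 H2]] := @inside_lt b a _ (ltW H); first by rewrite eq_sym.
by exists (~~ neg); rewrite negbK.
Qed.

(** The sides [k] and [l] of [fW b] that cut off [p a] and [p c] take opposite signs at [d]. This is
    the configuration refuted by the nested lemmas, with [k] and [l] exchanged when [d.2 < 0]. *)
Lemma inside_mid a b c : a != b -> c != b -> inside true a b -> inside false c b -> False.
Proof.
move=> ab cb [y [al [o [Wy Hy o0]]]] [y' [al' [o' [Wy' Hy' o0']]]].
case: (Hy) => al0 _ _ yt; case: (Hy') => al0' _ _ yt'.
have ba : b != a by rewrite eq_sym.
have bc : b != c by rewrite eq_sym.
have /inFPn[k kp] := Wp' ba; have /inFPn[l lp] := Wp' bc.
have [us [th th01 /andP[/inFP gx /eqP sx]]] := xs b.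
have [wt [ph ph01 /andP[/inFP gz /eqP tz]]] := xt b.
set x := onseg (p b) (u b) th in gx sx; set z := onseg (p b) (w b) ph in gz tz.
have sx0 : E g s (hom x) = 0 by rewrite E_hom sx subrr.
have tx0 : 0 <= E g t (hom x) by rewrite E_hom subr_ge0.
have tz0 : E g t (hom z) = 0 by rewrite E_hom tz subrr.
have sz0 : 0 <= E g s (hom z) by rewrite E_hom subr_ge0.
have Wx : inF P (fW b) x by apply: inF_onseg.
have Wz : inF P (fW b) z by apply: inF_onseg.
pose h := vadd (fW b) (-1) g; pose d := de g s t.
have Lh (m : P) : L m h = L m (fW b) - L m g by rewrite L_vadd; ring.
have hs : L s h < 0 by rewrite Lh; have /inFP/(_ s) := Wu b; lra.
have ht : L t h < 0 by rewrite Lh; have /inFP/(_ t) := Ww b; lra.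
have hk : 0 < L k h by rewrite Lh; have := gp a k; lra.
have hl : 0 < L l h by rewrite Lh; have := gp c l; lra.
have kp0 : E (fW b) k (hom (p a)) < 0 by rewrite E_hom subr_lt0.
have lp0 : E (fW b) l (hom (p c)) < 0 by rewrite E_hom subr_lt0.
have Epos' (m : P) v : inF P (fW b) v -> 0 <= E (fW b) m (hom v).
  by move=> /inFP Hv; rewrite E_hom subr_ge0.
have ky : E (fW b) k (hom y) = al * E (fW b) k (hom (p a)) + o * E (fW b) k d.
  exact: E_onray Hy.
have ly : E (fW b) l (hom y') = al' * E (fW b) l (hom (p c)) + o' * E (fW b) l d.
  exact: E_onray Hy'.
have ky0 : 0 <= o * E (fW b) k d.
  by have := Epos' k _ Wy; rewrite ky; have := mulr_ge0_le0 al0 (ltW kp0); lra.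
have ly0 : 0 <= o' * E (fW b) l d.
  by have := Epos' l _ Wy'; rewrite ly; have := mulr_ge0_le0 al0' (ltW lp0); lra.
have kd : E (fW b) k d <= 0 by rewrite -(nmulr_rge0 _ o0).
have ld : 0 <= E (fW b) l d by rewrite -(pmulr_rge0 _ o0').
have kd' : 0 < al -> E (fW b) k d < 0.
  move=> al1; rewrite -(nmulr_rgt0 _ o0).
  by have := Epos' k _ Wy; rewrite ky; have := mulr_gt0 al1 (_ : 0 < - E (fW b) k (hom (p a))); rewrite oppr_gt0 => /(_ kp0); lra.
have ld' : 0 < al' -> 0 < E (fW b) l d.
  move=> al1; rewrite -(pmulr_rgt0 _ o0').
  by have := Epos' l _ Wy'; rewrite ly; have := mulr_gt0 al1 (_ : 0 < - E (fW b) l (hom (p c))); rewrite oppr_gt0 => /(_ lp0); lra.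
have [d0|d0|d0] := ltgtP d.2 0.
- have o2 : o' * d.2 < 0 by rewrite pmulr_rlt0.
  have {}ld' : 0 < E (fW b) l d by apply: ld'; rewrite -/d in yt'; lra.
  apply: (@nested_nonparallel _ P g (fW b) s t l k (p a) x z) => //; rewrite -/d ?Epos' //.
  + by rewrite lt_eqF.
  + by rewrite pmulr_rlt0 // invr_lt0.
  + by rewrite mulr_le0 // invr_le0 ltW.
- have o2 : o * d.2 < 0 by rewrite nmulr_rlt0.
  have {}kd' : E (fW b) k d < 0 by apply: kd'; rewrite -/d in yt; lra.
  apply: (@nested_nonparallel _ P g (fW b) s t k l (p c) x z) => //; rewrite -/d ?Epos' //.
  + by rewrite gt_eqF.
  + by rewrite nmulr_rlt0 // invr_gt0.
  + by rewrite mulr_ge0 // invr_ge0 ltW.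
apply: (@nested_parallel _ P g (fW b) s t k l) => //.
  by apply: kd'; move: yt; rewrite -/d d0 mulr0 addr0 => <-.
by apply: ld'; move: yt'; rewrite -/d d0 mulr0 addr0 => <-.
Qed.

(** By [inside_mid] the sign depends only on the second index, so each tip has one sign; by
    [inside_total] any two tips have different signs. Three tips do not fit into two signs. *)
Lemma three_tips : False.
Proof.
pose i0 : 'I_3 := inord 0; pose i1 : 'I_3 := inord 1; pose i2 : 'I_3 := inord 2.
have n01 : i0 != i1 by rewrite -val_eqE /= !inordK.
have n02 : i0 != i2 by rewrite -val_eqE /= !inordK.
have n12 : i1 != i2 by rewrite -val_eqE /= !inordK.
have [a [A1 A2]] := inside_total n01; have [b [B1 B2]] := inside_total n12.
have [c [C1 C2]] := inside_total n02.
have m0 := @inside_mid i1 i0 i2; have m0' := @inside_mid i2 i0 i1.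
have m1 := @inside_mid i0 i1 i2; have m1' := @inside_mid i2 i1 i0.
have m2 := @inside_mid i0 i2 i1; have m2' := @inside_mid i1 i2 i0.
have n10 : i1 != i0 by rewrite eq_sym.
have n20 : i2 != i0 by rewrite eq_sym.
have n21 : i2 != i1 by rewrite eq_sym.
by case: a A1 A2 => /= A1 A2; case: b B1 B2 => /= B1 B2; case: c C1 C2 => /= C1 C2; auto.
Qed.

End Config.
End ThreeTips.

(** * Avoiding a point of a homothet *)

Lemma fin_pos_lb (R : realType) (T : finType) (F : T -> R) :
  (forall x, 0 < F x) -> exists2 e : R, 0 < e & forall x, e <= F x.
Proof.
move=> F0; have [x0 _|T0] := pickP (@predT T); last by exists 1 => // x; have := T0 x.
pose m := [arg min_(x < x0) F x]%O.
by exists (F m) => // x; rewrite /m; case: arg_minP => // i _ ->.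
Qed.

Section Cone.
Variables (R : realType) (P : polygon R).
Implicit Types (i j k l m p : P) (f g h b z Y : R * R * R).

Definition K z := forall j, 0 <= L j z.
Definition comb2 (a : R) (u : R * R * R) (c : R) (v : R * R * R) : R * R * R :=
  (a * u.1.1 + c * v.1.1, a * u.1.2 + c * v.1.2, a * u.2 + c * v.2).

Lemma L_comb2 j (a : R) u (c : R) v : L j (comb2 a u c v) = a * L j u + c * L j v.
Proof. by rewrite /L /comb2 /=; ring. Qed.

Lemma vadd_eq (u v d : R * R * R) (a : R) :
  vadd u (-1) v = vadd (0, 0, 0) a d -> u = vadd v a d.
Proof.
case: u => [[u1 u2] u3]; case: v => [[v1 v2] v3]; case: d => [[d1 d2] d3].
by rewrite /vadd /= => -[e1 e2 e3]; congr (_, _, _); lra.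
Qed.

Lemma vadd_vadd (u d : R * R * R) (a c : R) : vadd (vadd u a d) c d = vadd u (a + c) d.
Proof. by rewrite /vadd /=; congr (_, _, _); ring. Qed.

Lemma vadd_0 (u d : R * R * R) : vadd u 0 d = u.
Proof. by case: u => [[? ?] ?]; rewrite /vadd /= !mul0r !addr0. Qed.

Lemma L_zero j : L j (0, 0, 0) = 0.
Proof. by rewrite /L /= !mulr0 !addr0. Qed.

Lemma L_vadd0 j (c : R) v : L j (vadd (0, 0, 0) c v) = c * L j v.
Proof. by rewrite /L /vadd /=; ring. Qed.

Lemma coneP z : K z -> exists w : P -> R, [/\ forall l, 0 <= w l,
  z = (\sum_l w l * (vtx l).1.1, \sum_l w l * (vtx l).1.2, \sum_l w l)
  & forall j, L j z = \sum_l w l * L j (vtx l)].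
Proof.
move=> Kz; have [j|w [w0 e1 e2 e3]] := @cone_gen _ P z; first by rewrite -LE.
exists w; split=> //.
  by case: z e1 e2 e3 {Kz} => [[z1 z2] z3] /= -> -> ->.
move=> j; rewrite /L e1 e2 e3 !mulr_sumr -!big_split /=.
by apply: eq_bigr => l _; rewrite vtx_t; ring.
Qed.

Lemma cone_t z : K z -> 0 <= z.2.
Proof. by move=> /coneP[w [w0 -> _]] /=; apply: sumr_ge0 => l _. Qed.

Lemma cone_t0 z : K z -> z.2 = 0 -> z = (0, 0, 0).
Proof.
move=> /coneP[w [w0 -> _]] /= /eqP; rewrite psumr_eq0 // => /allP H.
have {}w0 l : w l = 0 by apply/eqP/H; rewrite mem_index_enum.
by rewrite !big1 // => l _; rewrite w0 ?mul0r.
Qed.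

Lemma faceP m z : K z -> L m z = 0 ->
  exists a c : R, [/\ 0 <= a, 0 <= c & z = comb2 a (vtx m) c (vtx (nxt m))].
Proof.
move=> /coneP[w [w0 -> Lz]]; rewrite Lz => /eqP.
rewrite psumr_eq0; last by move=> l _; rewrite mulr_ge0 // L_vtx_ge0.
move=> /allP H.
have wz l : l != m -> l != nxt m -> w l = 0.
  move=> l1 l2; have := H l; rewrite mem_index_enum => /(_ isT) /=.
  by rewrite mulf_eq0 (gt_eqF (L_vtx_gt0 l1 l2)) orbF => /eqP.
have nm : nxt m != m.
  apply/eqP => E; have [l /andP[l1 l2]] := vtx_off m.
  have := L_vtx_gt0 l1 l2; rewrite LE E /det3; lra.
exists (w m), (w (nxt m)); split=> //.
have S (F : P -> R) : \sum_l w l * F l = w m * F m + w (nxt m) * F (nxt m).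
  rewrite (bigD1 m) //= (bigD1 (nxt m)) //= big1 ?addr0 // => l /andP[l1 l2].
  by rewrite wz ?mul0r.
rewrite /comb2 !S !vtx_t; congr (_, _).
have := S (fun=> 1); rewrite !mulr1 => <-.
by apply: eq_bigr => l _; rewrite mulr1.
Qed.

Definition cen : R * R :=
  ((\sum_(l : P) (vtx l).1.1) / #|P|%:R, (\sum_(l : P) (vtx l).1.2) / #|P|%:R).

Lemma cen_gt0 j : 0 < L j (hom cen).
Proof.
have [l0 /andP[l1 l2]] := vtx_off j.
have c0 : 0 < #|P|%:R :> R by rewrite ltr0n; apply/card_gt0P; exists j.
have cn : #|P|%:R != 0 :> R by rewrite gt_eqF.
have -> : L j (hom cen) = (\sum_(l : P) L j (vtx l)) / #|P|%:R.
  apply: (mulIf cn); rewrite divfK // /L /hom /cen /=.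
  transitivity (n1 j * (\sum_(l : P) (vtx l).1.1) + n2 j * (\sum_(l : P) (vtx l).1.2) + n3 j * #|P|%:R).
    by field.
  have -> : #|P|%:R = \sum_(l : P) 1 :> R by rewrite sumr_const.
  rewrite !mulr_sumr -!big_split /=; apply: eq_bigr => l _.
  by rewrite vtx_t.
apply: divr_gt0 => //; rewrite (bigD1 l0) //=.
apply: ltr_pwDl; first exact: L_vtx_gt0.
by apply: sumr_ge0 => l _; exact: L_vtx_ge0.
Qed.

Lemma K_mid z (x y : R) d : K z -> K (vadd z x d) -> 0 <= y <= x -> K (vadd z y d).
Proof.
move=> Kz Kx /andP[y0 yx] j; rewrite L_vadd.
have := Kz j; have := Kx j; rewrite L_vadd.
have [d0|d0] := leP 0 (L j d); first by have := mulr_ge0 y0 d0; lra.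
by have := ler_wnM2r (ltW d0) yx; lra.
Qed.

Lemma cone_exit b z : (forall j, 0 < L j b) -> K z ->
  (exists j, L j b < L j z) -> (exists j, L j z < L j b) ->
  exists m p Y, [/\ K Y, L m Y = 0, K (vadd b (-1) Y), L p (vadd b (-1) Y) = 0 & K (vadd z (-1) Y)].
Proof.
move=> b0 Kz [j0 j0z] [i0 i0z].
pose F (j : P) := L j b / (L j b - L j z).
pose m := [arg min_(j < i0 | L j z < L j b) F j]%O.
have [mz mmin] : L m z < L m b /\ forall j, L j z < L j b -> F m <= F j.
  by rewrite /m; case: arg_minP => // i Hi Hm; split=> // j /Hm.
set s := F m in mmin.
have s1 : 1 <= s by rewrite /s /F ler_pdivlMr ?subr_gt0 // mul1r; have := Kz m; lra.
pose e := vadd b s (vadd z (-1) b).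
have Le (j : P) : L j e = L j b + s * (L j z - L j b) by rewrite !L_vadd; ring.
have Ke : K e.
  move=> j; rewrite Le; have [jz|jz] := ltP (L j z) (L j b).
    have d0 : 0 < L j b - L j z by rewrite subr_gt0.
    have := mmin j jz; rewrite /F ler_pdivlMr //; lra.
  have := b0 j; have := mulr_ge0 (le_trans ler01 s1) (_ : 0 <= L j z - L j b); rewrite subr_ge0 => /(_ jz); lra.
have me : L m e = 0.
  rewrite Le /s /F; field; rewrite gt_eqF // subr_gt0 //.
have ej0 : L j0 z <= L j0 e.
  rewrite Le; have := ler_wpM2r (_ : 0 <= L j0 z - L j0 b) s1; rewrite subr_ge0 => /(_ (ltW j0z)); lra.
pose G (j : P) := L j b / L j e.
pose p := [arg min_(j < j0 | 0 < L j e) G j]%O.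
have [pe pmin] : 0 < L p e /\ forall j, 0 < L j e -> G p <= G j.
  rewrite /p; case: arg_minP; first by have := b0 j0; lra.
  by move=> i Hi Hm; split=> // j /Hm.
set u := G p in pmin.
have u0 : 0 <= u by rewrite /u /G divr_ge0 // ltW.
have u1 : u <= 1.
  have ej : 0 < L j0 e by have := b0 j0; lra.
  apply: le_trans (pmin j0 ej) _; rewrite /G ler_pdivrMr // mul1r; lra.
pose Y := vadd (0, 0, 0) u e.
have LY (j : P) : L j Y = u * L j e by rewrite L_vadd0.
have KbY : K (vadd b (-1) Y).
  move=> j; rewrite L_vadd LY; have [je|je] := ltP 0 (L j e).
    by have := pmin j je; rewrite /G ler_pdivlMr //; lra.
  have -> : L j e = 0 by apply/eqP; rewrite eq_le je; exact: Ke.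
  by have := b0 j; lra.
exists m, p, Y; split=> //.
- by move=> j; rewrite LY mulr_ge0.
- by rewrite LY me mulr0.
- by rewrite L_vadd LY /u /G divfK ?gt_eqF //; ring.
move=> j; rewrite L_vadd LY.
have s0 : 0 < s by lra.
rewrite -(pmulr_rge0 _ s0).
have -> : s * (L j z + -1 * (u * L j e)) =
  (s - 1) * (L j b - u * L j e) + (1 - u) * L j e by rewrite Le; ring.
have := KbY j; rewrite L_vadd LY mulN1r => H.
by rewrite addr_ge0 // mulr_ge0 // subr_ge0.
Qed.

Definition link m p b Y := [/\ K Y, L m Y = 0, K (vadd b (-1) Y) & L p (vadd b (-1) Y) = 0].

(** Faces [m] and [p] share the ray of [U]. For a link point, [L p Y = L p b] fixes the coefficient
    of [V] and leaves that of [U] free; coefficient 0 gives a point dominated by all link points, so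
    it alone suffices. *)
Lemma vtx_link_adj m p (U V : P) : m != p -> L p (vtx U) = 0 -> 0 < L p (vtx V) ->
  (forall z, K z -> L m z = 0 -> exists a c : R, [/\ 0 <= a, 0 <= c & z = comb2 a (vtx U) c (vtx V)]) ->
  forall b, K b -> exists2 Y', K Y' /\ L p Y' = L p b &
    forall Y z, link m p b Y -> K (vadd z (-1) Y) -> K (vadd z (-1) Y').
Proof.
move=> mp pU pV face b Kb.
pose c0 := L p b / L p (vtx V).
have c00 : 0 <= c0 by rewrite divr_ge0 // ltW.
exists (vadd (0, 0, 0) c0 (vtx V)).
  split; first by move=> j; rewrite L_vadd0 mulr_ge0 // L_vtx_ge0.
  by rewrite L_vadd0 divfK // gt_eqF.
move=> Y z [KY mY KbY pbY] KzY j.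
have [a [c [a0 c0' EY]]] := face Y KY mY.
have cE : c = c0.
  move: pbY; rewrite L_vadd EY L_comb2 pU mulr0 add0r /c0 => H.
  by apply: (mulIf (lt0r_neq0 pV)); rewrite divfK ?lt0r_neq0 //; lra.
have := KzY j; rewrite L_vadd EY L_comb2 cE => H.
rewrite L_vadd L_vadd0.
by have := mulr_ge0 a0 (L_vtx_ge0 j U); lra.
Qed.

Lemma L_dirE m X : E (0, 0, -1) m X = L m X.
Proof. by rewrite /E /L /=; ring. Qed.

Lemma cone_kernel m p X : m != p -> L m X = 0 -> L p X = 0 ->
  exists o : R, X = vadd (0, 0, 0) o (de (0, 0, -1) m p).
Proof.
move=> mp mX pX.
have [||||o ->] := @kernel _ P (0, 0, -1) m p mp X cen; rewrite ?L_dirE ?cen_gt0 //.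
by exists o; rewrite /vadd /= !add0r.
Qed.

(** The slice is the segment between the two rescaled generators of face [m]. At [(0, 0, -1)] the
    equations [E] are the functionals [L], so [de] is the common direction of the planes [m] and
    [p]. *)
Lemma face_slice m p : m != p -> 0 < L p (vtx m) -> 0 < L p (vtx (nxt m)) ->
  exists U (a : R), [/\ K U, L m U = 0, L p U = 1, 0 < a & K (vadd U a (de (0, 0, -1) m p))] /\
    (de (0, 0, -1) m p != (0, 0, 0) /\ forall Y, K Y -> L m Y = 0 -> L p Y = 1 ->
      exists2 r : R, 0 <= r <= a & Y = vadd U r (de (0, 0, -1) m p)).
Proof.
move=> mp p1 p2; set d := de _ _ _.
pose U1 := vadd (0, 0, 0) (L p (vtx m))^-1 (vtx m).
pose U2 := vadd (0, 0, 0) (L p (vtx (nxt m)))^-1 (vtx (nxt m)).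
have KU1 : K U1 by move=> j; rewrite L_vadd0 mulr_ge0 ?L_vtx_ge0 // invr_ge0 ltW.
have KU2 : K U2 by move=> j; rewrite L_vadd0 mulr_ge0 ?L_vtx_ge0 // invr_ge0 ltW.
have mU1 : L m U1 = 0 by rewrite L_vadd0 L_vtx_self mulr0.
have mU2 : L m U2 = 0 by rewrite L_vadd0 L_vtx_nxt mulr0.
have pU1 : L p U1 = 1 by rewrite L_vadd0 mulVf // gt_eqF.
have pU2 : L p U2 = 1 by rewrite L_vadd0 mulVf // gt_eqF.
have [||a Ea] := @cone_kernel m p (vadd U2 (-1) U1) mp.
- by rewrite L_vadd mU1 mU2; ring.
- by rewrite L_vadd pU1 pU2; ring.
have U2E : U2 = vadd U1 a d := vadd_eq Ea.
have U21 : U2 <> U1.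
  move=> {}U2E.
  have [l /andP[l1 l2]] := vtx_off m.
  have := L_vtx_gt0 l1 l2.
  have t2 : (L p (vtx (nxt m)))^-1 = (L p (vtx m))^-1.
    by have := congr1 snd U2E; rewrite /= !vtx_t; lra.
  have v1 : (vtx (nxt m)).1.1 = (vtx m).1.1.
    have := congr1 (fun z => z.1.1) U2E; rewrite /= t2 !add0r; apply: mulfI.
    by rewrite invr_eq0 gt_eqF.
  have v2 : (vtx (nxt m)).1.2 = (vtx m).1.2.
    have := congr1 (fun z => z.1.2) U2E; rewrite /= t2 !add0r; apply: mulfI.
    by rewrite invr_eq0 gt_eqF.
  by rewrite LE /det3 v1 v2 !vtx_t; lra.
have a0 : a != 0 by apply/eqP => a0; apply: U21; rewrite U2E a0 vadd_0.
have d0 : d != (0, 0, 0).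
  apply/eqP => d0; apply: U21; rewrite U2E d0.
  by case: (U1) => [[? ?] ?]; rewrite /vadd /= !mulr0 !addr0.
have slice Y : K Y -> L m Y = 0 -> L p Y = 1 ->
    exists2 x : R, 0 <= x <= 1 & Y = vadd U1 (x * a) d.
  move=> KY mY pY; have [x1 [x2 [x10 x20 EY]]] := faceP KY mY.
  have E1 : x1 * L p (vtx m) + x2 * L p (vtx (nxt m)) = 1 by rewrite -pY EY L_comb2.
  exists (x2 * L p (vtx (nxt m))).
    by have := mulr_ge0 x10 (ltW p1); have := mulr_ge0 x20 (ltW p2); lra.
  have -> : vadd U1 (x2 * L p (vtx (nxt m)) * a) d =
    vadd U1 (x2 * L p (vtx (nxt m))) (vadd U2 (-1) U1).
    by rewrite Ea -/d /vadd /=; congr (_, _, _); ring.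
  have x1E : x1 = (1 - x2 * L p (vtx (nxt m))) / L p (vtx m).
    by apply: (mulIf (lt0r_neq0 p1)); rewrite divfK ?lt0r_neq0 //; lra.
  have p1' := lt0r_neq0 p1; have p2' := lt0r_neq0 p2.
  by rewrite EY /comb2 /vadd /=; congr (_, _, _); rewrite x1E; field; rewrite p1' p2'.
have [an|ap] := ltP a 0.
  exists U2, (- a); split.
    split=> //; first by rewrite oppr_gt0.
    by rewrite U2E vadd_vadd subrr vadd_0.
  split=> // Y KY mY pY; have [x /andP[x0 x1] ->] := slice Y KY mY pY.
  exists ((1 - x) * - a).
    by rewrite mulr_ge0 ?subr_ge0 ?oppr_ge0 ?(ltW an) //=; have := mulr_ge0_le0 x0 (ltW an); lra.
  by rewrite U2E vadd_vadd; congr vadd; ring.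
have {}ap : 0 < a by rewrite lt_neqAle eq_sym a0.
exists U1, a; split; first by split=> //; rewrite -U2E.
split=> // Y KY mY pY; have [x /andP[x0 x1] ->] := slice Y KY mY pY.
by exists (x * a) => //; rewrite mulr_ge0 ?(ltW ap) //= ler_piMl // ltW.
Qed.

Lemma face_slice_scaled m p : m != p -> 0 < L p (vtx m) -> 0 < L p (vtx (nxt m)) ->
  exists U (a : R), [/\ K U, L m U = 0, L p U = 1, 0 < a & K (vadd U a (de (0, 0, -1) m p))] /\
    (de (0, 0, -1) m p != (0, 0, 0) /\ forall Y, K Y -> L m Y = 0 -> 0 < L p Y ->
      exists2 r : R, 0 <= r <= a * L p Y &
        Y = vadd (vadd (0, 0, 0) (L p Y) U) r (de (0, 0, -1) m p)).
Proof.
move=> mp p1 p2; have [U [a [HU [d0 H]]]] := face_slice mp p1 p2.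
exists U, a; split=> //; split=> // Y KY mY pY.
have pn := lt0r_neq0 pY.
have [|||r /andP[r0 r1] E] := H (vadd (0, 0, 0) (L p Y)^-1 Y).
- by move=> j; rewrite L_vadd0 mulr_ge0 // invr_ge0 ltW.
- by rewrite L_vadd0 mY mulr0.
- by rewrite L_vadd0 mulVf.
exists (r * L p Y); first by rewrite mulr_ge0 ?(ltW pY) //= ler_wpM2r // ltW.
have : vadd (0, 0, 0) (L p Y) (vadd (0, 0, 0) (L p Y)^-1 Y) = Y.
  by case: (Y) pn => [[y1 y2] y3] pn; rewrite /vadd /= !add0r !mulrA mulfV // !mul1r.
rewrite E => {1}<-; rewrite /vadd /=; congr (_, _, _); ring.
Qed.

Lemma grid_cell (st r : R) (N : nat) : 0 <= r -> r <= st * N.+1%:R ->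
  exists2 i, (i <= N)%N & st * i%:R <= r <= st * i.+1%:R.
Proof.
move=> r0; elim: N => [|N IH] H; first by exists 0%N; rewrite // mulr0 r0.
have [/IH[i iN Hi]|/ltW H'] := leP r (st * N.+1%:R); first by exists i => //; exact: leqW.
by exists N.+1; rewrite // H' H.
Qed.

Lemma clampP (x y r B st : R) : 0 <= r <= B -> y <= r <= x -> x - y = st ->
  let c (v : R) := Num.max 0 (Num.min v B) in
  [/\ c y <= r, r <= c x, c x - c y <= st, 0 <= c x <= B & 0 <= c y <= B].
Proof.
move=> /andP[r0 rB] /andP[yr rx] st0 c.
have cE v : [\/ c v = 0 /\ v <= 0, c v = v /\ 0 <= v <= B | c v = B /\ B <= v].
  rewrite /c; case: (leP v B) => vB; last first.
    by apply: Or33; split; [apply/max_idPr; lra | exact: ltW].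
  have [v0|v0] := leP 0 v; first by apply: Or32.
  by apply: Or31; split=> //; exact: ltW.
case: (cE x) => -[-> Hx]; case: (cE y) => -[-> Hy]; try case/andP: Hx => ? ?; try case/andP: Hy => ? ?;
  split; try (apply/andP; split); lra.
Qed.

(** The link points lie on a segment of direction [d] and length at most [c * L m b], which the grid
    cuts into steps [st]. The size hypothesis gives [z - Y] height at least [ka * L m b], so the
    chord of the cone through it in direction [d] is at least one step long, and one of the two grid
    points around [Y] is still dominated by [z]. *)
Lemma link_grid m p (ka : R) : m != p -> 0 < L p (vtx m) -> 0 < L p (vtx (nxt m)) ->
  0 < L m (vtx p) -> 0 < L m (vtx (nxt p)) -> 0 < ka -> (forall l, 2 * ka * L m (vtx l) <= 1) ->
  exists N : nat, forall b, 0 < L m b -> 0 < L p b ->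
    exists2 Ys : seq (R * R * R), (size Ys <= N)%N &
    (forall Y', Y' \in Ys -> K Y' /\ L p Y' = L p b) /\
    (forall Y z, link m p b Y -> K (vadd z (-1) Y) -> b.2 - z.2 <= ka * L m b ->
       exists2 Y', Y' \in Ys & K (vadd z (-1) Y')).
Proof.
move=> mp pm1 pm2 mp1 mp2 ka0 kaP.
have pm : p != m by rewrite eq_sym.
have [U [a [[KU mU pU a0 KUa] [d0 HU]]]] := face_slice_scaled mp pm1 pm2.
have [W [c [[KW pW mW c0 KWc] [_ HW]]]] := face_slice_scaled pm mp1 mp2.
set d := de (0, 0, -1) m p in KUa d0 HU.
have dE X (r : R) : vadd X r (de (0, 0, -1) p m) = vadd X (- r) d.
  by rewrite /vadd /d /de /=; congr (_, _, _); ring.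
rewrite dE in KWc.
have [W' WE] : exists W', W = vadd W' c d.
  by exists (vadd W (- c) d); rewrite vadd_vadd addNr vadd_0.
rewrite {}WE in KW pW mW KWc HW.
have {}KWc : K W' by move: KWc; rewrite vadd_vadd subrr vadd_0.
have md : L m d = 0 by rewrite -(L_dirE m) /E /d /de /L /=; ring.
have pd : L p d = 0 by rewrite -(L_dirE p) /E /d /de /L /=; ring.
have pW' : L p W' = 0 by move: pW; rewrite L_vadd pd mulr0 addr0.
have mW' : L m W' = 1 by move: mW; rewrite L_vadd md mulr0 addr0.
(* The chord in direction [d] through a point of the cone has length [a * L p + c * L m]. It is at
   least [e0] times the height because no vertex lies on both sides [m] and [p]. *)
have [e0 e00 e0P] : exists2 e0 : R, 0 < e0 & forall l, e0 <= a * L p (vtx l) + c * L m (vtx l).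
  apply: fin_pos_lb => l.
  have := mulr_ge0 (ltW a0) (L_vtx_ge0 p l); have := mulr_ge0 (ltW c0) (L_vtx_ge0 m l).
  have [->|l1] := eqVneq l m; first by have := mulr_gt0 a0 pm1; lra.
  have [->|l2] := eqVneq l (nxt m); first by have := mulr_gt0 a0 pm2; lra.
  by have := mulr_gt0 c0 (L_vtx_gt0 l1 l2); lra.
have width z : K z -> e0 * z.2 <= a * L p z + c * L m z.
  move=> /coneP[w [w0 -> Lw]]; rewrite !Lw /= !mulr_sumr -big_split /=.
  by apply: ler_sum => l _; have := ler_wpM2l (w0 l) (e0P l); lra.
have size_lb z : K z -> 2 * ka * L m z <= z.2.
  move=> /coneP[w [w0 -> Lw]]; rewrite !Lw /= !mulr_sumr.
  by apply: ler_sum => l _; have := ler_wpM2l (w0 l) (kaP l); lra.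
pose N := Num.bound (c / (e0 * ka)).
have N0 : c / (e0 * ka) < N.+1%:R.
  apply: lt_le_trans (archi_boundP _) _; last by rewrite ler_nat.
  by rewrite divr_ge0 ?mulr_ge0 // ltW.
exists N.+2 => b mb pb.
pose U0 := vadd (0, 0, 0) (L p b) U; pose W0 := vadd (0, 0, 0) (L m b) W'.
have [||r0 Er0] := @cone_kernel m p (vadd (vadd b (-1) U0) (-1) W0) mp.
- by rewrite !L_vadd !L_zero mU mW'; ring.
- by rewrite !L_vadd !L_zero pU pW'; ring.
pose st := c * L m b / N.+1%:R.
(* Clamping keeps every grid point on face [m] of the cone. *)
pose cl (v : R) : R := Num.max 0 (Num.min v (a * L p b)).
pose Yi (i : nat) := vadd U0 (cl (r0 - st * i%:R)) d.
exists (map Yi (iota 0 N.+2)); first by rewrite size_map size_iota.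
have N1 : N.+1%:R != 0 :> R by rewrite pnatr_eq0.
have stN : st * N.+1%:R = c * L m b by rewrite /st divfK.
have st0 : 0 <= st by rewrite /st divr_ge0 // ?ler0n // mulr_ge0 // ltW.
have U0a : K (vadd U0 (a * L p b) d).
  have -> : vadd U0 (a * L p b) d = vadd (0, 0, 0) (L p b) (vadd U a d).
    by rewrite /vadd /=; congr (_, _, _); ring.
  by move=> j; rewrite L_vadd0 mulr_ge0 // ltW.
have KU0 : K U0 by move=> j; rewrite L_vadd0 mulr_ge0 // ltW.
split.
  move=> Y' /mapP[i _ ->]; split; last by rewrite L_vadd L_vadd0 pU pd; ring.
  apply: K_mid U0a _ => //; rewrite /cl le_max lexx /= ge_max ge_min lexx orbT andbT.
  by rewrite mulr_ge0 // ltW.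
move=> Y z [KY mY KbY pbY] KzY bz.
have pY : L p Y = L p b by move: pbY; rewrite L_vadd; lra.
have mbY : L m (vadd b (-1) Y) = L m b by rewrite L_vadd mY; ring.
have [|r r01 EY] := HU Y KY mY; first by rewrite pY.
rewrite pY -/U0 in r01 EY.
have [|ro ro01] := HW _ KbY pbY; first by rewrite mbY.
rewrite mbY dE => EbY; rewrite mbY in ro01.
have EbY' : vadd b (-1) Y = vadd W0 (c * L m b - ro) d.
  by rewrite EbY /W0 /vadd /=; congr (_, _, _); ring.
have EbY2 : vadd b (-1) Y = vadd W0 (r0 - r) d.
  move: (vadd_eq Er0) => E1; rewrite -/d in E1.
  rewrite EY; move: E1; case: (b) => [[b1 b2] b3]; case: (U0) => [[u1 u2] u3].
  case: (W0) => [[w1 w2] w3]; case: (d) => [[d1 d2] d3]; rewrite /vadd /= => -[f1 f2 f3].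
  by congr (_, _, _); lra.
have ror : c * L m b - ro = r0 - r.
  apply/eqP; rewrite -subr_eq0; apply: contraT => nz; case/negP: d0.
  move: EbY'; rewrite EbY2; case: (W0) => [[w1 w2] w3]; case: (d) => [[d1 d2] d3].
  rewrite /vadd /= => -[f1 f2 f3].
  by apply/eqP; congr (_, _, _); apply: (mulfI nz); lra.
case/andP: (ro01) => ro0 ro1.
have [|| i iN /andP[i1 i2]] := @grid_cell st (r0 - r) N.
- by rewrite -ror; lra.
- by rewrite stN -ror; lra.
have [||cy cx cxy cx01 cy01] := @clampP (r0 - st * i%:R) (r0 - st * i.+1%:R) r (a * L p b) st r01.
- by apply/andP; split; lra.
- by rewrite -natr1; ring.
rewrite -!/(cl _) in cy cx cxy cx01 cy01.
have [ze zeE] : exists ze, ze = vadd z (-1) Y by exists (vadd z (-1) Y).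
rewrite -zeE in KzY.
have [||k Ek] := @cone_kernel m p
  (vadd ze (-1) (vadd (vadd (0, 0, 0) (L p ze) U) (L m ze) W')) mp.
- by rewrite !L_vadd !L_zero mU mW'; ring.
- by rewrite !L_vadd !L_zero pU pW'; ring.
have {}Ek := vadd_eq Ek; rewrite -/d in Ek.
pose ell := a * L p ze + c * L m ze.
have Klo : K (vadd ze (- k) d).
  rewrite Ek vadd_vadd subrr vadd_0 => j; rewrite L_vadd L_vadd0.
  by rewrite addr_ge0 // mulr_ge0.
have Khi : K (vadd ze (ell - k) d).
  have -> : vadd ze (ell - k) d = vadd (vadd (0, 0, 0) (L p ze) (vadd U a d)) (L m ze) (vadd W' c d).
    rewrite {1}Ek vadd_vadd /ell; move: (L p ze) (L m ze) => ? ?.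
    by rewrite /vadd /=; congr (_, _, _); ring.
  by move=> j; rewrite L_vadd L_vadd0 addr_ge0 // mulr_ge0.
have sz : st <= ell.
  apply: le_trans (width _ KzY).
  have H1 := size_lb _ KbY; rewrite mbY /= in H1.
  have H2 : ka * L m b <= ze.2 by rewrite zeE /=; lra.
  apply: le_trans (ler_wpM2l (ltW e00) H2).
  rewrite /st ler_pdivrMr ?ltr0n //.
  have : c <= N.+1%:R * (e0 * ka) by move: N0; rewrite ltr_pdivrMr ?mulr_gt0 // => /ltW.
  by move=> /(ler_wpM2r (ltW mb)); lra.
have YiE (j : nat) : vadd z (-1) (Yi j) = vadd ze (r - cl (r0 - st * j%:R)) d.
  rewrite zeE /Yi EY; case: (U0) => [[? ?] ?]; rewrite /vadd /=; congr (_, _, _); ring.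
(* Inside the cone, [ze] can move by [ell - k] forwards and by [k] backwards. The two moves to the
   neighbouring grid points add up to at most [st <= ell], so one of them fits. *)
have [s2|s2] := leP (r - cl (r0 - st * i.+1%:R)) (ell - k).
  exists (Yi i.+1); first by apply/mapP; exists i.+1; rewrite // mem_iota /= add0n !ltnS.
  by rewrite YiE; apply: K_mid Khi _ => //; rewrite s2 subr_ge0 cy.
exists (Yi i); first by apply/mapP; exists i; rewrite // mem_iota /= add0n ltnS leqW.
rewrite YiE -[r - _]opprB.
have -> (v : R) : vadd ze (- v) d = vadd ze v (vadd (0, 0, 0) (-1) d).
  by rewrite /vadd /=; congr (_, _, _); ring.
apply: (@K_mid _ k) => //; last by apply/andP; split; lra.
have -> : vadd ze k (vadd (0, 0, 0) (-1) d) = vadd ze (- k) d; last by [].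
by rewrite /vadd /=; congr (_, _, _); ring.
Qed.

End Cone.

Section Avoid.
Variables (R : realType) (P : polygon R).
Implicit Types (i j k l m p : P) (f g h b z Y : R * R * R).

Lemma nxt_neq m : nxt m != m.
Proof.
apply/eqP => E; have [l /andP[l1 l2]] := vtx_off m.
by have := L_vtx_gt0 l1 l2; rewrite LE E /det3; lra.
Qed.

Lemma nxt_nxt_neq m : nxt (nxt m) != m.
Proof.
apply/eqP => E; have [l /andP[l1 l2]] := vtx_off m.
have := L_vtx_gt0 l1 l2; have := L_vtx_ge0 (nxt m) l; rewrite !LE E /det3; lra.
Qed.

Lemma nxt_inj m p : nxt m = nxt p -> m = p.
Proof.
move=> E; apply/eqP/negPn/negP => mp.
have pm : p != m by rewrite eq_sym.
have p1 : p != nxt m by rewrite E eq_sym nxt_neq.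
have m1 : m != nxt p by rewrite -E eq_sym nxt_neq.
have := L_vtx_gt0 pm p1; have := L_vtx_gt0 mp m1; rewrite !LE E /det3; lra.
Qed.

Lemma link_list m p (ka : R) : m != p -> 0 < ka -> (forall l, 2 * ka * L m (vtx l) <= 1) ->
  exists N : nat, forall b, (forall j, 0 < L j b) ->
    exists2 Ys : seq (R * R * R), (size Ys <= N)%N &
    (forall Y', Y' \in Ys -> K P Y' /\ L p Y' = L p b) /\
    (forall Y z, link m p b Y -> K P (vadd z (-1) Y) -> b.2 - z.2 <= ka * L m b ->
       exists2 Y', Y' \in Ys & K P (vadd z (-1) Y')).
Proof.
move=> mp ka0 kaP.
have [pE|pn] := eqVneq p (nxt m).
  exists 1%N => b b0.
  have pm : 0 < L p (vtx m).
    apply: L_vtx_gt0 => //; rewrite pE eq_sym; exact: nxt_nxt_neq.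
  have [|Y' [KY' pY'] H] := @vtx_link_adj _ P m p p m mp (L_vtx_self p) pm _ b (fun j => ltW (b0 j)).
    move=> z Kz mz; have [a [c [a0 c0 ->]]] := faceP Kz mz; exists c, a; split=> //.
    by rewrite pE /comb2; congr (_, _, _); ring.
  exists [:: Y'] => //; split; first by move=> Y; rewrite inE => /eqP->.
  by move=> Y z HY Kz _; exists Y'; [rewrite inE | apply: H HY Kz].
have [mE|mn] := eqVneq m (nxt p).
  exists 1%N => b b0.
  have pm : 0 < L p (vtx (nxt m)).
    apply: L_vtx_gt0; last by rewrite -mE nxt_neq.
    by rewrite mE nxt_nxt_neq.
  have mz : L p (vtx m) = 0 by rewrite mE L_vtx_nxt.
  have [|Y' [KY' pY'] H] := @vtx_link_adj _ P m p m (nxt m) mp mz pm _ b (fun j => ltW (b0 j)).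
    by move=> z Kz mz'; exact: faceP.
  exists [:: Y'] => //; split; first by move=> Y; rewrite inE => /eqP->.
  by move=> Y z HY Kz _; exists Y'; [rewrite inE | apply: H HY Kz].
have pm : p != m by rewrite eq_sym.
have nn : nxt m != nxt p by apply: contraNneq mp => /nxt_inj ->.
have [|||| N HN] := @link_grid _ P m p ka mp _ _ _ _ ka0 kaP.
- exact: L_vtx_gt0.
- by apply: L_vtx_gt0 => //; rewrite eq_sym.
- exact: L_vtx_gt0.
- by apply: L_vtx_gt0; rewrite eq_sym.
by exists N => b b0; apply: HN.
Qed.

Lemma side_ex : exists j : P, true.
Proof.
have [j _|n0] := pickP (@predT P); first by exists j.
have [j|w [_ _ _ e]] := @cone_gen _ P (0, 0, 1); first by have := n0 j.
by move: e; rewrite big_pred0 //= => /eqP; rewrite oner_eq0.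
Qed.

Lemma pt_eq_of_le (x y : R * R) : (forall j, L j (pt x) <= L j (pt y)) -> x = y.
Proof.
case: x y => [x1 x2] [y1 y2] H.
have : K P (vadd (pt (y1, y2)) (-1) (pt (x1, x2))).
  by move=> j; rewrite L_vadd; have := H j; lra.
move=> /cone_t0; rewrite /vadd /= mulr0 addr0 => /(_ erefl) [e1 e2].
by congr (_, _); lra.
Qed.

Definition cover_const (C : nat) := forall (I : finType) (pos : I -> R * R) f (b : I),
  injective pos -> (forall x : I, inF P f (pos x) -> forall j, L j f < L j (pt (pos x))) ->
  inF P f (pos b) ->
  exists2 fs : seq (R * R * R), (size fs <= C)%N &
    (forall f', f' \in fs -> ~~ inF P f' (pos b) /\ forall j, L j f <= L j f') /\
    (forall x, inF P f (pos x) -> x != b -> exists2 f', f' \in fs & inF P f' (pos x)).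

(* Translate [f] to the origin and push [b] slightly to [b']: each remaining point [x]
   dominates the apex [Y] of a translated cone, where [Y] lies on a face [m] and [b' - Y] on
   a face [p]. The possible [Y] form a segment, of which a bounded grid suffices. *)
Lemma avoid_cover : exists C : nat, cover_const C.
Proof.
have [ka ka0 kaP'] : exists2 ka : R, 0 < ka &
    forall ml : P * P, ka <= (2 * (L ml.1 (vtx ml.2) + 1))^-1.
  by apply: fin_pos_lb => -[m l] /=; rewrite invr_gt0 mulr_gt0 // ltr_wpDl // L_vtx_ge0.
have kaP m l : 2 * ka * L m (vtx l) <= 1.
  have l0 := L_vtx_ge0 m l; have := kaP' (m, l) => /= H.
  have d0 : 0 < 2 * (L m (vtx l) + 1) by lra.
  by move: H; rewrite -[X in _ <= X]mul1r ler_pdivlMr //; lra.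
have HN0 (mp : P * P) : exists N : nat, mp.1 != mp.2 ->
    forall b, (forall j, 0 < L j b) ->
    exists2 Ys : seq (R * R * R), (size Ys <= N)%N &
    (forall Y', Y' \in Ys -> K P Y' /\ L mp.2 Y' = L mp.2 b) /\
    (forall Y z, link mp.1 mp.2 b Y -> K P (vadd z (-1) Y) -> b.2 - z.2 <= ka * L mp.1 b ->
       exists2 Y', Y' \in Ys & K P (vadd z (-1) Y')).
  case: mp => m p /=; have [->|mp] := eqVneq m p; first by exists 0%N.
  by have [n Hn] := link_list mp ka0 (kaP m); exists n => _; exact: Hn.
have [N HN] := choice HN0.
exists (\sum_mp N mp)%N => I pos f b posI fin fb.
have bf := fin b fb; pose b1 := vadd (pt (pos b)) (-1) f.
have b10 j : 0 < L j b1 by rewrite L_vadd; have := bf j; lra.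
(* The length of the push: small enough for the height condition of [link_list], and for [b'] to
   dominate no other point. *)
have [e e0 [eP1 eP2]] : exists2 e : R, 0 < e & (forall m, e <= ka * L m b1) /\
    forall x, x != b -> exists j, L j (pt (pos b)) + e * L j (hom (cen P)) < L j (pt (pos x)).
  have [e1 e10 e1P] : exists2 e : R, 0 < e & forall m, e <= ka * L m b1.
    by apply: fin_pos_lb => m; rewrite mulr_gt0.
  have gap x : exists j : P, x != b -> 0 < L j (pt (pos x)) - L j (pt (pos b)).
    have [->|xb] := eqVneq x b; first by have [j _] := side_ex; exists j.
    suff [j Hj] : exists j : P, L j (pt (pos b)) < L j (pt (pos x)) by exists j; rewrite subr_gt0.
    have [j Hj|Hn] := pickP (fun j : P => L j (pt (pos b)) < L j (pt (pos x))); first by exists j.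
    case/eqP: xb; apply: posI; apply: pt_eq_of_le => j; have := Hn j; rewrite ltNge => /negbFE.
    by [].
  have [jj Hjj] := fin_all_exists gap.
  pose G x := if x != b then (L (jj x) (pt (pos x)) - L (jj x) (pt (pos b))) / (2 * L (jj x) (hom (cen P))) else 1.
  have [e2 e20 e2P] : exists2 e : R, 0 < e & forall x, e <= G x.
    apply: fin_pos_lb => x; rewrite /G; case: ifP => // xb.
    by rewrite divr_gt0 ?Hjj // mulr_gt0 // cen_gt0.
  exists (Num.min e1 e2); first by rewrite lt_min e10.
  split; first by move=> m; rewrite ge_min e1P.
  move=> x xb; exists (jj x); have := e2P x; rewrite /G xb.
  have c0 := cen_gt0 (jj x); have d0 : 0 < 2 * L (jj x) (hom (cen P)) by lra.
  rewrite ler_pdivlMr //.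
  have : Num.min e1 e2 <= e2 by rewrite ge_min lexx orbT.
  move=> /(ler_wpM2r (ltW c0)); have := mulr_gt0 e20 c0; have := Hjj x xb; lra.
pose b' := vadd b1 e (hom (cen P)).
have b'0 j : 0 < L j b' by rewrite L_vadd; have := b10 j; have := mulr_gt0 e0 (cen_gt0 j); lra.
have HYs0 (mp : P * P) : exists Ys : seq (R * R * R), (size Ys <= N mp)%N /\
   ((forall Y', Y' \in Ys -> K P Y' /\ L mp.2 Y' = L mp.2 b') /\
   (mp.1 != mp.2 -> forall Y z, link mp.1 mp.2 b' Y -> K P (vadd z (-1) Y) -> b'.2 - z.2 <= ka * L mp.1 b' ->
       exists2 Y', Y' \in Ys & K P (vadd z (-1) Y'))).
   have [mpE|mpN] := boolP (mp.1 == mp.2); first by exists [::].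
  by have [ys s1 [s2 s3]] := HN mp mpN b' b'0; exists ys.
have [Ys HYs] := choice HYs0.
exists (flatten [seq [seq vadd f 1 Y | Y <- Ys mp] | mp <- index_enum (P * P)%type]).
  rewrite size_flatten /shape -map_comp sumnE big_map; apply: leq_sum => mp _ /=.
  by rewrite size_map; case: (HYs mp).
split.
  move=> f' /flattenP[ys /mapP[mp _ ->] /mapP[Y YY ->]].
  have [_ [/(_ Y YY) [KY pY] _]] := HYs mp; split; last by move=> j; rewrite L_vadd; have := KY j; lra.
  apply/inFPn; exists mp.2; rewrite L_vadd pY !L_vadd.
  by have := mulr_gt0 e0 (cen_gt0 mp.2); lra.
move=> x fx xb; pose z := vadd (pt (pos x)) (-1) f.
have Kz : K P z by move=> j; rewrite L_vadd; have := fin x fx j; lra.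
have [||m [p [Y [KY mY KbY pbY KzY]]]] := @cone_exit _ P b' z b'0 Kz.
- by have [j Hj] := eP2 x xb; exists j; rewrite !L_vadd; lra.
- have [j Hj|Hn] := pickP (fun j : P => L j z < L j b'); first by exists j.
  have : K P (vadd z (-1) b').
    by move=> j; rewrite L_vadd; have := Hn j; rewrite ltNge => /negbFE; lra.
  by move=> /cone_t; rewrite /z /b' /b1 /=; lra.
have mp : m != p.
  by apply/eqP => mpE; move: pbY; rewrite -mpE L_vadd mY; have := b'0 m; lra.
have [_ [_ /(_ mp)]] := HYs (m, p) => /(_ Y z) [].
- by split.
- by [].
- rewrite /z /b' /b1 /=; apply: le_trans (_ : e <= _); first by lra.
  apply: le_trans (eP1 m) _; rewrite ler_wpM2l ?(ltW ka0) // /b' [leRHS]L_vadd.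
  by have := mulr_gt0 e0 (cen_gt0 m); lra.
move=> Y' YY' KzY'; exists (vadd f 1 Y').
  apply/flattenP; exists [seq vadd f 1 Y | Y <- Ys (m, p)]; last by apply/mapP; exists Y'.
  by apply/mapP; exists (m, p); rewrite // mem_index_enum.
by apply/inFP => j; have := KzY' j; rewrite !L_vadd; lra.
Qed.

End Avoid.

(** * Shrinking a homothet *)

Lemma poly_avoid (R : realType) (T : finType) (q : T -> {poly R}) (d : R) : 0 < d ->
  (forall t, q t != 0) -> exists2 s : R, 0 < s < d & forall t, (q t).[s] != 0.
Proof.
move=> d0 q0; pose pr := \prod_t q t.
have pr0 : pr != 0 by apply/prodf_neq0 => t _; exact: q0.
pose r := [seq d / k.+2%:R | k <- iota 0 (size pr)].
have [/allP rr|] := boolP (all (root pr) r).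
  have := @max_poly_roots _ pr r pr0 _ _.
  rewrite size_map size_iota ltnn => H; suff: false by []; apply: H; first exact/allP.
  rewrite map_inj_in_uniq ?iota_uniq // => k l _ _ /(mulfI (lt0r_neq0 d0)) /invr_inj /eqP.
  by rewrite eqr_nat !eqSS => /eqP.
move=> /allPn[s /mapP[k _ ->]] /negP rk; exists (d / k.+2%:R).
  rewrite divr_gt0 ?ltr0n //= ltr_pdivrMr ?ltr0n // -[ltLHS]mulr1 ltr_pM2l //.
  by rewrite -[1]/(1%:R) ltr_nat.
by move=> t; apply/negP => /eqP e; apply: rk; apply/rootP; rewrite horner_prod (bigD1 t) //= e mul0r.
Qed.

Section Points.
Variables (R : realType) (P : polygon R) (I : finType) (pos : I -> R * R).
Implicit Types (i j : P) (x y z : I) (X : {set I}) (f g : R * R * R).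

Definition A f : {set I} := [set x | inF P f (pos x)].

Lemma A_mono f g : (forall j, L j f <= L j g) -> A g \subset A f.
Proof.
move=> fg; apply/subsetP => x; rewrite !inE => /inFP gx; apply/inFP => j.
exact: le_trans (fg j) (gx j).
Qed.

(** A slight enlargement catches no new point, since an excluded point violates some side strictly;
    the contained points become interior. *)
Lemma robust f : exists2 g, forall j, L j g < L j f & A g = A f.
Proof.
have H x : exists j, ~~ inF P f (pos x) -> 0 < L j f - L j (pt (pos x)).
  have [fx|/inFPn[j Hj]] := boolP (inF P f (pos x)); first by have [j _] := side_ex P; exists j.
  by exists j => _; rewrite subr_gt0.
have [jj Hjj] := choice H.
pose G x := if inF P f (pos x) then 1 else
  (L (jj x) f - L (jj x) (pt (pos x))) / (2 * L (jj x) (hom (cen P))).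
have [e e0 eP] : exists2 e : R, 0 < e & forall x, e <= G x.
  apply: fin_pos_lb => x; rewrite /G; case: ifPn => // /Hjj H1.
  by rewrite divr_gt0 // mulr_gt0 // cen_gt0.
have gf j : L j (vadd f (- e) (hom (cen P))) < L j f.
  by rewrite L_vadd; have := mulr_gt0 e0 (cen_gt0 j); lra.
exists (vadd f (- e) (hom (cen P))) => //.
apply/eqP; rewrite eqEsubset (A_mono (fun j => ltW (gf j))) andbT; apply/subsetP => x.
rewrite !inE => /inFP gx; apply/negPn/negP => fx.
have := eP x; rewrite /G (negbTE fx); have c0 := cen_gt0 (jj x).
have d0 : 0 < 2 * L (jj x) (hom (cen P)) by lra.
rewrite ler_pdivlMr //; have := gx (jj x); rewrite L_vadd.
by have := Hjj x fx; lra.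
Qed.

Hypothesis Hgen : forall j, injective (fun x => L j (pt (pos x))).

Lemma pos_inj : injective pos.
Proof. by move=> x y e; have [j _] := side_ex P; apply: (Hgen (j := j)); rewrite e. Qed.

Lemma below_ex x y : x != y -> exists j, L j (pt (pos y)) < L j (pt (pos x)).
Proof.
move=> xy.
have [j Hj|Hn] := pickP (fun j : P => L j (pt (pos y)) < L j (pt (pos x))); first by exists j.
case/eqP: xy; apply: pos_inj; apply: (@pt_eq_of_le _ P) => j.
by have := Hn j; rewrite ltNge => /negbFE.
Qed.

(* Shrinking [f] towards [c] loses the points one at a time: the last condition excludes
   ties, and holds for [c] generic on a cubic curve through [pos x]. *)
Lemma shrink_center f x : (forall j, L j f < L j (pt (pos x))) ->
  exists c, [/\ forall j, L j f < L j c, forall j, L j c < L j (pt (pos x)),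
   forall y, y != x -> exists j, L j (pt (pos y)) < L j c &
   forall i j (a b : R), 0 < a -> 0 < b -> i != j ->
     (exists y z, a = L i (pt (pos y)) - L i f /\ b = L j (pt (pos z)) - L j f) ->
     a * (L j c - L j f) != b * (L i c - L i f)].
Proof.
move=> fx.
have H y : exists j, y != x -> 0 < L j (pt (pos x)) - L j (pt (pos y)).
  have [_|yx] := eqVneq y x; first by have [j _] := side_ex P; exists j.
  by have [|j] := @below_ex x y; rewrite 1?eq_sym //; exists j; rewrite subr_gt0.
have [jj Hjj] := choice H.
pose w j := L j (hom (cen P)).
have w0 j : 0 < w j := cen_gt0 j.
pose G y := if y == x then 1 else (L (jj y) (pt (pos x)) - L (jj y) (pt (pos y))) / (2 * w (jj y)).
have [e1 e10 e1P] : exists2 e : R, 0 < e & forall y, e <= G y.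
  apply: fin_pos_lb => y; rewrite /G; case: ifPn => // yx.
  by rewrite divr_gt0 ?Hjj // mulr_gt0.
have [e2 e20 e2P] : exists2 e : R, 0 < e & forall j, e <= (L j (pt (pos x)) - L j f) / (2 * w j).
  by apply: fin_pos_lb => j; rewrite divr_gt0 ?subr_gt0 // mulr_gt0.
have [e3 e30 e3P] : exists2 e : R, 0 < e & forall j, e <= w j / (2 * (`|n1 j| + `|n2 j| + 1)).
  by apply: fin_pos_lb => j; rewrite divr_gt0 // mulr_gt0 // ltr_wpDl // addr_ge0.
pose a0 (t : P * P * I * I) := L t.1.1.1 (pt (pos t.1.2)) - L t.1.1.1 f.
pose b0 (t : P * P * I * I) := L t.1.1.2 (pt (pos t.2)) - L t.1.1.2 f.
pose F (t : P * P * I * I) (z : R * R * R) := a0 t * L t.1.1.2 z - b0 t * L t.1.1.1 z.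
pose good t := [&& 0 < a0 t, 0 < b0 t & t.1.1.1 != t.1.1.2].
pose q t : {poly R} := if good t then
   (F t (vadd (pt (pos x)) (-1) f))%:P - (F t (hom (cen P)))%:P * 'X
    - (F t (1, 0, 0))%:P * 'X^2 - (F t (0, 1, 0))%:P * 'X^3 else 1.
have [||s /andP[s0 sd] qs] := @poly_avoid _ _ q (Num.min (Num.min e1 e2) (Num.min e3 1)).
- by rewrite !lt_min e10 e20 e30 ltr01.
- move=> t; rewrite /q; case: ifPn => [/and3P[a00 b00 ij]|_]; last exact: oner_neq0.
  apply/eqP => q0.
  have c2 : F t (1, 0, 0) = 0.
    by have := congr1 (fun p : {poly R} => p`_2) q0; rewrite !coefE /= => h; lra.
  have c3 : F t (0, 1, 0) = 0.
    by have := congr1 (fun p : {poly R} => p`_3) q0; rewrite !coefE /= => h; lra.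
  move: c2 c3; rewrite /F /L /= => c2 c3.
  have a0n : a0 t != 0 by rewrite gt_eqF.
  have p1 : n1 t.1.1.2 = b0 t / a0 t * n1 t.1.1.1.
    apply: (mulfI a0n); rewrite [RHS](_ : _ = b0 t * n1 t.1.1.1); last by field.
    by lra.
  have p2 : n2 t.1.1.2 = b0 t / a0 t * n2 t.1.1.1.
    apply: (mulfI a0n); rewrite [RHS](_ : _ = b0 t * n2 t.1.1.1); last by field.
    by lra.
  by case/eqP: ij; rewrite (normals_indep (divr_gt0 b00 a00) p1 p2).
move: sd; rewrite !lt_min => /andP[/andP[se1 se2] /andP[se3 s1]].
pose v : R * R * R := ((cen P).1 + s, (cen P).2 + s ^+ 2, 1).
have Lv j : L j v = w j + s * n1 j + s ^+ 2 * n2 j by rewrite /L /w /v /L /hom /=; ring.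
have vb j : w j / 2 <= L j v <= 3 * w j / 2.
  have := e3P j; have d0 : 0 < 2 * (`|n1 j| + `|n2 j| + 1).
    by rewrite mulr_gt0 // ltr_wpDl // addr_ge0.
  rewrite ler_pdivlMr // => h3.
  have h4 : s * (2 * (`|n1 j| + `|n2 j| + 1)) <= w j.
    by apply: le_trans h3; rewrite ler_wpM2r ?ltW.
  have h1 : `|s * n1 j + s ^+ 2 * n2 j| <= s * (`|n1 j| + `|n2 j|).
    apply: le_trans (ler_normD _ _) _; rewrite !normrM !(gtr0_norm s0) mulrDr lerD2l.
    rewrite -mulrA ler_wpM2l ?(ltW s0) // ler_piMl //; exact: ltW.
  rewrite Lv; move: h1; rewrite ler_norml => /andP[h1 h2].
  by apply/andP; split; lra.
have v0 j : 0 < L j v by have := vb j; have := w0 j; lra.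
have Lc j : L j (vadd (pt (pos x)) (- s) v) = L j (pt (pos x)) - s * L j v.
  by rewrite L_vadd mulNr.
exists (vadd (pt (pos x)) (- s) v); split.
- move=> j; rewrite Lc; have := e2P j; rewrite ler_pdivlMr; last by rewrite mulr_gt0.
  have h : s * (2 * w j) < e2 * (2 * w j) by rewrite ltr_pM2r // mulr_gt0.
  have := vb j => /andP[_ vb2]; have := ler_wpM2l (ltW s0) vb2.
  by have := mulr_gt0 s0 (w0 j); lra.
- by move=> j; rewrite Lc; have := mulr_gt0 s0 (v0 j); lra.
- move=> y yx; exists (jj y); rewrite Lc; have := e1P y; rewrite /G (negbTE yx).
  rewrite ler_pdivlMr; last by rewrite mulr_gt0.
  have h : s * (2 * w (jj y)) < e1 * (2 * w (jj y)) by rewrite ltr_pM2r // mulr_gt0.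
  have := vb (jj y) => /andP[_ vb2]; have := ler_wpM2l (ltW s0) vb2.
  by have := mulr_gt0 s0 (w0 (jj y)); lra.
move=> i j a b a00 b00 ij [y [z [ea eb]]].
have := qs (i, j, y, z); rewrite /q /good /a0 /b0 /= -ea -eb a00 b00 ij /=.
rewrite !hornerE; apply: contraNneq => e.
rewrite /F /a0 /b0 /= -ea -eb; apply/eqP.
move: e; rewrite !Lc !Lv /w /L /vadd /hom /=; lra.
Qed.

(** Move [f1] linearly towards [c]; [tau y] is the moment at which [y] is lost. These moments are
    distinct by the choice of [c], above 1 for [x] and below 1 for the other points, so [x] goes
    last. Stopping at the second moment [tau z] loses exactly the first point, as the homothets are
    closed. *)
Lemma shrink f x X : x \in A f :&: X -> (1 < #|A f :&: X|)%N ->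
  exists2 g, x \in A g & exists2 y, y \in A f :&: X & A g :&: X = (A f :&: X) :\ y.
Proof.
have [f1 f1f Af1] := robust f; rewrite -Af1; set Y := A f1 :&: X => xY Y2.
have fY y : y \in Y -> forall j, L j f1 < L j (pt (pos y)).
  rewrite /Y Af1 !inE => /andP[/inFP fy _] j; exact: lt_le_trans (f1f j) (fy j).
have [c [fc cx xc cN]] := shrink_center (fY x xY).
have d0 j : 0 < L j c - L j f1 by rewrite subr_gt0.
have [j0 _] := side_ex P.
pose jt y := [arg min_(j < j0) (L j (pt (pos y)) - L j f1) / (L j c - L j f1)]%O.
pose tau y := (L (jt y) (pt (pos y)) - L (jt y) f1) / (L (jt y) c - L (jt y) f1).
have tauP y j : tau y * (L j c - L j f1) <= L j (pt (pos y)) - L j f1.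
  rewrite -ler_pdivlMr // /tau /jt; case: arg_minP => // k _ H; exact: H.
have tauE y : tau y * (L (jt y) c - L (jt y) f1) = L (jt y) (pt (pos y)) - L (jt y) f1.
  by rewrite divfK // gt_eqF.
have tau0 y : y \in Y -> 0 < tau y.
  by move=> yY; rewrite divr_gt0 // subr_gt0 fY.
have tauI y z : y \in Y -> z \in Y -> tau y = tau z -> y = z.
  move=> yY zY e; have ey := tauE y; have ez := tauE z.
  have [jj|jj] := eqVneq (jt y) (jt z).
    by apply: (Hgen (j := jt y)); move: ez; rewrite -jj -e ey; lra.
  have ay : 0 < L (jt y) (pt (pos y)) - L (jt y) f1 by rewrite subr_gt0 fY.
  have az : 0 < L (jt z) (pt (pos z)) - L (jt z) f1 by rewrite subr_gt0 fY.
  have := cN _ _ _ _ ay az jj (ex_intro _ y (ex_intro _ z (conj erefl erefl))).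
  by rewrite -ey -ez e mulrAC eqxx.
have mem y (u : R) : 0 < u -> (y \in A (vadd f1 u (vadd c (-1) f1))) = (u <= tau y).
  move=> u0; rewrite inE; apply/inFP/idP => [H|H j].
    have := H (jt y); rewrite !L_vadd /tau ler_pdivlMr //; lra.
  have := tauP y j; have := ler_wpM2r (ltW (d0 j)) H; rewrite !L_vadd; lra.
pose y := [arg min_(z < x in Y) tau z]%O.
have [yY ymin] : y \in Y /\ forall z, z \in Y -> tau y <= tau z.
  by rewrite /y; case: arg_minP.
have taux : 1 < tau x.
  by rewrite /tau ltr_pdivlMr // mul1r ltrD2r.
have yx : y != x.
  have [z zY zx] : exists2 z, z \in Y & z != x.
    have /card_gt0P[z] : (0 < #|Y :\ x|)%N by move: Y2; rewrite (cardsD1 x) xY; lia.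
    by rewrite in_setD1 => /andP[zx zY]; exists z.
  apply/eqP => yx; have := ymin z zY; rewrite yx; have [j Hj] := xc z zx.
  have : tau z < 1.
    apply: le_lt_trans (_ : (L j (pt (pos z)) - L j f1) / (L j c - L j f1) < 1).
      by rewrite ler_pdivlMr.
    by rewrite ltr_pdivrMr // mul1r ltrD2r.
  by lra.
have xY' : x \in Y :\ y by rewrite in_setD1 eq_sym yx.
pose z := [arg min_(z < x in Y :\ y) tau z]%O.
have [zY zmin] : z \in Y :\ y /\ forall z', z' \in Y :\ y -> tau z <= tau z'.
  by rewrite /z; case: arg_minP.
have /andP[zy zY'] : (z != y) && (z \in Y) by move: zY; rewrite in_setD1.
exists (vadd f1 (tau z) (vadd c (-1) f1)); first by rewrite mem ?tau0 // zmin.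
exists y => //; apply/setP => v; rewrite !in_setI in_setD1 in_setI mem ?tau0 //.
have [vX|] := boolP (v \in X); rewrite ?andbF // !andbT.
have [->|vy] /= := eqVneq v y.
  apply/negbTE; rewrite -ltNge lt_neqAle ymin // andbT.
  by apply/eqP => e; case/eqP: zy; apply: tauI.
apply/idP/idP => [H|vf]; last by apply: zmin; rewrite in_setD1 vy in_setI vf.
have : v \in A (vadd f1 (tau z) (vadd c (-1) f1)) by rewrite mem ?tau0.
apply/subsetP/A_mono => j; rewrite !L_vadd.
by have := mulr_gt0 (tau0 z zY') (d0 j); lra.
Qed.

End Points.

(** * Plane graphs have a vertex of degree at most five *)

Lemma affine_zero (R : realType) (u v s t : R) : s < t -> 0 < u + v * s -> u + v * t <= 0 ->
  exists2 r : R, s < r <= t & u + v * r = 0.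
Proof.
move=> st Hs Ht; have v0 : v < 0.
  by rewrite ltNge; apply/negP => v0; have := ler_wpM2l v0 (ltW st); lra.
have vn : v != 0 by rewrite lt_eqF.
exists (- u / v); last by rewrite mulrC divfK // subrr.
by rewrite ltr_ndivlMr // ler_ndivrMr //; apply/andP; split; lra.
Qed.

Section PlaneGraph.
Variables (R : realType) (I : finType) (pos : I -> R * R) (Y : {set I}) (e : rel I).
Implicit Types (p q a b c v w : I).
Let x v := (pos v).1.
Let h v := (pos v).2.
Hypothesis h_inj : injective h.
Hypothesis e_sym : symmetric e.
Hypothesis e_irr : forall p, ~~ e p p.
Hypothesis e_mem : forall p q, e p q -> p \in Y.
Hypothesis e_vtx : forall p a v (s : R), e p a -> v \in Y -> v != p -> v != a ->
  0 <= s <= 1 -> onseg (pos p) (pos a) s <> pos v.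
Hypothesis e_cross : forall p a q b (s t : R), e p a -> e q b ->
  p != q -> p != b -> a != q -> a != b -> 0 <= s <= 1 -> 0 <= t <= 1 ->
  onseg (pos p) (pos a) s <> onseg (pos q) (pos b) t.

(** Change of [x] per unit of height: among edges going down from [p], a smaller slope means further
    to the right. *)
Definition slope p a := (x p - x a) / (h p - h a).
Definition xat p a (t : R) := x p + slope p a * (t - h p).
Definition dn p a := e p a && (h a < h p).

Lemma xat_top p a : xat p a (h p) = x p.
Proof. by rewrite /xat subrr mulr0 addr0. Qed.

Lemma xat_bot p a : dn p a -> xat p a (h a) = x a.
Proof.
move=> /andP[_ ap]; rewrite /xat /slope; have d : h p - h a != 0 by rewrite subr_eq0 gt_eqF.
by field.
Qed.

Lemma xatE p a (t : R) : dn p a -> h a <= t <= h p ->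
  exists2 s : R, 0 <= s <= 1 & onseg (pos p) (pos a) s = (xat p a t, t).
Proof.
move=> /andP[_ ap] /andP[at_ tp]; have d0 : 0 < h p - h a by rewrite subr_gt0.
have d : h p - h a != 0 by rewrite gt_eqF.
exists ((h p - t) / (h p - h a)).
  by rewrite ler_pdivlMr // ler_pdivrMr // mul0r mul1r; apply/andP; split; lra.
by rewrite /onseg /xat /slope -/(x p) -/(x a) -/(h p) -/(h a); congr (_, _); field.
Qed.

Lemma dn_vtx p a v : dn p a -> v \in Y -> v != p -> v != a -> h a <= h v <= h p ->
  xat p a (h v) <> x v.
Proof.
move=> pa vY vp va hv E; have [s s01 es] := xatE pa hv; case/andP: pa => pa _.
by apply: (e_vtx pa vY vp va s01); rewrite es E [pos v]surjective_pairing.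
Qed.

Lemma dn_mem p a : dn p a -> p \in Y /\ a \in Y.
Proof. by case/andP=> pa _; split; [apply: e_mem pa | apply: (@e_mem a p); rewrite e_sym]. Qed.

Lemma dn_meet_top p a b (t : R) : dn p a -> dn p b -> t < h p -> xat p a t = xat p b t -> a = b.
Proof.
move=> pa pb tp E; apply/eqP/negPn/negP => ab.
have {}E : slope p a = slope p b.
  by move: E => /addrI /mulIf; apply; rewrite subr_eq0 lt_eqF.
wlog hab : a b pa pb ab E / h a < h b.
  move=> W; have [ha|ha|/h_inj] := ltgtP (h a) (h b); first exact: (W a b).
    by apply: (W b a) => //; rewrite eq_sym.
  by move/eqP; rewrite (negbTE ab).
have [_ bY] := dn_mem pb; case/andP: (pb) => _ hb.
apply: (dn_vtx pa bY); rewrite 1?eq_sym // ?ltW //.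
- by apply: contraTneq hb => <-; rewrite ltxx.
- by rewrite -(xat_bot pb) /xat E.
Qed.

Lemma dn_meet_bot p q a (t : R) : dn p a -> dn q a -> h a < t -> xat p a t = xat q a t -> p = q.
Proof.
move=> pa qa ta E; apply/eqP/negPn/negP => pq.
have xa r (s : R) : dn r a -> xat r a s = x a + slope r a * (s - h a).
  by move=> ra; have := xat_bot ra; rewrite /xat => <-; ring.
have {}E : slope p a = slope q a.
  by move: E; rewrite !xa // => /addrI /mulIf; apply; rewrite subr_eq0 gt_eqF.
wlog hpq : p q pa qa pq E / h p < h q.
  move=> W; have [ha|ha|/h_inj] := ltgtP (h p) (h q); first exact: (W p q).
    by apply: (W q p) => //; rewrite eq_sym.
  by move/eqP; rewrite (negbTE pq).
have [pY _] := dn_mem pa; case/andP: (pa) => _ hp.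
apply: (dn_vtx qa pY) => //; first by apply: contraTneq hp => ->; rewrite ltxx.
- by rewrite !ltW.
- by rewrite -(xat_top p a) !xa // E.
Qed.

Lemma dn_meet p a q b (t : R) : dn p a -> dn q b -> h a < t <= h p -> h b < t <= h q ->
  xat p a t = xat q b t -> p = q /\ (t = h p \/ a = b).
Proof.
move=> pa qb /andP[at_ tp] /andP[bt tq] E.
have [pq|pq] := eqVneq p q.
  split=> //; subst q; have [tp'|tp'] := eqVneq t (h p); first by left.
  by right; apply: dn_meet_top pa qb _ E; rewrite lt_neqAle tp'.
exfalso; have [ab|ab] := eqVneq a b.
  by subst b; case/eqP: pq; apply: dn_meet_bot pa qb _ E.
have [|s s01 es] := @xatE p a t pa; first by rewrite ltW.
have [|s' s01' es'] := @xatE q b t qb; first by rewrite ltW.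
case/andP: pa => pa ap; case/andP: qb => qb bq.
apply: (e_cross pa qb pq _ _ ab s01 s01'); last by rewrite es es' E.
- by apply/eqP => pb; move: bt; rewrite -pb; lra.
- by apply/eqP => aq; move: at_; rewrite aq; lra.
Qed.

Definition nextr p a b := [/\ dn p a, dn p b, slope p b < slope p a &
  forall c, dn p c -> ~ (slope p b < slope p c < slope p a)].

(** The vertices in the triangle below [p] bounded by the two edges and by the horizontal line
    through the higher of their lower ends. *)
Definition wedge p a b v := [&& v \in Y, Num.max (h a) (h b) <= h v < h p &
  xat p a (h v) <= x v <= xat p b (h v)].

Definition top_wedge p a b w := wedge p a b w /\ forall v, wedge p a b v -> h v <= h w.

Lemma xat_lt p a b (t : R) : t < h p -> (xat p a t < xat p b t) = (slope p b < slope p a).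
Proof. by move=> tp; rewrite /xat ltrD2l ltr_nM2r // subr_lt0. Qed.

(** An edge strictly between the two at the level of [w] can meet neither of them higher up. So
    either it is squeezed onto [p] at the level of [p], or its upper end lies in the wedge above
    [w], or it starts at [p] between consecutive edges; all are impossible. *)
Lemma top_wedge_clear p a b w q c : nextr p a b -> top_wedge p a b w -> dn q c ->
  h c <= h w < h q -> xat p a (h w) < xat q c (h w) < xat p b (h w) -> False.
Proof.
move=> [pa pb sab nx] [/and3P[wY /andP[]]]; rewrite ge_max => /andP[aw bw] wp _ wmax.
move=> qc /andP[cw wq] /andP[lo hi].
have [E|pq] := eqVneq q p.
  by subst q; apply: (nx c qc); move: lo hi; rewrite !xat_lt // => -> ->.
have key d (t : R) : dn p d -> h d <= h w -> h w < t -> t <= h p -> t <= h q ->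
    xat q c t = xat p d t -> False.
  move=> pd dw wt tp tq E; have [] := dn_meet qc pd _ _ E.
  - by rewrite tq andbT; apply: le_lt_trans cw wt.
  - by rewrite tp andbT; apply: le_lt_trans dw wt.
  - by move=> qp; rewrite qp eqxx in pq.
have hi2 (t : R) : h w < t -> t <= h p -> t <= h q -> xat p b t <= xat q c t -> False.
  move=> wt tp tq H.
  have [||r /andP[r1 r2] Er] := @affine_zero _ (xat p b 0 - xat q c 0) (slope p b - slope q c) (h w) t wt.
  - by move: hi; rewrite /xat; lra.
  - by move: H; rewrite /xat; lra.
  - by apply: (key b r) => //; [lra|lra|move: Er; rewrite /xat; lra].
have lo2 (t : R) : h w < t -> t <= h p -> t <= h q -> xat q c t <= xat p a t -> False.
  move=> wt tp tq H.
  have [||r /andP[r1 r2] Er] := @affine_zero _ (xat q c 0 - xat p a 0) (slope q c - slope p a) (h w) t wt.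
  - by move: lo; rewrite /xat; lra.
  - by move: H; rewrite /xat; lra.
  - by apply: (key a r) => //; [lra|lra|move: Er; rewrite /xat; lra].
have [pq'|qp] := leP (h p) (h q).
  have := hi2 _ wp (lexx _) pq'; have := lo2 _ wp (lexx _) pq'; rewrite !xat_top.
  by have [xx|xx] := leP (x p) (xat q c (h p)) => H1 H2; [apply: H2 | apply: H1; exact: ltW].
have [qY _] := dn_mem qc.
have [Hw|Hw] := boolP (wedge p a b q); first by have := wmax q Hw; lra.
move: Hw; rewrite /wedge qY qp ge_max /= andbT (le_trans aw (ltW wq)) (le_trans bw (ltW wq)) /=.
rewrite negb_and -!ltNge => /orP[H|H].
  by apply: (lo2 (h q)) => //; rewrite ?xat_top ltW.
by apply: (hi2 (h q)) => //; rewrite ?xat_top ltW.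
Qed.

Definition rightmost p a := dn p a /\ forall c, dn p c -> slope p a <= slope p c.

Lemma slope_inj p a b : dn p a -> dn p b -> slope p a = slope p b -> a = b.
Proof.
move=> pa pb E; apply: (@dn_meet_top p a b (h p - 1)) => //; first by lra.
by rewrite /xat E.
Qed.

Lemma nextr_ex p a : dn p a -> rightmost p a \/ exists b, nextr p a b.
Proof.
move=> pa; have [b0 /andP[pb0 sb0]|H] := pickP (fun b => dn p b && (slope p b < slope p a)); last first.
  by left; split=> // c pc; have := H c; rewrite pc /= ltNge => /negbFE.
right; have Pb : dn p b0 && (slope p b0 < slope p a) by rewrite pb0.
have := @arg_maxP _ _ _ b0 (fun b => dn p b && (slope p b < slope p a)) (slope p) Pb.
case=> b /andP[pb sb] bmax; exists b; split=> // c pc /andP[c1 c2].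
have : slope p c <= slope p b by apply: bmax; rewrite pc c2.
by lra.
Qed.

Lemma top_wedge_ex p a b : nextr p a b -> exists w, top_wedge p a b w.
Proof.
move=> [pa pb sab nx]; pose m := if h a <= h b then b else a.
have [aY bY] : a \in Y /\ b \in Y by split; [have [] := dn_mem pa | have [] := dn_mem pb].
case/andP: (pa) => _ ha; case/andP: (pb) => _ hb.
have Pm : wedge p a b m.
  rewrite /wedge /m ge_max; case: ifPn => [hab|]; [|rewrite -ltNge => hab].
    rewrite bY hab lexx hb /= (xat_bot pb) lexx andbT.
    by apply: ltW; rewrite -(xat_bot pb) xat_lt.
  rewrite aY lexx (ltW hab) ha /= (xat_bot pa) lexx /=.
  by apply: ltW; rewrite -(xat_bot pa) xat_lt.
have := @arg_maxP _ _ _ m (wedge p a b) h Pm.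
by case=> w Pw wmax; exists w; split.
Qed.

(* [(v, None)] stands for the rightmost edge going down from [v]; [(v, Some true)] and
   [(v, Some false)] for the first edge met by the horizontal ray from [v] to the right
   and to the left. *)
Definition charged p a (o : I * option bool) : Prop :=
  (o = (p, None) /\ rightmost p a) \/
  (exists b w, [/\ nextr p a b, top_wedge p a b w & o = (w, Some (w != b))]).

Lemma charged_ex p a : dn p a -> exists o, charged p a o.
Proof.
move=> pa; have [r|[b n]] := nextr_ex pa; first by exists (p, None); left.
by have [w tw] := top_wedge_ex n; exists (w, Some (w != b)); right; exists b, w.
Qed.

Lemma nextr_inj p a a' b : nextr p a b -> nextr p a' b -> a = a'.
Proof.
move=> [pa pb sb nx] [pa' _ sb' nx']; apply: (slope_inj pa pa').
have [s|s|//] := ltgtP (slope p a) (slope p a').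
  by have := nx' a pa; rewrite s sb.
by have := nx a' pa'; rewrite s sb'.
Qed.

Lemma wedge_bot p a b w : nextr p a b -> wedge p a b w -> w != b ->
  h b < h w /\ x w < xat p b (h w).
Proof.
move=> [pa pb sb nx] /and3P[wY /andP[]]; rewrite ge_max => /andP[aw bw] wp /andP[_ xw] wb.
have bw' : h b < h w.
  by rewrite lt_neqAle bw andbT; apply: contraNneq wb => /h_inj ->.
split=> //; rewrite lt_neqAle xw andbT; apply/eqP => E.
apply: (dn_vtx pb wY _ wb) (esym E); first by apply: contraTneq wp => ->; rewrite ltxx.
by rewrite bw ltW.
Qed.

(** Two edges charged to the same ray would both be the first one met; [top_wedge_clear] forbids
    that one of them is strictly closer. *)
Lemma charged_inj p a q c o : charged p a o -> charged q c o -> (p, a) = (q, c).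
Proof.
move=> [[-> [pa ra]]|[b [w [n tw ->]]]] [[E [qc rc]]|[d [v [n' tv E]]]] //.
  case: E => E; subst q; congr (_, _).
  by apply: (slope_inj pa qc); apply/le_anti; rewrite ra // rc.
case: E => vw; subst v; case: (eqVneq w b) (eqVneq w d) => [wb|wb] [wd|wd] // _.
  subst b d; case: (n) (n') => [pa pw s1 _] [qc qw s2 _].
  have [/and3P[_ /andP[]]] := tw; rewrite ge_max lexx andbT => aw wp _ _.
  have [/and3P[_ /andP[]]] := tv; rewrite ge_max lexx andbT => cw wq _ _.
  have aw' : h a < h w.
    by rewrite lt_neqAle aw andbT; apply/eqP => /h_inj E; move: s1; rewrite E ltxx.
  have cw' : h c < h w.
    by rewrite lt_neqAle cw andbT; apply/eqP => /h_inj E; move: s2; rewrite E ltxx.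
  have [xx|xx|xx] := ltgtP (xat p a (h w)) (xat q c (h w)).
  - have [] := top_wedge_clear n tw qc; first by rewrite cw wq.
    by rewrite xx (xat_bot pw) -(xat_bot qw) xat_lt.
  - have [] := top_wedge_clear n' tv pa; first by rewrite aw wp.
    by rewrite xx (xat_bot qw) -(xat_bot pw) xat_lt.
  - have [||-> [E|->] //] := dn_meet pa qc _ _ xx; rewrite ?aw' ?cw' ?(ltW wp) ?(ltW wq) //.
    by move: wq; rewrite E ltxx.
have [bw xb] := wedge_bot n (proj1 tw) wb; have [dw xd] := wedge_bot n' (proj1 tv) wd.
case: (n) (n') => [pa pb s1 _] [qc qd s2 _].
have [/and3P[_ /andP[_ wp] /andP[xa _]] _] := tw.
have [/and3P[_ /andP[_ wq] /andP[xc _]] _] := tv.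
have [xx|xx|xx] := ltgtP (xat p b (h w)) (xat q d (h w)).
- have [] := top_wedge_clear n' tv pb; first by rewrite (ltW bw) wp.
  by rewrite xx andbT; apply: le_lt_trans xc xb.
- have [] := top_wedge_clear n tw qd; first by rewrite (ltW dw) wq.
  by rewrite xx andbT; apply: le_lt_trans xa xd.
- have [||pq [E|bd]] := dn_meet pb qd _ _ xx; rewrite ?bw ?dw ?(ltW wp) ?(ltW wq) //.
    by move: wp; rewrite E ltxx.
  by subst q d; rewrite (nextr_inj n n').
Qed.

Lemma charged_mem p a o : charged p a o -> o.1 \in Y.
Proof.
case=> [[-> [/dn_mem[pY _] _]] //|[b [w [_ [/and3P[wY _ _] _] ->]]]] //.
Qed.

Definition edges := [set pa : I * I | e pa.1 pa.2].

(** Each vertex offers three charges, and the lowest vertex has no downward edge, so its [None]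
    stays free: at most [3 * #|Y| - 1] downward edges, each counted twice in [edges]. *)
Lemma card_edges : Y != finset.set0 -> (#|edges| <= 6 * #|Y| - 2)%N.
Proof.
move=> /set0Pn[v0 v0Y].
pose dns := [set pa : I * I | dn pa.1 pa.2].
have ch (pa : I * I) : exists o, pa \in dns -> charged pa.1 pa.2 o.
  have [pd|_] := boolP (pa \in dns); last by exists (v0, None).
  by rewrite inE in pd; have [o] := charged_ex pd; exists o.
have [phi phiP] := choice ch.
have := @arg_minP _ _ _ v0 (fun v => v \in Y) h v0Y; case=> v vY vmin.
have D : (#|dns| <= 3 * #|Y| - 1)%N.
  rewrite -(card_in_imset (f := phi)); last first.
    move=> [p a] [q c] pd qd E; have := phiP _ pd; rewrite E => H1.
    exact: charged_inj H1 (phiP _ qd).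
  have sub : phi @: dns \subset setX Y [set: option bool] :\ (v, None).
    apply/subsetP => o /imsetP[pa pd ->]; have H := phiP _ pd.
    rewrite in_setD1 inE inE andbT (charged_mem H) andbT; apply/eqP => E.
    case: H; rewrite E; last by case=> [b [w [_ _ []]]].
    case=> [[ev] [/andP[pe pl] _]]; rewrite -ev in pe pl.
    have : h v <= h pa.2 by apply: vmin; apply: (@e_mem pa.2 v); rewrite e_sym.
    by lra.
  apply: leq_trans (subset_leq_card sub) _.
  have := cardsD1 (v, None : option bool) (setX Y [set: option bool]).
  rewrite in_setX vY in_setT cardsX cardsT card_option card_bool /= => c1.
  by rewrite [(3 * _)%N]mulnC c1 addKn.
have swap : #|[set pa : I * I | dn pa.2 pa.1]| = #|dns|.
  rewrite -(card_imset (mem dns) (f := fun pa : I * I => (pa.2, pa.1))); last by move=> [? ?] [? ?] [-> ->].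
  apply: eq_card => -[p a]; rewrite inE; apply/idP/imsetP => [H|[[q c]]].
    by exists (a, p); rewrite ?inE.
  by rewrite inE => H [-> ->].
have sub : edges \subset dns :|: [set pa : I * I | dn pa.2 pa.1].
  apply/subsetP => -[p a]; rewrite !inE /= /dn => pa; rewrite [e a p]e_sym pa /=.
  by case: (ltgtP (h a) (h p)) => // /h_inj E; move: pa; rewrite E (negbTE (e_irr p)).
have := subset_leq_card sub; rewrite cardsU swap.
have : (0 < #|Y|)%N by apply/card_gt0P; exists v0.
by lia.
Qed.

Lemma low_degree : Y != finset.set0 -> exists2 v, v \in Y & (#|[set a | e v a]| <= 5)%N.
Proof.
move=> Y0; have := card_edges Y0; have {Y0} : (0 < #|Y|)%N by rewrite card_gt0.
move=> Y0 cE; apply/exists_inP; apply: contraLR cE => /exists_inPn H; rewrite -ltnNge.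
have -> : #|edges| = (\sum_(v in Y) #|[set a | e v a]|)%N.
  rewrite -sum1_card (eq_bigl (fun pa : I * I => (pa.1 \in Y) && (pa.2 \in [set a | e pa.1 a]))); last first.
    by move=> [p a]; rewrite !inE /=; case: (boolP (e p a)) => [/e_mem->|_] //; rewrite andbF.
  rewrite -(pair_big_dep (mem Y) (fun p a => a \in [set a | e p a]) (fun _ _ => 1%N)) /=.
  by apply: eq_bigr => v _; rewrite sum1_card.
apply: leq_trans (_ : \sum_(v in Y) 6 <= _)%N; first by rewrite sum_nat_const; lia.
by apply: leq_sum => v vY; have := H v vY; rewrite -ltnNge.
Qed.

End PlaneGraph.

(** * The graph of two-point homothets *)

Section Graph.
Variables (R : realType) (P : polygon R) (I : finType) (pos : I -> R * R).
Implicit Types (j : P) (x y z p q a b v : I) (X Y M W : {set I}) (f g : R * R * R).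
Hypothesis Hgen : forall j, injective (fun x => L j (pt (pos x))).
Hypothesis Hy : injective (fun x => (pos x).2).
Local Notation A := (A P pos).

(** The graph is taken relative to [X] because deleting points only adds edges among the others
    ([adj_sub]); a low degree in [adj X] thus bounds the degree in [G] within [X]. *)
Definition adj X p q := (p != q) && `[< exists f, A f :&: X = [set p; q] >].

Lemma adjP X p q : reflect (p != q /\ exists f, A f :&: X = [set p; q]) (adj X p q).
Proof. by apply: (iffP andP) => -[pq /asboolP H]; split=> //; apply/asboolP. Qed.

Lemma adj_sym X : symmetric (adj X).
Proof. by move=> p q; rewrite /adj eq_sym finset.setUC. Qed.

Lemma adj_irr X p : ~~ adj X p p.
Proof. by rewrite /adj eqxx. Qed.

Lemma adj_mem X p q : adj X p q -> p \in X.
Proof. by move=> /adjP[_ [f E]]; have /setIP[] : p \in A f :&: X by rewrite E set21. Qed.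

Lemma adj_sub X Y p q : Y \subset X -> p \in Y -> q \in Y -> adj X p q -> adj Y p q.
Proof.
move=> YX pY qY /adjP[pq [f E]]; apply/adjP; split=> //; exists f.
rewrite -(setIidPr YX) finset.setIA E; apply/setP => x; rewrite !inE.
by case: eqP => [->|_] //=; case: eqP => [->|_].
Qed.

Lemma adj_homothet X p q : adj X p q -> exists f,
  [/\ p \in A f, q \in A f & forall v, v \in X -> v != p -> v != q -> v \notin A f].
Proof.
move=> /adjP[pq [f E]]; exists f.
have m v : v \in [set p; q] -> v \in A f by rewrite -E => /setIP[].
split; [by apply: m; rewrite set21|by apply: m; rewrite set22|].
move=> v vX vp vq; apply/negP => vf; have : v \in A f :&: X by rewrite inE vf.
by rewrite E !inE (negbTE vp) (negbTE vq).
Qed.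

(** Straight segments draw the graph: a segment meets no further point since homothets are convex,
    and disjoint edges do not cross by [noncross]. *)
Lemma adj_low_degree Y : Y != finset.set0 -> exists2 v, v \in Y & (#|[set a | adj Y v a]| <= 5)%N.
Proof.
apply: (low_degree (pos := pos) Hy (adj_sym Y) (adj_irr Y) (@adj_mem Y)).
- move=> p a v s pa vY vp va s01 E; have [f [pf af nf]] := adj_homothet pa.
  have := nf v vY vp va; rewrite !inE in pf af *; rewrite -E; move/negP; apply.
  exact: inF_onseg.
move=> p a q b s t pa qb pq pb aq ab s01 t01 E.
have [f [pf af nf]] := adj_homothet pa; have [g [qg bg ng]] := adj_homothet qb.
have aY : a \in Y by apply: (@adj_mem Y a p); rewrite adj_sym.
have bY : b \in Y by apply: (@adj_mem Y b q); rewrite adj_sym.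
have pg := ng p (adj_mem pa) pq pb; have ag := ng a aY aq ab.
have qf := nf q (adj_mem qb); rewrite eq_sym pq eq_sym aq in qf; have {}qf := qf isT isT.
have bf := nf b bY; rewrite eq_sym pb eq_sym ab in bf; have {}bf := bf isT isT.
rewrite !inE in pf af qg bg pg ag qf bf.
exact: (noncross pf af pg ag qg bg qf bf s01 t01 E).
Qed.

End Graph.

Local Open Scope nat_scope.

(** * Degree counts, acyclic colourings and labels *)

Section Sparse.
Variables (I : finType) (e : rel I).
Hypothesis e_sym : symmetric e.
Hypothesis e_irr : forall p, ~~ e p p.
Implicit Types (M X : {set I}) (v a : I).

Definition nbr M v := [set a in M | e v a].
Definition deg_sum M := \sum_(v in M) #|nbr M v|.

Lemma in_nbr M v a : (a \in nbr M v) = (a \in M) && e v a.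
Proof. by rewrite inE. Qed.

Lemma nbrU1 M v a : v \notin M -> #|nbr (v |: M) a| = e a v + #|nbr M a|.
Proof.
move=> vM; rewrite (cardsD1 v) !inE eqxx /=; congr (_ + _); apply: eq_card => b.
by rewrite !inE; have [->|] := eqVneq b v; rewrite ?(negbTE vM).
Qed.

Lemma deg_sumU1 M v : v \notin M -> deg_sum (v |: M) = deg_sum M + 2 * #|nbr M v|.
Proof.
move=> vM; rewrite /deg_sum big_setU1 //= nbrU1 // (negbTE (e_irr v)) add0n.
rewrite (eq_bigr (fun a => e a v + #|nbr M a|)); last by move=> a _; rewrite nbrU1.
rewrite big_split /=; have -> : \sum_(a in M) e a v = #|nbr M v|.
  rewrite -sum1_card big_mkcond [RHS]big_mkcond /=; apply: eq_bigr => a _.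
  by rewrite inE e_sym; case: (a \in M) => //=; case: (e v a).
by rewrite mul2n -addnn addnA addnC addnA.
Qed.

Lemma deg_sum0 : deg_sum finset.set0 = 0.
Proof. by rewrite /deg_sum big_set0. Qed.

End Sparse.

Lemma pigeon_low (I : finType) (X : {set I}) (c : I -> 'I_3) : #|X| <= 5 ->
  exists k, #|[set a in X | c a == k]| <= 1.
Proof.
move=> X5; apply/existsP; apply: contraLR X5 => /existsPn H; rewrite -ltnNge.
have -> : #|X| = \sum_(k < 3) #|[set a in X | c a == k]|.
  rewrite -sum1_card (partition_big c predT) //=; apply: eq_bigr => k _.
  by rewrite -sum1_card; apply: eq_bigl => a; rewrite inE.
apply: leq_trans (_ : \sum_(k < 3) 2 <= _); first by rewrite sum_nat_const card_ord.
by apply: leq_sum => k _; rewrite ltnNge.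
Qed.

Section Colour.
Variables (R : realType) (P : polygon R) (I : finType) (pos : I -> R * R).
Implicit Types (j : P) (x y z p q a b v : I) (X Y M W : {set I}) (f g : R * R * R).
Hypothesis Hgen : forall j, injective (fun x => L j (pt (pos x))).
Hypothesis Hy : injective (fun x => (pos x).2).
Local Notation A := (A P pos).
Local Notation adj := (adj P pos).
Local Notation G := (adj [set: I]).

(** Among at most five neighbours of the new point, one of three colours occurs at most once. Giving
    it that colour adds at most one edge to any monochromatic set, which keeps the edges fewer than
    the points. *)
Lemma colour_ex : exists c : I -> 'I_3, forall M, M != finset.set0 ->
  {in M &, forall x y, c x = c y} -> deg_sum G M < 2 * #|M|.
Proof.
suff H n X : #|X| = n -> exists c : I -> 'I_3, forall M, M \subset X -> M != finset.set0 ->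
    {in M &, forall x y, c x = c y} -> deg_sum G M < 2 * #|M|.
  by have [c cP] := H _ _ (erefl #|[set: I]|); exists c => M; apply: cP; exact: finset.subsetT.
elim: n X => [|n IH] X Xn.
  exists (fun=> ord0) => M; rewrite (cards0_eq Xn) finset.subset0 => /eqP ->; by rewrite eqxx.
have [|v vX vdeg] := @adj_low_degree _ P _ pos Hy X; first by rewrite -card_gt0 Xn.
have [|c cP] := IH (X :\ v); first by move: Xn; rewrite (cardsD1 v) vX => -[].
have [|k kP] := @pigeon_low I (nbr G (X :\ v) v) c.
  apply: leq_trans vdeg; apply: subset_leq_card; apply/subsetP => a; rewrite !inE.
  by move=> /andP[/andP[_ aX] va]; apply: adj_sub va => //; exact: finset.subsetT.
exists (fun a => if a == v then k else c a) => M MX M0 mono.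
have [vM|vM] := boolP (v \in M); last first.
  apply: cP => //; first by rewrite subsetD1 MX.
  move=> x y xM yM; have := mono x y xM yM.
  by rewrite !ifN //; [apply: contraNneq vM => <-|apply: contraNneq vM => <-].
have vM' : v \notin M :\ v by rewrite !inE eqxx.
rewrite -(finset.setD1K vM) deg_sumU1 //; [|exact: adj_sym|exact: adj_irr].
rewrite cardsU1 vM' mulnDr addnC.
have ck a : a \in M :\ v -> c a = k.
  rewrite !inE => /andP[av aM]; have := mono a v aM vM; by rewrite (negbTE av) eqxx.
have n1 : #|nbr G (M :\ v) v| <= 1.
  apply: leq_trans kP; apply: subset_leq_card; apply/subsetP => a; rewrite in_nbr => /andP[aM va].
  rewrite inE (ck a aM) eqxx andbT in_nbr va andbT.
  by move: aM; rewrite !inE => /andP[-> /(subsetP MX)].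
have [M0'|M0'] := eqVneq (M :\ v) finset.set0.
  rewrite M0' deg_sum0 cards0 (_ : nbr _ _ _ = finset.set0) ?cards0 //.
  by apply/setP => a; rewrite !inE.
have := cP (M :\ v) (finset.setSD _ MX) M0'.
have mono' : {in M :\ v &, forall x y, c x = c y} by move=> x y xM yM; rewrite !ck.
by move=> /(_ mono'); lia.
Qed.

Lemma sub_size X f x k : x \in A f :&: X -> 0 < k <= #|A f :&: X| ->
  exists2 g, x \in A g & A g :&: X \subset A f :&: X /\ #|A g :&: X| = k.
Proof.
move: {2}(#|A f :&: X|) (leqnn #|A f :&: X|) => n.
elim: n f => [|n IH] f fn xf /andP[k0 kn]; first by move: (leq_trans kn fn); lia.
have [E|kn'] := eqVneq #|A f :&: X| k; first by exists f => //; case/setIP: xf.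
have [|g xg [y yf gE]] := shrink Hgen xf; first by lia.
have gc : #|A g :&: X| = #|A f :&: X|.-1 by rewrite gE [in RHS](cardsD1 y) yf.
have xX : x \in X by case/setIP: xf.
have xg1 : x \in A g :&: X by rewrite in_setI xg.
have [|| g' xg' [sub g'k]] := IH g _ xg1; rewrite ?gc; [by lia|by lia|].
exists g' => //; split=> //; apply: fintype.subset_trans sub _.
by rewrite gE subsetDl.
Qed.

Lemma nbr_ex X f x : x \in A f :&: X -> 1 < #|A f :&: X| ->
  exists2 y, y \in A f :&: X & adj X x y.
Proof.
move=> xf f2; have [|g xg [sub g2]] := @sub_size X f x 2 xf; first by rewrite f2.
have xg' : x \in A g :&: X by rewrite in_setI xg; case/setIP: xf.
have /cards1P[y yE] : #|(A g :&: X) :\ x| == 1 by move: g2; rewrite (cardsD1 x) xg' add1n => -[->].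
have yx : y \in (A g :&: X) :\ x by rewrite yE set11.
have /andP[yx' yg] : (y != x) && (y \in A g :&: X) by move: yx; rewrite in_setD1.
exists y; first exact: subsetP yg.
apply/adjP; split; first by rewrite eq_sym.
by exists g; rewrite -(finset.setD1K xg') yE.
Qed.

(** The edge count of a connected graph: shrinking loses points one at a time, and each lost point
    has a neighbour among those kept. *)
Lemma deg_sum_ge f : 2 * #|A f| <= deg_sum G (A f) + 2.
Proof.
move: {2}(#|A f|) (leqnn #|A f|) => n.
elim: n f => [|n IH] f fn; first by lia.
have [f1|f1] := leqP #|A f| 1; first by lia.
have /card_gt0P[x xf] : 0 < #|A f| by lia.
have [||g xg [y yf gE]] := @shrink _ _ _ _ Hgen f x [set: I]; rewrite ?finset.setIT //.
rewrite !finset.setIT in yf gE.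
have yg : y \notin A g by rewrite gE !inE eqxx.
have fE : A f = y |: A g by rewrite gE finset.setD1K.
have [||z zf yz] := @nbr_ex [set: I] f y; rewrite ?finset.setIT //.
rewrite finset.setIT in zf.
have : z \in nbr G (A g) y.
  rewrite inE yz andbT gE in_setD1 zf andbT; apply/eqP => zy.
  by move: yz; rewrite zy (negbTE (adj_irr _ _ _ _)).
move=> zn; have n0 : 0 < #|nbr G (A g) y| by apply/card_gt0P; exists z.
have cf : #|A f| = #|A g|.+1 by rewrite fE cardsU1 yg.
rewrite [in X in _ <= X + _]fE deg_sumU1 //; [|exact: adj_sym|exact: adj_irr].
by have := IH g; lia.
Qed.

Lemma proper_colour X : exists c : I -> 'I_6, forall p q, p \in X -> q \in X -> adj X p q -> c p != c q.
Proof.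
move: {2}(#|X|) (erefl #|X|) => n; elim: n X => [|n IH] X Xn.
  by exists (fun=> ord0) => p q; rewrite (cards0_eq Xn) inE.
have [|v vX vdeg] := @adj_low_degree _ P _ pos Hy X; first by rewrite -card_gt0 Xn.
have [|c cP] := IH (X :\ v); first by move: Xn; rewrite (cardsD1 v) vX => -[].
have [k kP] : exists k, k \notin c @: [set a | adj X v a].
  apply/existsP; rewrite -negb_forall; apply/negP => /forallP H.
  have : #|'I_6| <= #|c @: [set a | adj X v a]| by apply: subset_leq_card; apply/subsetP => k _.
  by rewrite card_ord => h6; have := leq_trans h6 (leq_imset_card c _); lia.
have kn a : adj X v a -> c a != k.
  by move=> va; apply: contraNneq kP => <-; apply/imsetP; exists a; rewrite ?inE.
exists (fun a => if a == v then k else c a) => p q pX qX pq.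
have [pv|pv] := eqVneq p v; have [qv|qv] := eqVneq q v.
- by move: pq; rewrite pv qv (negbTE (adj_irr _ _ _ _)).
- by rewrite eq_sym kn // -pv.
- by rewrite kn // -qv adj_sym.
have sub : X :\ v \subset X by rewrite subsetDl.
by apply: cP; rewrite ?in_setD1 ?pv ?qv //; apply: adj_sub pq => //; rewrite ?in_setD1 ?pv ?qv.
Qed.

(** In a proper 6-colouring, each point of a homothet with at least two points has a neighbour of
    another colour there, so a colour class meets it in at most [T - 1] points and induction applies
    to the class. The label is a number in base 6 whose last digit is the colour. *)
Lemma label_ex T X : exists2 h : I -> nat, forall p, h p < 6 ^ T &
  forall f, #|A f :&: X| <= T -> {in A f :&: X &, injective h}.
Proof.
elim: T X => [|T IH] X.
  exists (fun=> 0) => // f; rewrite leqn0 => /eqP/cards0_eq -> x y; by rewrite inE.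
have [c cP] := proper_colour X.
have H (k : 'I_6) : exists h : I -> nat, (forall p, h p < 6 ^ T) /\
    forall f, #|A f :&: [set a in X | c a == k]| <= T -> {in A f :&: [set a in X | c a == k] &, injective h}.
  by have [h h1 h2] := IH [set a in X | c a == k]; exists h.
have [h hP] := choice H.
exists (fun p => c p + 6 * h (c p) p).
  move=> p; rewrite expnS; have := (hP (c p)).1 p; have := ltn_ord (c p); lia.
move=> f fT p q pf qf E.
have [ec eh] : nat_of_ord (c p) = c q /\ h (c p) p = h (c q) q.
  by have := ltn_ord (c p); have := ltn_ord (c q); lia.
have {}ec : c p = c q by apply: val_inj.
have [f2|f2] := leqP #|A f :&: X| 1.
  by apply: (card_le1_eqP f2).
apply: ((hP (c p)).2 f) => //; last by rewrite eh ec.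
- have [y yf py] := nbr_ex pf f2; case/setIP: pf => pf pX; case/setIP: (yf) => yf' yX.
  rewrite -ltnS; apply: leq_trans fT; apply: proper_card.
  apply/properP; split.
    by apply/subsetP => a; rewrite !in_setI !inE => /andP[-> /andP[->]].
  by exists y => //; rewrite in_setI yf' inE yX /= eq_sym cP.
- by case/setIP: pf => pf pX; rewrite in_setI pf inE pX eqxx.
- by case/setIP: qf => qf qX; rewrite in_setI qf inE qX ec eqxx.
Qed.

End Colour.

(** * Recolouring *)

(** Greedy choice: out-degrees at most [d] leave a vertex of in-degree at most [d]; taking it
    discards at most [2 * d] others. *)
Lemma sparse_independent (I : finType) (r : rel I) (d m : nat) (U : {set I}) :
  (forall a, #|[set b in U | r a b]| <= d) -> (2 * d + 1) * m <= #|U| ->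
  exists2 V : {set I}, V \subset U & m <= #|V| /\ {in V &, forall a b, a != b -> ~~ r a b}.
Proof.
elim: m U => [|m IH] U rd Um.
  by exists finset.set0; rewrite ?finset.sub0set //; split=> // a b; rewrite inE.
have [b bU bd] : exists2 b, b \in U & #|[set a in U | r a b]| <= d.
  apply/exists_inP; apply: contraT => /exists_inPn H.
  have : \sum_(b in U) #|[set a in U | r a b]| = \sum_(a in U) #|[set b in U | r a b]|.
    have e1 : \sum_(b in U) #|[set a in U | r a b]| = \sum_(b in U) \sum_(a in U) r a b.
      apply: eq_bigr => b _; rewrite -sum1_card big_mkcond [RHS]big_mkcond.
      by apply: eq_bigr => a _; rewrite inE; case: (a \in U) => //=; case: (r a b).
    have e2 : \sum_(a in U) #|[set b in U | r a b]| = \sum_(a in U) \sum_(b in U) r a b.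
      apply: eq_bigr => a _; rewrite -sum1_card big_mkcond [RHS]big_mkcond.
      by apply: eq_bigr => b _; rewrite inE; case: (b \in U) => //=; case: (r a b).
    by rewrite e1 e2 exchange_big.
  have : \sum_(a in U) #|[set b in U | r a b]| <= #|U| * d.
    by rewrite -sum_nat_const; apply: leq_sum => a _.
  have : #|U| * d.+1 <= \sum_(b in U) #|[set a in U | r a b]|.
    by rewrite -sum_nat_const; apply: leq_sum => a aU; have := H a aU; rewrite -ltnNge.
  by lia.
pose N := b |: ([set a in U | r a b] :|: [set a in U | r b a]).
have Nc : #|N| <= 2 * d + 1.
  have := rd b; rewrite /N; have := cardsU1 b ([set a in U | r a b] :|: [set a in U | r b a]).
  have := cardsU [set a in U | r a b] [set a in U | r b a]; case: (b \notin _) => /=; lia.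
have [||V VU [Vm Vi]] := IH (U :\: N).
- move=> a; apply: leq_trans (rd a); apply: subset_leq_card; apply/subsetP => x.
  by rewrite !inE => /andP[/andP[_ ->]].
- by have := cardsID N U; have := subset_leq_card (subsetIr U N); lia.
have VN a : a \in V -> (a \in U) && (a \notin N) by move/(subsetP VU); rewrite in_setD andbC.
have bV : b \notin V by apply/negP => /VN; rewrite /N !inE eqxx andbF.
have bN a : a \in V -> ~~ r a b && ~~ r b a.
  move=> /VN /andP[aU]; rewrite /N !inE aU /= !negb_or => /andP[_ ->].
  by [].
exists (b |: V).
  apply/subsetP => a; rewrite in_setU1 => /predU1P[-> //|/VN /andP[]//].
split; first by rewrite cardsU1 bV.
move=> x y; rewrite !in_setU1 => /predU1P[->|xV] /predU1P[->|yV] xy; first by rewrite eqxx in xy.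
- by case/andP: (bN y yV).
- by case/andP: (bN x xV).
- exact: Vi.
Qed.

Lemma pigeon_three (I T : finType) (U : {set I}) (F : I -> T) : 2 * #|T| < #|U| ->
  exists t, exists2 p : 'I_3 -> I, injective p & forall k, p k \in U /\ F (p k) = t.
Proof.
move=> H; have [t Ht] : exists t, 2 < #|[set a in U | F a == t]|.
  apply/existsP; apply: contraLR H => /existsPn H; rewrite -leqNgt.
  have -> : #|U| = \sum_t #|[set a in U | F a == t]|.
    rewrite -sum1_card (partition_big F predT) //=; apply: eq_bigr => k _.
    by rewrite -sum1_card; apply: eq_bigl => a; rewrite inE.
  rewrite mulnC -sum_nat_const; apply: leq_sum => k _; have := H k; by rewrite -leqNgt.
exists t; exists (fun k => enum_val (widen_ord Ht k)).
  by move=> k l /enum_val_inj /(congr1 val) /= /val_inj.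
by move=> k; have := enum_valP (widen_ord Ht k); rewrite inE => /andP[-> /eqP].
Qed.

(** Points a homothet needs so that [M] points survive the avoidance of [k] given ones; each round
    shares the points among at most [C] covering homothets, as in [avoid1]. *)
Fixpoint avn (C k M : nat) := if k is k'.+1 then (C.+1 * avn C k' M).+2 else M.

Section Core.
Variables (R : realType) (P : polygon R) (I : finType) (pos : I -> R * R) (C : nat).
Implicit Types (j s t : P) (x y z p q a b v : I) (X Y W : {set I}) (f g : R * R * R).
Hypothesis HC : cover_const P C.
Hypothesis Hgen : forall j, injective (fun x => L j (pt (pos x))).
Hypothesis Hy : injective (fun x => (pos x).2).
Local Notation A := (A P pos).
Local Notation adj := (adj P pos).
Local Notation G := (adj [set: I]).

Lemma avoid1 f b M : (C.+1 * M).+1 < #|A f| -> exists2 g, A g \subset A f :\ b & M <= #|A g|.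
Proof.
move=> fM; have [bf|bf] := boolP (b \in A f); last first.
  exists f; last by lia.
  by apply/subsetP => x xf; rewrite in_setD1 xf andbT; apply: contraNneq bf => <-.
have [f1 f1f Af] := robust P pos f.
have str x : inF P f1 (pos x) -> forall j, (L j f1 < L j (pt (pos x)))%R.
  move=> xf j; have : x \in A f by rewrite -Af inE.
  by rewrite inE => /inFP/(_ j); apply: lt_le_trans.
have bf1 : inF P f1 (pos b) by move: bf; rewrite -Af inE.
have [fs fsC [fs1 fs2]] := HC (pos_inj Hgen) str bf1.
have [/hasP[g gs gM]|/hasPn H] := boolP (has (fun g => M <= #|A g|) fs).
  exists g => //; have [bg fg] := fs1 g gs; apply/subsetP => x xg.
  rewrite in_setD1 -Af (subsetP (A_mono _ fg)) // andbT.
  by apply: contraNneq bg => <-; move: xg; rewrite inE.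
exfalso.
have sub : A f :\ b \subset \bigcup_(g <- fs) A g.
  apply/subsetP => x; rewrite in_setD1 -Af => /andP[xb]; rewrite inE => xf.
  have [g gs xg] := fs2 x xf xb; rewrite (big_rem g) //= in_setU inE xg //.
have c1 : #|\bigcup_(g <- fs) A g| <= \sum_(g <- fs) #|A g|.
  elim: fs {fsC fs1 fs2 H sub} => [|g fs IH]; first by rewrite !big_nil cards0.
  rewrite !big_cons; apply: leq_trans (leq_add (leqnn _) IH); rewrite cardsU; lia.
have c2 : \sum_(g <- fs) #|A g| <= \sum_(g <- fs) M.
  rewrite big_seq [leqRHS]big_seq; apply: leq_sum => g /H; lia.
have c3 : \sum_(g <- fs) M = size fs * M by rewrite big_const_seq count_predT iter_addn_0 mulnC.
have := subset_leq_card sub; have := cardsD1 b (A f); rewrite bf.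
have : size fs * M <= C * M by rewrite leq_mul2r fsC orbT.
by rewrite mulSn in fM; lia.
Qed.

Lemma avoid k f (K : {set I}) M : #|K| <= k -> avn C k M <= #|A f| ->
  exists2 g, A g \subset A f :\: K & M <= #|A g|.
Proof.
elim: k f K => [|k IH] f K; first by rewrite leqn0 => /eqP/cards0_eq -> H; exists f; rewrite // finset.setD0.
move=> Kk fM; have [K0|[b bK]] := set_0Vmem K.
  have [||g gf gM] := IH f K _ _; rewrite ?K0 ?cards0 //; last by exists g; rewrite // -K0.
  by move: fM; rewrite /= -/(avn C k M); nia.
have [g gf gM] := avoid1 b fM.
have [|g' g'g g'M] := IH g (K :\ b) _ gM; first by move: Kk; rewrite (cardsD1 b) bK.
exists g' => //; apply/subsetP => x /(subsetP g'g); rewrite !in_setD in_set1.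
move=> /andP[xK xg]; have := subsetP gf x xg; rewrite in_setD1 => /andP[xb ->].
by rewrite andbT; move: xK; rewrite xb.
Qed.

Definition good p W := [/\ p \in W, 2 <= #|nbr G W p| &
  forall s, exists2 q, q \in W :\ p & (L s (pt (pos p)) <= L s (pt (pos q)))%R].

(** If at most [#|P|] points had degree two or more, a homothet with at least three points would
    avoid them all, and its degree sum would be too small for [deg_sum_ge]. So there are more such
    points than sides, and one of them is not the chosen extreme point of any side. *)
Lemma good_ex f : avn C #|P| 3 <= #|A f| -> exists p, good p (A f).
Proof.
move=> fT; pose Q := [set p in A f | 2 <= #|nbr G (A f) p|].
have [QP|QP] := leqP #|Q| #|P|.
  have [g gf g3] := avoid QP fT; have := deg_sum_ge Hgen g.
  have : deg_sum G (A g) <= #|A g| * 1.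
    rewrite -sum_nat_const; apply: leq_sum => v vg; have := subsetP gf v vg.
    rewrite in_setD => /andP[vQ vf]; rewrite -ltnS.
    apply: leq_ltn_trans (_ : #|nbr G (A f) v| < _).
      apply: subset_leq_card; apply/subsetP => a; rewrite !in_set => /andP[ag ->].
      by rewrite andbT; have := subsetP gf a; rewrite !in_set ag => /(_ isT) /andP[].
    by rewrite ltnNge; apply: contra vQ => H; rewrite inE vf.
  by lia.
have /card_gt0P[x0 x0f] : 0 < #|A f|.
  have sub : Q \subset A f by apply/subsetP => p; rewrite inE => /andP[].
  by have := subset_leq_card sub; lia.
pose ex s := [arg max_(x > x0 in A f) (L s (pt (pos x)))]%O.
have [p pQ pe] : exists2 p, p \in Q & p \notin ex @: [set: P].
  apply/exists_inP; apply: contraT => /exists_inPn H.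
  have : Q \subset ex @: [set: P] by apply/subsetP => p /H /negPn.
  move=> /subset_leq_card H1; have := leq_imset_card ex [set: P]; rewrite cardsT => H2.
  by have := leq_trans H1 H2; rewrite leqNgt QP.
move: pQ; rewrite inE => /andP[pf pd]; exists p; split=> // s.
have [xf xm] : ex s \in A f /\ forall y, y \in A f -> (L s (pt (pos y)) <= L s (pt (pos (ex s))))%R.
  by rewrite /ex; case: arg_maxP.
exists (ex s); last exact: xm.
rewrite in_setD1 xf andbT; apply: contraNneq pe => <-; exact: imset_f.
Qed.

Variable c : I -> 'I_3.
Hypothesis cP : forall M, M != finset.set0 -> {in M &, forall x y, c x = c y} ->
  deg_sum G M < 2 * #|M|.

Definition mono (W : {set I}) := {in W &, forall x y, c x = c y}.

Lemma three_tips_pts (F : R * R * R) (s t : P) (p u w : 'I_3 -> I) (fW : 'I_3 -> R * R * R) :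
  s != t -> injective p -> (forall j k, (L j F < L j (pt (pos (p k))))%R) ->
  (forall k, A (fW k) :&: A F = [set p k]) ->
  (forall k, u k \in A (fW k) /\ w k \in A (fW k)) ->
  (forall k, u k \notin A F /\ w k \notin A F) ->
  (forall k l, k != l -> u l \notin A (fW k)) ->
  (forall k, G (p k) (u k)) ->
  (forall k, exits F (pos (p k)) (pos (u k)) s /\ exits F (pos (p k)) (pos (w k)) t) -> False.
Proof.
move=> st pI Fp WF uw nuw uW pu ex.
have [fE fEP] := choice (fun k => adj_homothet (pu k)).
have pW k : p k \in A (fW k) by have : p k \in A (fW k) :&: A F by [rewrite WF set11]; case/setIP.
have pF k : p k \in A F by have : p k \in A (fW k) :&: A F by [rewrite WF set11]; case/setIP.
have pp k l : k != l -> p l != p k by move=> kl; apply: contraNneq kl => /pI ->.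
have inA f x : x \in A f -> inF P f (pos x) by rewrite inE.
have ninA f x : x \notin A f -> ~~ inF P f (pos x) by rewrite inE.
apply: (@three_tips R P F s t (pos \o p) (pos \o u) (pos \o w) fW fE) => //=.
- by move=> k; apply/inA.
- by move=> k; apply/inA; case: (uw k).
- by move=> k; apply/inA; case: (uw k).
- move=> k l kl; apply/ninA/negP => H; have : p l \in A (fW k) :&: A F by rewrite in_setI H pF.
  by rewrite WF in_set1 (negbTE (pp _ _ kl)).
- by move=> k l kl; apply/ninA/uW.
- by move=> k; apply/inA; case: (fEP k).
- by move=> k; apply/inA; case: (fEP k).
- move=> k l kl; apply/ninA; case: (fEP k) => _ _; apply; rewrite ?in_setT ?pp //.
  by apply: contraTneq (pF l) => ->; case: (nuw k).
- move=> k l kl; apply/ninA; case: (fEP k) => _ _; apply; rewrite ?in_setT //.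
    by apply: contraTneq (pF k) => <-; case: (nuw l).
  have := uW l k; rewrite eq_sym => /(_ kl); apply: contraNneq => <-; by case: (uw l).
- by move=> k; case: (ex k).
- by move=> k; case: (ex k).
Qed.

Definition tipb := 2 * #|{: P * P}| + 1.

(** The work is to give many tips a neighbour [u] lying in no other tip's homothet, as [three_tips]
    requires. The factor [tipb] then lets three tips share one ordered pair of exit sides. *)
Lemma tips_small (T : nat) (F : R * R * R) (U : {set I}) (f : I -> R * R * R) :
  U \subset A F -> {in U &, forall a b, c a = c b} ->
  (forall a, a \in U -> [/\ #|A (f a)| = T, mono (A (f a)), good a (A (f a)) & A (f a) :&: A F = [set a]]) ->
  #|U| < (2 * (T * tipb) + 1) * tipb.
Proof.
move=> UF Uc fP; rewrite ltnNge; apply/negP => Ub.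
have [g gF Ag] := robust P pos F.
have gU a : a \in U -> forall j, (L j g < L j (pt (pos a)))%R.
  move=> aU j; have := subsetP UF a aU; rewrite inE => /inFP/(_ j); exact: lt_le_trans.
have y12 a : exists y : I * I, a \in U ->
    [/\ y.1 != y.2, y.1 \in nbr G (A (f a)) a & y.2 \in nbr G (A (f a)) a].
  have [aU|_] := boolP (a \in U); last by exists (a, a).
  have [_ _ [_ /card_gt1P[x [y [xn yn xy]]] _] _] := fP a aU.
  by exists (x, y).
have [y yP] := choice y12.
have notin a b : a \in U -> b \in U -> a != b -> a \notin A (f b).
  move=> aU bU ab; have [_ _ _ E] := fP b bU; apply: contraNN ab => ab.
  by rewrite -in_set1 -E in_setI ab (subsetP UF).
(* Otherwise [b |: A (f a)] would be monochromatic and contain a cycle. *)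
have D a b : a \in U -> b \in U -> a != b -> (y b).1 \in A (f a) -> (y b).2 \in A (f a) -> False.
  move=> aU bU ab y1 y2; have [_ mo [af _ _] _] := fP a aU.
  have bW : b \notin A (f a) by apply: notin; rewrite // eq_sym.
  have := cP (M := b |: A (f a)); rewrite deg_sumU1 //; [|exact: adj_sym|exact: adj_irr].
  rewrite cardsU1 bW.
  have -> : b |: A (f a) != finset.set0 by apply/set0Pn; exists b; rewrite setU11.
  have mo' : {in b |: A (f a) &, forall x y, c x = c y}.
    have cb x : x \in b |: A (f a) -> c x = c a.
      by rewrite in_setU1 => /predU1P[->|xf]; [apply: Uc|apply: mo].
    by move=> x x' /cb -> /cb ->.
  move=> /(_ isT mo'); have [yy yn1 yn2] := yP b bU.
  have : 1 < #|nbr G (A (f a)) b|.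
    apply/card_gt1P; exists (y b).1, (y b).2; split=> //.
      by move: yn1; rewrite !in_nbr y1 => /andP[].
    by move: yn2; rewrite !in_nbr y2 => /andP[].
  by have := deg_sum_ge Hgen (f a); lia.
(* If [tipb] tips share a first neighbour [v], it lies in all their homothets, so by [D] the second
   neighbours are private. Otherwise each of the [T] points of a homothet is the first neighbour of
   few tips, and a sparse independent set makes the first neighbours private. *)
have [V [u [VU Vb uP]]] : exists V : {set I}, exists u : I -> I, [/\ V \subset U, tipb <= #|V| &
    (forall a, a \in V -> u a \in nbr G (A (f a)) a) /\
    {in V &, forall a b, a != b -> u b \notin A (f a)}].
  have [/existsP[v Hv]|/existsPn Hn] := boolP [exists v, tipb <= #|[set a in U | (y a).1 == v]|].
    have sub : [set a in U | (y a).1 == v] \subset U by apply/subsetP => a; rewrite inE => /andP[].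
    exists [set a in U | (y a).1 == v], (fun a => (y a).2); split=> //; split.
      by move=> a /(subsetP sub) aU; case: (yP a aU).
    move=> a b /setIdP[aU /eqP ya] /setIdP[bU /eqP yb] ab; apply/negP => H.
    apply: (D a b) => //; rewrite yb -ya; have [_ + _] := yP a aU; by rewrite in_nbr => /andP[].
  have [||V VU [Vb Vi]] := @sparse_independent I (fun a b => (a \in U) && ((y b).1 \in A (f a))) (T * tipb) tipb U.
  - move=> a; have [aU|aU] := boolP (a \in U); last first.
      by rewrite (_ : [set b in U | _] = finset.set0) ?cards0 //; apply/setP => b; rewrite !inE andbF.
    have [fT _ _ _] := fP a aU.
    rewrite -sum1_card (partition_big (fun b => (y b).1) (fun v => v \in A (f a))) /=; last first.
      by move=> b; rewrite inE => /andP[].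
    rewrite -fT -sum_nat_const; apply: leq_sum => v _.
    rewrite sum1_card ltnW //; apply: leq_ltn_trans (_ : #|[set a in U | (y a).1 == v]| < _).
      by apply: subset_leq_card; apply/subsetP => b; rewrite unfold_in => /andP[/setIdP[bU _] yv]; rewrite inE bU.
    by have := Hn v; rewrite -ltnNge.
  - exact: Ub.
  exists V, (fun a => (y a).1); split=> //; split.
    by move=> a /(subsetP VU) aU; case: (yP a aU).
  by move=> a b aV bV ab; have := Vi a b aV bV ab; rewrite (subsetP VU).
have {yP D y12} [un uW] := uP.
have inW a x : a \in V -> x \in A (f a) -> x != a -> x \notin A F.
  move=> aV xf xa; have [_ _ _ E] := fP a (subsetP VU a aV).
  by apply: contraNN xa => xF; rewrite -in_set1 -E in_setI xf.
have una a : a \in V -> u a != a.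
  by move=> aV; have := un a aV; rewrite in_nbr => /andP[_]; apply: contraTneq => ->; exact: adj_irr.
have unW a : a \in V -> u a \in A (f a) by move/un; rewrite in_nbr => /andP[].
have gin a : a \in V -> inF P g (pos a).
  by move=> aV; apply/inFP => j; apply/ltW/gU/(subsetP VU).
have gout x : x \notin A F -> ~~ inF P g (pos x) by rewrite -Ag inE.
have stw a : exists o : P * P * I, a \in V ->
    [/\ exits g (pos a) (pos (u a)) o.1.1, exits g (pos a) (pos o.2) o.1.2,
       o.1.1 != o.1.2, o.2 \in A (f a) & o.2 \notin A F].
  have [aV|_] := boolP (a \in V); last by have [j _] := side_ex P; exists (j, j, a).
  have [s xs] := exit_ex (gin a aV) (gout _ (inW a _ aV (unW a aV) (una a aV))).
  (* Goodness at the exit side [s] gives a point [w] not beyond [s], which must leave through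
     another side. *)
  have [_ _ [_ _ /(_ s)[w]]] := fP a (subsetP VU a aV).
  rewrite in_setD1 => /andP[wa wf] sw _; have wF := inW a w aV wf wa.
  have [t xt] := exit_ex (gin a aV) (gout _ wF).
  exists (s, t, w) => _; split=> //=; apply/eqP => st.
  case: xt => + _; rewrite -st; have := gU a (subsetP VU a aV) s; move: sw; lra.
have [o oP] := choice stw.
have [|[s t] [p pI pP]] := @pigeon_three I _ V (fun a => (o a).1).
  by apply: leq_trans Vb; rewrite /tipb addn1.
have pV k : p k \in V by case: (pP k).
have po k : (o (p k)).1 = (s, t) by case: (pP k).
apply: (@three_tips_pts g s t p (u \o p) (fun k => (o (p k)).2) (f \o p)) => //=.
- by have [_ _ +] := oP _ (pV ord0); rewrite po.
- by move=> j k; apply/gU/(subsetP VU).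
- by move=> k; rewrite Ag; case: (fP (p k)) => //; exact: (subsetP VU).
- by move=> k; split; [exact: unW|case: (oP _ (pV k))].
- move=> k; rewrite Ag; split; last by case: (oP _ (pV k)).
  by apply: (inW (p k)); [| exact: unW | exact: una].
- by move=> k l kl; apply: uW => //; apply: contraNneq kl => /pI ->.
- by move=> k; have := un _ (pV k); rewrite in_nbr => /andP[].
- by move=> k; have [] := oP _ (pV k); rewrite po.
Qed.

End Core.

Lemma rank_rec (I : finType) (h : I -> nat) (S : I -> {set I} -> Prop) :
  (forall p (X X' : {set I}), (forall q, h q < h p -> (q \in X) = (q \in X')) -> S p X -> S p X') ->
  exists X : {set I}, forall p, p \in X <-> S p X.
Proof.
move=> ext; pose n := (\max_p h p).+1.
have hn p : h p < n by rewrite ltnS; apply: leq_bigmax.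
suff [X [_ XP]] : exists X : {set I}, (forall p, p \in X -> h p < n) /\
    forall p, h p < n -> (p \in X <-> S p X).
  by exists X => p; exact: XP.
elim: n {hn} => [|n [X [Xn XP]]]; first by exists finset.set0; split=> p; rewrite ?inE.
pose X' := X :|: [set p | (h p == n) && `[< S p X >]].
have XX' q : h q < n -> (q \in X) = (q \in X').
  by move=> qn; rewrite !inE (ltn_eqF qn) /= orbF.
exists X'; split=> p.
  by rewrite !inE => /orP[/Xn/ltnW //|/andP[/eqP -> _]].
rewrite ltnS => pn.
have eS : S p X <-> S p X'.
  by split; apply: ext => q qp; rewrite XX' //; exact: leq_trans qp pn.
have [pn'|pn'] := ltnP (h p) n; first by rewrite -XX' // XP.
have pE : h p = n by apply/eqP; rewrite eqn_leq pn.
have pX : p \notin X by apply/negP => /Xn; rewrite pE ltnn.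
rewrite !inE (negbTE pX) pE eqxx /=; split; first by move=> /asboolP/eS.
by move=> H; apply/asboolP/eS.
Qed.

Lemma avn_gt0 C k M : 0 < M -> 0 < avn C k M.
Proof. by case: k. Qed.

(** * The final colouring *)

Section Final.
Variables (R : realType) (P : polygon R) (C : nat).
Hypothesis HC : cover_const P C.

Let T := avn C #|P| 3.
Let K0 := (2 * (T * tipb P) + 1) * tipb P.
(** The size that refutes a monochromatic homothet whose recoloured points have labels below [i];
    each label costs the avoidance of up to [K0] tips. *)
Fixpoint msize (i : nat) := if i is i'.+1 then avn C K0 (msize i') else T.

Variables (I : finType) (pos : I -> R * R).
Hypothesis Hgen : forall j : P, injective (fun x => L j (pt (pos x))).
Hypothesis Hy : injective (fun x => (pos x).2).
Local Notation A := (A P pos).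

Lemma three_colour : exists c : I -> 'I_3, forall f, msize (6 ^ T) <= #|A f| ->
  exists x y, [/\ x \in A f, y \in A f & c x != c y].
Proof.
have [c cP] := @colour_ex _ P _ _ Hy.
have [h hT hI] := @label_ex _ P _ _ Hgen Hy T [set: I].
(* [X] collects the points to be recoloured, chosen in order of increasing label [h]. *)
pose wit p (X : {set I}) f :=
  [/\ #|A f| = T, mono c (A f), good P pos p (A f) & forall q, q \in A f -> q \in X -> ~~ (h q < h p)].
have [|X XP] := @rank_rec I h (fun p X => exists f, wit p X f).
  move=> p X X' E [f [f1 f2 f3 f4]]; exists f; split=> // q qf qX'; apply/negP => qp.
  by have := f4 q qf; rewrite E // qp => /(_ qX').
pose c' p := if p \in X then (c p + 1)%R else c p.
exists c' => F FM; apply: contrapT => nF.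
have mF : mono c' (A F).
  by move=> x y xF yF; apply/eqP/negPn/negP => xy; apply: nF; exists x, y.
have {}nF : forall p, p \in A F -> p \in X -> h p < 6 ^ T by move=> p _ _.
elim: (6 ^ T) F FM mF nF => [|i IH] F FM mF hF.
  have XF p : p \in A F -> p \notin X by move=> pF; apply/negP => /(hF p pF).
  have T0 : 0 < T by apply: avn_gt0.
  have /card_gt0P[x xF] : 0 < #|A F| by apply: leq_trans FM.
  have [|| g xg []] := @sub_size _ P _ _ Hgen [set: I] F x T; rewrite ?finset.setIT ?xF // ?T0 //.
  move=> gF gT; have [|p pg] := @good_ex _ P _ _ C HC Hgen g; first by rewrite gT.
  have pF : p \in A F by case: pg => /(subsetP gF).
  case/negP: (XF p pF); apply/XP; exists g; split=> //.
    move=> a b /(subsetP gF) aF /(subsetP gF) bF; have := mF a b aF bF.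
    by rewrite /c' (negbTE (XF a aF)) (negbTE (XF b bF)).
  by move=> q /(subsetP gF) /XF /negbTE ->.
pose U := [set p in A F :&: X | h p == i].
have UP p : p \in U -> [/\ p \in A F, p \in X & h p = i].
  by move=> /setIdP[/setIP[pF pX] /eqP].
have Hf p : exists f, p \in X -> wit p X f.
  have [pX|_] := boolP (p \in X); last by exists (0, 0, 0)%R.
  by have /XP[f fw] := pX; exists f.
have [f fP] := choice Hf.
have cU : {in U &, forall a b, c a = c b}.
  move=> a b /UP[aF aX _] /UP[bF bX _]; have := mF a b aF bF.
  by rewrite /c' aX bX => /addIr.
have Us : #|U| < K0.
  apply: (tips_small (c := c) (F := F) (f := f) Hgen cP) => //.
    by apply/subsetP => p /UP[].
  move=> p /[dup] pU /UP[pF pX pi]; have [w1 w2 w3 w4] := fP p pX; split=> //.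
  have pf : p \in A (f p) by case: w3.
  (* A common point [q] is recoloured, since it agrees with [p] in the old and in the new colour.
     Its label is at most [i] in [F] and at least [i] in the witness, so it is [p]. *)
  apply/setP => q; rewrite in_set1 in_setI; apply/andP/eqP => [[qf qF]|-> //].
  have qX : q \in X.
    apply/negPn/negP => qX; have := mF p q pF qF; rewrite /c' pX (negbTE qX).
    rewrite (w2 p q pf qf) => /eqP; rewrite -subr_eq0 addrC addKr oner_eq0.
    by [].
  have qi : h q = i.
    by have := hF q qF qX; have := w4 q qf qX; rewrite pi; lia.
  by apply: (hI (f p)); rewrite ?finset.setIT ?w1 ?pi ?qi.
have [g gF gM] := avoid HC Hgen (ltnW Us) FM.
have gF' p : p \in A g -> p \in A F /\ p \notin U.
  by move=> /(subsetP gF); rewrite in_setD => /andP[].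
apply: (IH g) => //.
  by move=> a b /gF'[aF _] /gF'[bF _]; exact: mF.
move=> p /gF'[pF pU] pX; have := hF p pF pX; rewrite ltnS leq_eqVlt => /orP[pi|//].
by case/negP: pU; rewrite inE in_setI pF pX.
Qed.

End Final.

Local Open Scope ring_scope.

(** * From vertices to side functionals *)

Definition xy (R : realType) (v : 'rV[R]_2) : R * R := (v 0 0, v 0 1).

Lemma rV2_eq (R : realType) (u v : 'rV[R]_2) : xy u = xy v -> u = v.
Proof.
case=> e0 e1; apply/rowP => k; have [k0|k1] : k = 0 \/ k = 1.
  by case: k => [[|[|k]] hk] //; [left|right]; apply: val_inj.
- by rewrite k0.
- by rewrite k1.
Qed.

Lemma sum_delta (R : realType) (I : finType) (a : I) (s : R) (F : I -> R) :
  \sum_k (if k == a then s else 0) * F k = s * F a.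
Proof.
by rewrite (bigD1 a) //= eqxx big1 ?addr0 // => k /negbTE ->; rewrite mul0r.
Qed.

Lemma hull_weights (R : realType) (n : nat) (p : 'I_n -> 'rV[R]_2) i (w : 'I_n -> R) :
  ~ conv_hull (p \o lift i) (p i) -> (forall k, 0 <= w k) -> w i = 0 -> 0 < \sum_k w k ->
  \sum_k w k * (p k 0 0 - p i 0 0) = 0 -> \sum_k w k * (p k 0 1 - p i 0 1) = 0 -> False.
Proof.
move=> ext w0 wi ws ex ey; set s := \sum_k w k in ws; have sn : s != 0 by rewrite gt_eqF.
have ex' : \sum_k w k * p k 0 0 = s * p i 0 0.
  by move: ex; under eq_bigr do rewrite mulrBr; rewrite sumrB -mulr_suml -/s; lra.
have ey' : \sum_k w k * p k 0 1 = s * p i 0 1.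
  by move: ey; under eq_bigr do rewrite mulrBr; rewrite sumrB -mulr_suml -/s; lra.
apply: ext; exists (fun m => w (lift i m) / s); split.
- by move=> m; rewrite divr_ge0 // ltW.
- rewrite -mulr_suml; apply: (mulIf sn); rewrite divfK // mul1r.
  by rewrite [RHS](bigD1_ord i) //= wi add0r.
- apply: rV2_eq; rewrite /xy !summxE; congr (_, _).
    apply: (mulfI sn); rewrite -ex' mulr_sumr (bigD1_ord i) //= wi mul0r add0r.
    by apply: eq_bigr => m _; rewrite mxE /=; field.
  apply: (mulfI sn); rewrite -ey' mulr_sumr (bigD1_ord i) //= wi mul0r add0r.
  by apply: eq_bigr => m _; rewrite mxE /=; field.
Qed.

Section Ngon.
Variables (R : realType) (n : nat) (X Y : 'I_n -> R).
Implicit Types (i j k l a b c : 'I_n).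
Hypothesis n3 : (3 <= n)%N.
Hypothesis ext : forall i (w : 'I_n -> R), (forall k, 0 <= w k) -> w i = 0 -> 0 < \sum_k w k ->
  \sum_k w k * (X k - X i) = 0 -> \sum_k w k * (Y k - Y i) = 0 -> False.

Local Notation V i := (X i, Y i, 1).
Local Notation D i j k := (det3 (V i) (V j) (V k)).

Lemma hull_triple i a b c (s t u : R) : a != i -> b != i -> c != i ->
  0 <= s -> 0 <= t -> 0 <= u -> 0 < s + t + u ->
  s * (X a - X i) + t * (X b - X i) + u * (X c - X i) = 0 ->
  s * (Y a - Y i) + t * (Y b - Y i) + u * (Y c - Y i) = 0 -> False.
Proof.
move=> ai bi ci s0 t0 u0 stu e1 e2.
pose w k : R := (if k == a then s else 0) + (if k == b then t else 0) + (if k == c then u else 0).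
have wF (F : 'I_n -> R) : \sum_k w k * F k = s * F a + t * F b + u * F c.
  by under eq_bigr do rewrite !mulrDl; rewrite !big_split /= !sum_delta.
apply: (@ext i w); rewrite ?wF //.
- by move=> k; rewrite /w !addr_ge0 //; case: ifP.
- by rewrite /w ![i == _]eq_sym (negbTE ai) (negbTE bi) (negbTE ci) !addr0.
- have -> : \sum_k w k = \sum_k w k * 1 by apply: eq_bigr => k _; rewrite mulr1.
  by rewrite wF !mulr1.
Qed.

(** Of three collinear vertices one lies between the others; comparing the ratio [d / e] with 0 and
    1 tells which. *)
Lemma D_neq0 j k l : k != j -> l != j -> l != k -> D j k l != 0.
Proof.
move=> kj lj lk; apply/eqP; rewrite /det3 /= => D0.
have jk : j != k by rewrite eq_sym.
have jl : j != l by rewrite eq_sym.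
have kl : k != l by rewrite eq_sym.
have dist a b : a != b -> X a - X b = 0 -> Y a - Y b = 0 -> False.
  by move=> ab e1 e2; apply: (@hull_triple b a a a 1 0 0) => //; lra.
have main (d e : R) (De : (X l - X j) * e = d * (X k - X j)) (De' : (Y l - Y j) * e = d * (Y k - Y j)) :
    e != 0 -> False.
  move=> e0; wlog ep : d e De De' e0 / 0 < e.
    move=> W; case: (ltgtP e 0) => h; [|exact: (W d e)|by rewrite h eqxx in e0].
    by apply: (W (- d) (- e)); rewrite ?oppr_eq0 ?oppr_gt0 //; lra.
  have [dn|dn] := ltP d 0.
    by apply: (@hull_triple j k l l (- d) e 0) => //; lra.
  have [de|de] := leP d e.
    by apply: (@hull_triple l k j j d (e - d) 0) => //; lra.
  by apply: (@hull_triple k l j j e (d - e) 0) => //; lra.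
have [ex|ex] := eqVneq (X k - X j) 0; last by apply: (main (X l - X j) (X k - X j)) => //; lra.
have [ey|ey] := eqVneq (Y k - Y j) 0; last by apply: (main (Y l - Y j) (Y k - Y j)) => //; lra.
exact: dist kj ex ey.
Qed.

(** Scan the vertices, replacing the candidate [k'] by [m] when [m] lies to its right as seen from
    [j]. If some [l] were then to the right of [m], the vertex [j] would be in the hull of [m],
    [k'], [l], with the determinants as weights. *)
Lemma first_ex j : exists k, k != j /\ forall l, l != j -> 0 <= D j k l.
Proof.
pose s := [seq k <- enum 'I_n | k != j].
have [k kj] : exists k, k \in s.
  have /card_gt0P[k kj] : (0 < #|[set~ j]|)%N by have := cardsC1 j; rewrite card_ord; lia.
  by exists k; move: kj; rewrite mem_filter mem_enum !inE => ->.
suff H (r : seq 'I_n) : r != [::] -> all (fun k => k != j) r ->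
    exists k, k \in r /\ forall l, l \in r -> 0 <= D j k l.
  have [||k' [ks kP]] := H s; first by case: (s) kj.
    by apply/allP => m; rewrite mem_filter => /andP[].
  exists k'; split; first by move: ks; rewrite mem_filter => /andP[].
  by move=> l lj; apply: kP; rewrite mem_filter lj mem_enum.
elim: r => [|m r IH] // _ /= /andP[mj rj].
have Dmm a : D j a a = 0 by rewrite /det3 /=; ring.
have [->|r0] := eqVneq r [::].
  by exists m; rewrite inE eqxx; split=> // l; rewrite inE => /eqP ->; rewrite Dmm.
have [k' [kr kP]] := IH r0 rj; have k'j := allP rj _ kr.
have [km|km] := leP 0 (D j k' m).
  exists k'; rewrite inE kr orbT; split=> // l; rewrite inE => /predU1P[-> //|]; exact: kP.
exists m; rewrite inE eqxx; split=> // l; rewrite inE => /predU1P[->|lr]; first by rewrite Dmm.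
have lj := allP rj _ lr; rewrite leNgt; apply/negP => ml; have kl := kP l lr.
apply: (@hull_triple j m k' l (D j k' l) (- D j m l) (- D j k' m)) => //.
- lra.
- lra.
- lra.
- by rewrite /det3 /=; ring.
- by rewrite /det3 /=; ring.
Qed.

Lemma ngon_nxt : exists nx : 'I_n -> 'I_n, forall j, nx j != j /\
  forall l, l != j -> l != nx j -> 0 < D j (nx j) l.
Proof.
have H j : exists k, k != j /\ forall l, l != j -> l != k -> 0 < D j k l.
  have [k [kj kP]] := first_ex j; exists k; split=> // l lj lk.
  by rewrite lt_neqAle kP // andbT eq_sym D_neq0.
by have [nx nxP] := choice H; exists nx.
Qed.

(** Fan triangulation from [o]: [z] lies in the cone of a triangle [o], [k], [nx k] where [phi]
    changes sign, with weights given by Cramer's rule. Without a sign change, [phi] would stay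
    positive along the orbit of [nx] up to the predecessor of [o], where it is at most 0. *)
Lemma ngon_cone (nx : 'I_n -> 'I_n) : (forall j, nx j != j /\
    forall l, l != j -> l != nx j -> 0 < D j (nx j) l) ->
  forall z, (forall j, 0 <= det3 (V j) (V (nx j)) z) ->
  exists w : 'I_n -> R, [/\ forall l, 0 <= w l,
      z.1.1 = \sum_l w l * X l, z.1.2 = \sum_l w l * Y l & z.2 = \sum_l w l].
Proof.
move=> nxP z Kz; have nxj j : nx j != j by case: (nxP j).
have nxD j l : l != j -> l != nx j -> 0 < D j (nx j) l by case: (nxP j) => _; apply.
have third a b : exists c, c != a /\ c != b.
  have /card_gt0P[c] : (0 < #|~: [set a; b]|)%N.
    by have := cardsC [set a; b]; rewrite card_ord cards2; case: (a != b) => /=; lia.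
  by rewrite !inE negb_or => /andP[ca cb]; exists c.
have nx2 j : nx (nx j) != j.
  apply/eqP => E; have [c [c1 c2]] := third j (nx j).
  have := nxD j c c1 c2; have := nxD (nx j) c c2; rewrite E => /(_ c1).
  by rewrite /det3; lra.
have nx_inj : injective nx.
  move=> a b E; apply/eqP/negPn/negP => ab; have ba : b != a by rewrite eq_sym.
  have b1 : b != nx a by rewrite E eq_sym.
  have a1 : a != nx b by rewrite -E eq_sym.
  by have := nxD a b ba b1; have := nxD b a ab a1; rewrite E /det3; lra.
have o : 'I_n := Ordinal (leq_trans (isT : 0 < 3)%N n3).
pose phi k := det3 (V o) (V k) z.
have [k [ko nko [pk pnk]]] : exists k, [/\ k != o, nx k != o & 0 <= phi k /\ phi (nx k) <= 0].
  apply: contrapT => Hn.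
  have step k : k != o -> nx k != o -> 0 <= phi k -> 0 < phi (nx k).
    by move=> ko nko pk; rewrite ltNge; apply/negP => pnk; apply: Hn; exists k.
  have orb m : let k := iter m nx o in k = o \/ 0 <= phi k /\ (k != nx o -> 0 < phi k).
    elim: m => [|m IH] /=; first by left.
    have [ko|ko] := eqVneq (iter m nx o) o.
      by right; rewrite ko eqxx; split=> //; exact: Kz.
    have [nko|nko] := eqVneq (nx (iter m nx o)) o; first by left.
    case: IH => [E|[k0 _]]; first by rewrite E eqxx in ko.
    by right; have := step _ ko nko k0; split=> //; exact: ltW.
  have : iter (fingraph.order nx o) nx o = o by apply: fingraph.iter_order.
  rewrite -(prednK (fingraph.order_gt0 nx o)) iterS; set k := iter _ nx o => ko.
  have [E|[_ H]] := orb (fingraph.order nx o).-1; first by have := nxj o; rewrite -{1}E -/k ko eqxx.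
  have : k != nx o by apply/eqP => E; have := nx2 o; rewrite -E ko eqxx.
  by move=> /H; have := Kz k; rewrite ko -/k /phi /det3; lra.
have d0 : 0 < D o k (nx k).
  by have := nxD k o; rewrite eq_sym ko eq_sym nko => /(_ isT isT); rewrite /det3; lra.
have dn : D o k (nx k) != 0 by rewrite gt_eqF.
set d := D o k (nx k) in d0 dn.
pose A0 := det3 (V k) (V (nx k)) z / d.
pose A1 := - phi (nx k) / d.
pose A2 := phi k / d.
pose w l : R := (if l == o then A0 else 0) + (if l == k then A1 else 0) + (if l == nx k then A2 else 0).
have wF (F : 'I_n -> R) : \sum_k w k * F k = A0 * F o + A1 * F k + A2 * F (nx k).
  by under eq_bigr do rewrite !mulrDl; rewrite !big_split /= !sum_delta.
have e0 : A0 * d = det3 (V k) (V (nx k)) z by rewrite divfK.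
have e1 : A1 * d = - phi (nx k) by rewrite divfK.
have e2 : A2 * d = phi k by rewrite divfK.
have comb (r ro rk rn : R) : r * d = A0 * d * ro + A1 * d * rk + A2 * d * rn ->
    r = A0 * ro + A1 * rk + A2 * rn.
  by move=> E; apply: (mulIf dn); rewrite E; ring.
exists w; split; rewrite ?wF.
- have a0 : 0 <= A0 by rewrite divr_ge0 ?Kz // ltW.
  have a1 : 0 <= A1 by rewrite divr_ge0 ?oppr_ge0 // ltW.
  have a2 : 0 <= A2 by rewrite divr_ge0 // ltW.
  by move=> l; rewrite /w !addr_ge0 //; case: ifP.
- by apply: comb; rewrite e0 e1 e2 /phi /d /det3 /=; ring.
- by apply: comb; rewrite e0 e1 e2 /phi /d /det3 /=; ring.
- have -> : \sum_l w l = \sum_l w l * 1 by apply: eq_bigr => l _; rewrite mulr1.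
  by rewrite wF; apply: comb; rewrite e0 e1 e2 /phi /d /det3 /=; ring.
Qed.

End Ngon.

Lemma ngon_polygon (R : realType) (n : nat) (D : set 'rV[R]_2) : convex_ngon n D ->
  exists P : polygon R, forall H, homothet D H -> exists f, forall x, H x <-> inF P f (xy x).
Proof.
move=> [nge3 [p [ext ->]]]; pose X i := p i 0 0; pose Y i := p i 0 1.
pose V i : R * R * R := (X i, Y i, 1).
have extw i w : (forall k, 0 <= w k) -> w i = 0 -> 0 < \sum_k w k ->
    \sum_k w k * (X k - X i) = 0 -> \sum_k w k * (Y k - Y i) = 0 -> False.
  exact: hull_weights.
have [nx nxP] := ngon_nxt nge3 extw.
have vs j l : l != j -> l != nx j -> 0 < det3 (V j) (V (nx j)) (V l) by case: (nxP j) => _; apply.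
have vo j : exists l, (l != j) && (l != nx j).
  have /card_gt0P[c] : (0 < #|~: [set j; nx j]|)%N.
    by have := cardsC [set j; nx j]; rewrite card_ord cards2; case: (j != nx j) => /=; lia.
  by rewrite !inE negb_or => cc; exists c.
pose P := @Polygon R 'I_n V nx (fun=> erefl) vs vo (ngon_cone nge3 nxP).
exists P => H [la [v [la0 ->]]]; exists (v 0 0, v 0 1, - la) => x.
split=> [[d [w [w0 w1 ->]] <-]|/inFP xf].
  apply/inFP => j.
  have e (a : 'I_2) : (la *: (\sum_i w i *: p i) + v) 0 a = la * (\sum_i w i * p i 0 a) + v 0 a.
    by rewrite !mxE summxE; congr (_ * _ + _); apply: eq_bigr => i _; rewrite mxE.
  have -> : L j (pt (xy (la *: (\sum_i w i *: p i) + v))) =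
      L j (v 0 0, v 0 1, - la) + la * \sum_i w i * L j (V i).
    have -> : \sum_i w i * L j (V i) =
        n1 j * (\sum_i w i * p i 0 0) + n2 j * (\sum_i w i * p i 0 1) + n3 j * (\sum_i w i).
      rewrite !mulr_sumr -!big_split /=; apply: eq_bigr => i _.
      by rewrite /L /V /X /Y /=; ring.
    by rewrite w1 /L /pt /xy !e /=; ring.
  rewrite lerDl mulr_ge0 ?(ltW la0) // sumr_ge0 // => i _.
  by rewrite mulr_ge0 // (@L_vtx_ge0 _ P).
have [j|w [w0 e1 e2 e3]] := @cone_gen _ P (vadd (pt (xy x)) (-1) (v 0 0, v 0 1, - la)).
  by rewrite -(LE (P := P)) L_vadd; have := xf j; lra.
move: e1 e2 e3; rewrite /= => e1 e2 e3.
have lan : la != 0 by rewrite gt_eqF.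
exists (\sum_i (w i / la) *: p i).
  exists (fun i => w i / la); split=> //; first by move=> i; rewrite divr_ge0 // ltW.
  by rewrite -mulr_suml -e3 (_ : 0 + -1 * - la = la) ?divff //; ring.
have e (a : 'I_2) : (la *: (\sum_i (w i / la) *: p i) + v) 0 a = (\sum_i w i * p i 0 a) + v 0 a.
  rewrite !mxE summxE mulr_sumr; congr (_ + _); apply: eq_bigr => i _.
  by rewrite mxE; field.
by apply: rV2_eq; rewrite /xy !e -e1 -e2; congr (_, _); ring.
Qed.

(** * Perturbation to general position *)

Section Perturb.
Variables (R : realType) (P : polygon R) (I : finType) (pos0 : I -> R * R).
Implicit Types (x y : I) (j : P).

Definition idx x : R := (enum_rank x)%:R.
(** Moving the coordinates at the orders [s] and [s ^+ 2] makes a coincidence along any nonzero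
    normal a nonzero polynomial condition on [s]. *)
Definition moved (s : R) x : R * R := ((pos0 x).1 + s * idx x, (pos0 x).2 + s ^+ 2 * idx x).

Lemma L_moved s x j : L j (pt (moved s x)) =
  L j (pt (pos0 x)) + s * idx x * (n1 j + s * n2 j).
Proof. by rewrite /L /pt /moved /=; ring. Qed.

(** After [robust], contained points satisfy all sides strictly and excluded ones violate one
    strictly; both survive small moves. *)
Lemma moved_pattern f : exists gd : (R * R * R) * R, 0 < gd.2 /\
  forall s : R, 0 < s < gd.2 -> A P (moved s) gd.1 = A P pos0 f.
Proof.
have [g gf Ag] := robust P pos0 f.
pose q (xj : I * P) := `|L xj.2 (pt (pos0 xj.1)) - L xj.2 g|.
pose F (xj : I * P) := if q xj == 0 then 1 else
  q xj / (idx xj.1 * (`|n1 xj.2| + `|n2 xj.2|) + 1).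
have d0 (xj : I * P) : 0 < idx xj.1 * (`|n1 xj.2| + `|n2 xj.2|) + 1.
  by rewrite ltr_wpDl // mulr_ge0 ?addr_ge0 // ler0n.
have [e e0 eP] : exists2 e : R, 0 < e & forall xj, e <= F xj.
  apply: fin_pos_lb => xj; rewrite /F; case: ifPn => // q0.
  by rewrite divr_gt0 // lt_neqAle eq_sym q0 normr_ge0.
exists (g, Num.min e 1); split; first by rewrite /= lt_min e0 ltr01.
move=> s /=; rewrite lt_min => /and3P[s0 se s1].
have near x j : L j (pt (pos0 x)) != L j g ->
    `|L j (pt (moved s x)) - L j (pt (pos0 x))| < `|L j (pt (pos0 x)) - L j g|.
  move=> ne; have := eP (x, j); rewrite /F /q /= normr_eq0 subr_eq0 (negbTE ne).
  rewrite ler_pdivlMr ?(d0 (x, j)) // => h; rewrite L_moved addrAC subrr add0r.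
  apply: lt_le_trans h; rewrite !normrM (gtr0_norm s0) (ger0_norm (ler0n _ _)) -mulrA.
  apply: le_lt_trans (_ : s * (idx x * (`|n1 j| + `|n2 j|) + 1) < _).
    rewrite ler_wpM2l ?(ltW s0) //; apply: le_trans (_ : idx x * (`|n1 j| + `|n2 j|) <= _).
      rewrite ler_wpM2l ?ler0n //; apply: le_trans (ler_normD _ _) _.
      by rewrite lerD2l normrM (gtr0_norm s0) ler_piMl // ltW.
    by rewrite lerDl.
  by rewrite ltr_pM2r // (d0 (x, j)).
rewrite -Ag; apply/setP => x; rewrite !inE; apply/idP/idP => [/inFP H|H].
  apply/negPn/negP => /inFPn[j Hj]; have := near x j; rewrite lt_eqF // => /(_ isT).
  rewrite [X in _ < X]ltr0_norm ?subr_lt0 // => /(le_lt_trans (ler_norm _)).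
  by have := H j; lra.
have Hs j : L j g < L j (pt (pos0 x)).
  have : x \in A P pos0 f by rewrite -Ag inE.
  by rewrite inE => /inFP/(_ j); exact: lt_le_trans.
apply/inFP => j; have := near x j; rewrite gt_eqF // => /(_ isT).
rewrite [X in _ < X]gtr0_norm ?subr_gt0 // ltr_norml => /andP[+ _].
by lra.
Qed.

Lemma normal_neq0 j : (n1 j != 0) || (n2 j != 0).
Proof.
rewrite -negb_and; apply/negP => /andP[/eqP a /eqP b].
have := L_vtx_self j; have [l /andP[l1 l2]] := vtx_off j; have := L_vtx_gt0 l1 l2.
by rewrite /L a b !mul0r !add0r !vtx_t; lra.
Qed.

Lemma generic_ex : exists pos : I -> R * R,
  [/\ forall j, injective (fun x => L j (pt (pos x))), injective (fun x => (pos x).2) &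
   forall f, exists g, A P pos g = A P pos0 f].
Proof.
(* The threshold is chosen per trace [B], not per homothet: there are finitely many traces, so one
   [s] serves all. Sets that are no trace get a dummy value. *)
have Hp (B : {set I}) : exists gd : (R * R * R) * R, 0 < gd.2 /\ forall f, A P pos0 f = B ->
   forall s : R, 0 < s < gd.2 -> A P (moved s) gd.1 = B.
  have [[f fB]|nf] := pselect (exists f, A P pos0 f = B); last first.
    by exists ((0, 0, 0), 1); split=> //= f fB; case: nf; exists f.
  have [gd [gd0 gdP]] := moved_pattern f; exists gd; split=> // f' _ s /gdP ->; exact: fB.
have [gd gdP] := choice Hp.
have [d d0 dP] : exists2 d : R, 0 < d & forall B, d <= (gd B).2.
  by apply: fin_pos_lb => B; case: (gdP B).
pose q (t : option P * I * I) : {poly R} := if t.1.2 == t.2 then 1 else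
  if t.1.1 is Some j then
    (L j (pt (pos0 t.1.2)) - L j (pt (pos0 t.2)))%:P
     + ((idx t.1.2 - idx t.2) * n1 j)%:P * 'X + ((idx t.1.2 - idx t.2) * n2 j)%:P * 'X^2
  else ((pos0 t.1.2).2 - (pos0 t.2).2)%:P + (idx t.1.2 - idx t.2)%:P * 'X^2.
have idxn x y : x != y -> idx x - idx y != 0.
  by move=> xy; rewrite subr_eq0 eqr_nat; apply: contraNneq xy => /val_inj/enum_rank_inj ->.
have [|s /andP[s0 sd] qs] := @poly_avoid _ _ q d d0.
  move=> [[oj x] y]; rewrite /q /=; have [_|xy] := eqVneq x y; first exact: oner_neq0.
  have xn := idxn x y xy; case: oj => [j|]; apply/eqP => q0; last first.
    have := congr1 (fun p : {poly R} => p`_2) q0; rewrite !coefE /= => h.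
    by case/eqP: xn; lra.
  have h1 := congr1 (fun p : {poly R} => p`_1) q0; have h2 := congr1 (fun p : {poly R} => p`_2) q0.
  move: h1 h2; rewrite !coefE /= => h1 h2.
  have [/eqP|/eqP] := orP (normal_neq0 j); apply; apply: (mulfI xn); lra.
exists (moved s); split.
- move=> j x y /= E; apply/eqP/negPn/negP => xy.
  have := qs (Some j, x, y); rewrite /q /= (negbTE xy) !(hornerD, hornerM, hornerC, hornerX, hornerXn) => /eqP; apply.
  by move: E; rewrite !L_moved; lra.
- move=> x y /= E; apply/eqP/negPn/negP => xy.
  have := qs (None, x, y); rewrite /q /= (negbTE xy) !(hornerD, hornerM, hornerC, hornerX, hornerXn) => /eqP; apply.
  by move: E; lra.
- move=> f; exists (gd (A P pos0 f)).1; case: (gdP (A P pos0 f)) => _; apply; first by [].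
  by rewrite s0; apply: lt_le_trans (dP _).
Qed.

End Perturb.

Local Open Scope card_scope.
Local Open Scope classical_set_scope.
Local Open Scope ring_scope.

(* [`I_m #<= A] says that A has at least m elements. *)
Theorem theorem2 (R : realType) (n : nat) (D : set 'rV[R]_2)
    (hD : convex_ngon n D) :
  exists m : nat, (0 < m)%N /\
    forall S : set 'rV[R]_2, finite_set S ->
      exists c : 'rV[R]_2 -> 'I_3,
        forall H : set 'rV[R]_2, homothet D H ->
          `I_m #<= S `&` H ->
          exists x y : 'rV[R]_2,
            [/\ (S `&` H) x, (S `&` H) y & c x <> c y].
Proof.
have [P PH] := ngon_polygon hD; have [C HC] := avoid_cover P.
exists (msize P C (6 ^ avn C #|P| 3)).+1; split=> // S /finite_seqP[s ->].
pose I : finType := seq_sub s.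
have [pos [Hg Hy pat]] := @generic_ex R P I (fun x => xy (ssval x)).
have [c cP] := @three_colour R P C HC I pos Hg Hy.
exists (fun x => if insub x is Some i then c (i : I) else ord0) => H HH mS.
have [f fP] := PH H HH; have [g gE] := pat f.
have memA (i : I) : i \in A P pos g -> ([set` s] `&` H) (ssval i).
  by rewrite gE inE => /fP Hi; split=> //; exact: ssvalP.
have [|x [y [xg yg cxy]]] := cP g.
  have sub : [set` s] `&` H `<=` (fun k : nat => nth 0 [seq ssval i | i : I <- enum (A P pos g)] k) @` `I_#|A P pos g|.
    move=> x [/= xs Hx]; have xA : (SeqSub xs : I) \in A P pos g by rewrite gE inE; apply/fP.
    have xm : x \in [seq ssval i | i : I <- enum (A P pos g)].
      by apply/mapP; exists (SeqSub xs : I); rewrite ?mem_enum.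
    exists (index x [seq ssval i | i : I <- enum (A P pos g)]); last by rewrite nth_index.
    by move: xm; rewrite -index_mem size_map -cardE.
  have := card_le_trans (card_le_trans mS (subset_card_le sub)) (card_image_le _ _).
  by rewrite card_le_II; exact: ltnW.
exists (ssval x), (ssval y); split; [exact: memA|exact: memA|].
by rewrite !valK; exact/eqP.
Qed.
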